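(* Let $\mu\ge 0$ and let $\omega\in\mathbb{R}\setminus\mathbb{Q}$ be $\mu$-well approximable. Let $h_0(x,x')=\frac12(x-x')^2$. Then for every real $r$ with $0\le r<3+\mu$ and every $\epsilon>0$ there exists a real trigonometric polynomial $R_N(x)$ (of period $1$, of some degree $N$) with $\|R_N\|_{C^r}<\epsilon$ such that the exact area-preserving twist map generated by $h(x,x')=h_0(x,x')+R_N(x')$ admits no invariant circle with frequency $\omega$.
   Context: An irrational $\omega$ is called $\mu$-well approximable if there are infinitely many $q_n\in\mathbb{N}$ and integers $p_n$ with $|q_n\omega-p_n|<q_n^{-1-\mu}$. A function $h:\mathbb{R}^2\to\mathbb{R}$ with $h(x+1,x'+1)=h(x,x')$ and suitable twist condition generates the map $F(x,y)=(x',y')$ of $\mathbb{R}^2$ defined implicitly by $y=-\partial_1h(x,x')$, $y'=\partial_2 h(x,x')$; it commutes with $(x,y)\mapsto(x+1,y)$ and induces an exact area-preserving twist map $f$ of the cylinder $\mathbb{T}\times\mathbb{R}$, $\mathbb{T}=\mathbb{R}/\mathbb{Z}$. An invariant circle is an $f$-invariant simple closed curve in the cylinder that is not homotopic to a point; it has frequency $\omega$ if the restriction of $f$ to it (a circle homeomorphism) has rotation number $\omega$ (with respect to the lift $F$). For $u\in C^r(\mathbb{T})$, $\|u\|_{C^r}=\max_{0\le j\le r}\max_{x\in\mathbb{T}}|u^{(j)}(x)|$, the maximum over integer orders $j\le r$. *)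

(* Defs.v *)
From Stdlib Require Import Reals Lra List.
From Coquelicot Require Import Coquelicot.
Open Scope R_scope.

Definition irrational (w : R) : Prop :=
  forall (p : Z) (q : nat), (0 < q)%nat -> w <> IZR p / INR q.

Definition well_approximable (mu w : R) : Prop :=
  irrational w /\
  forall M : nat, exists q : nat, (M < q)%nat /\
    exists p : Z, Rabs (INR q * w - IZR p) < Rpower (INR q) (-1 - mu).

Definition trig_poly (N : nat) (a b : nat -> R) (x : R) : R :=
  a 0%nat + fold_right Rplus 0
    (map (fun k => a k * cos (2 * PI * INR k * x) + b k * sin (2 * PI * INR k * x))
         (seq 1 N)).

(* ||u||_{C^r} = max_{0 <= j <= r, j integer} max_x |u^(j)(x)|, taken as a
   supremum (it is attained for the periodic smooth u considered here). *)
Definition Cr_norm (r : R) (u : R -> R) : Rbar :=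
  Lub_Rbar (fun v => exists (j : nat) (x : R),
    INR j <= r /\ v = Rabs (Derive_n u j x)).

(* the (lifted) map F generated by h, as a relation:
   F(x,y) = (x',y') iff y = -d1 h(x,x') and y' = d2 h(x,x') *)
Definition gen_map (h : R -> R -> R) (p q : R * R) : Prop :=
  snd p = - Derive (fun s => h s (fst q)) (fst p) /\
  snd q = Derive (fun s => h (fst p) s) (fst q).

Definition h0 (x x' : R) : R := (x - x') ^ 2 / 2.

(* Lift G : R -> R^2 of a closed curve c : T -> T x R; the full lift of its
   image to the plane R^2. *)
Definition lifted_set (G : R -> R * R) (p : R * R) : Prop :=
  exists (t : R) (m : Z), p = (fst (G t) + IZR m, snd (G t)).

(* G is the lift of a simple closed curve in the cylinder T x R that is not
   homotopic to a point: continuous, G(t+1) = G(t) + (k,0) with k <> 0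
   (k = degree), and the induced map T -> T x R is injective. *)
Definition noncontractible_simple_closed_curve (G : R -> R * R) : Prop :=
  (forall t, continuous (fun s => fst (G s)) t /\ continuous (fun s => snd (G s)) t) /\
  (exists k : Z, k <> 0%Z /\
     forall t, G (t + 1) = (fst (G t) + IZR k, snd (G t))) /\
  (forall s t, (exists m : Z, G s = (fst (G t) + IZR m, snd (G t))) ->
     exists n : Z, s = t + IZR n).

(* the curve is f-invariant (f(C) = C), expressed on the lift with F *)
Definition invariant_curve (F : R * R -> R * R -> Prop) (G : R -> R * R) : Prop :=
  (forall p q, lifted_set G p -> F p q -> lifted_set G q) /\
  (forall q, lifted_set G q -> exists p, lifted_set G p /\ F p q).

(* rotation number w.r.t. the lift F: every orbit on the curve has
   x_n / n -> w *)
Definition has_frequency (F : R * R -> R * R -> Prop) (G : R -> R * R) (w : R) : Prop :=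
  forall p : nat -> R * R, lifted_set G (p 0%nat) ->
    (forall n, F (p n) (p (S n))) ->
    is_lim_seq (fun n => fst (p n) / INR n) w.

Definition invariant_circle_with_frequency
  (F : R * R -> R * R -> Prop) (w : R) : Prop :=
  exists G : R -> R * R,
    noncontractible_simple_closed_curve G /\ invariant_curve F G /\ has_frequency F G w.

(* Main.v *)
Require Import Defs.
From Stdlib Require Import Reals Lra Lia Psatz ZArith List FinFun Classical ClassicalEpsilon.
From Coquelicot Require Import Coquelicot.
Open Scope R_scope.

(** Take [|q w - p| < A := q^(-1-mu)] and [R x = q^(-2) P (q x)] with [P = A u + A^T u K], [u x = 1 - cos (2 PI x)],
    where [K] is a high power of [cos (PI (x - xi))]^2.  The change of variables [(q x, q y - p)] turns a circle of
    frequency [w] into a circle for [P] of frequency [al = q w - p], with [0 < |al| < A].  A curve invariant under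
    the map contains a graph (Birkhoff), on which the dynamics is a circle homeomorphism whose orbits minimise the
    action.  As it is so slow, the graph passes within [(1 + sqrt A)^(-c/A)] of the hyperbolic fixed point [(0,0)],
    so all orbits on it have, up to that error, the same action over one turn.  But choose an almost minimal chain
    for [A u] and centre [K] in the gap of this chain at [1/2]: the orbit through [xi] then has an action exceeding
    that of the chain by about [A^T], a power of [A], which is a contradiction.  The first term of [R] has [C^r] size
    [q^(r-3-mu)], whence the condition [r < 3 + mu]. *)

(** * Lifted arguments of planar paths *)

(** On which side of the curve a point lies is read off from the total turn of the direction in
    which it sees the curve; the winding number may be any positive [k]. The graph is the lower
    envelope of all integer translates of the curve. Its regularity comes from order: the map and
    its inverse preserve the set of points below the envelope, which makes the induced map [G] and
    its inverse [B] adjoint, hence monotone, while [G x + B x = 2 x + f x] with [f] Lipschitz. The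
    constants are balanced in powers of A. The gap has width at least A/2, so a power M of about
    A^(-3) brings K below A/4 on the whole chain. One derivative of the second term of R then costs
    at most a constant times q M, that is A^(-4), whence T = 4 J + 8 with J > r. Chains are kept
    A^T/16 away from 0 and 1, where the potential vanishes; this bounds their number of points by a
    power of 1/A. The drift of the calibration is charged once per bond and is bounded by the
    distance to the fixed point, which is smaller than any fixed power of A. *)

Lemma stays_between (f : R -> R) (lo hi s0 s : R) :
  continuity f -> lo < f s0 < hi ->
  (forall t, Rmin s0 s <= t <= Rmax s0 s -> f t <> lo /\ f t <> hi) ->
  lo < f s < hi.
Proof.
intros Cf H0 Hne.
assert (Cf' : forall x, continuity_pt f x) by exact Cf.
split; apply Rnot_le_lt; intros Hs.
- destruct (IVT_gen f s0 s lo Cf') as [t [Ht Et]].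
  { unfold Rmin, Rmax; repeat destruct Rle_dec; lra. }
  now destruct (Hne t Ht).
- destruct (IVT_gen f s0 s hi Cf') as [t [Ht Et]].
  { unfold Rmin, Rmax; repeat destruct Rle_dec; lra. }
  now destruct (Hne t Ht).
Qed.

Definition is_angle (a b th : R) : Prop :=
  exists rho, 0 < rho /\ a = rho * cos th /\ b = rho * sin th.

(** Cross product over dot product is the tangent of the angle between the two vectors, and the
    positive dot product selects the branch of [atan]. An angle can thus be continued across any
    turn below a right angle. *)
Lemma is_angle_rotate (a b a' b' th : R) :
  is_angle a b th -> 0 < a * a' + b * b' ->
  is_angle a' b' (th + atan ((a * b' - b * a') / (a * a' + b * b'))).
Proof.
intros [rho [Hrho [-> ->]]] Hd.
set (d := rho * cos th * a' + rho * sin th * b') in *.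
set (c := rho * cos th * b' - rho * sin th * a').
set (K := / sqrt (1 + (c / d)²)).
assert (HK : 0 < K).
{ apply Rinv_0_lt_compat, sqrt_lt_R0. pose proof (Rle_0_sqr (c / d)). lra. }
assert (Ec : cos (atan (c / d)) = K) by (rewrite cos_atan; unfold K, Rdiv; ring).
assert (Es : sin (atan (c / d)) = c / d * K) by (rewrite sin_atan; unfold K, Rdiv; ring).
pose proof (sin2_cos2 th) as Hsc. unfold Rsqr in Hsc.
exists (d / (K * rho)). split.
{ apply Rdiv_lt_0_compat; [exact Hd | now apply Rmult_lt_0_compat]. }
rewrite cos_plus, sin_plus, Ec, Es.
split.
- replace (d / (K * rho) * (cos th * K - sin th * (c / d * K)))
    with ((d * cos th - c * sin th) / rho) by (field; repeat split; lra).
  unfold d, c.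
  replace (((rho * cos th * a' + rho * sin th * b') * cos th -
            (rho * cos th * b' - rho * sin th * a') * sin th) / rho)
    with (a' * (sin th * sin th + cos th * cos th)) by (field; lra).
  rewrite Hsc. ring.
- replace (d / (K * rho) * (sin th * K + cos th * (c / d * K)))
    with ((d * sin th + c * cos th) / rho) by (field; repeat split; lra).
  unfold d, c.
  replace (((rho * cos th * a' + rho * sin th * b') * sin th +
            (rho * cos th * b' - rho * sin th * a') * cos th) / rho)
    with (b' * (sin th * sin th + cos th * cos th)) by (field; lra).
  rewrite Hsc. ring.
Qed.

Lemma is_angle_dot_cross (a b a' b' th th' : R) :
  is_angle a b th -> is_angle a' b' th' ->
  exists r, 0 < r /\ a * a' + b * b' = r * cos (th' - th) /\
    a * b' - b * a' = r * sin (th' - th).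
Proof.
intros [r [Hr [-> ->]]] [r' [Hr' [-> ->]]].
exists (r * r'). rewrite cos_minus, sin_minus.
repeat split; try ring. now apply Rmult_lt_0_compat.
Qed.

Lemma cos_eq_1_zero (x : R) : - PI < x < PI -> sin x = 0 -> x = 0.
Proof.
intros Hx Hs.
destruct (Rtotal_order x 0) as [H | [H | H]]; trivial; exfalso.
- pose proof (sin_gt_0 (- x)). rewrite sin_neg in H0. lra.
- pose proof (sin_gt_0 x). lra.
Qed.

(** All [s] are reached from [s0] simultaneously in [N] steps [pt i s], which by uniform continuity
    are so short that the vector turns by less than a right angle in each. The angle is the sum of
    the [atan] increments, hence continuous in [s]; [cl] clamps [s] to the compact interval. *)
Lemma lift_compact (a b : R -> R) (s0 n c : R) :
  continuity a -> continuity b -> (forall s, a s <> 0 \/ b s <> 0) ->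
  0 < n -> is_angle (a s0) (b s0) c ->
  exists th, continuity th /\ th s0 = c /\
    forall s, Rabs (s - s0) <= n -> is_angle (a s) (b s) (th s).
Proof.
intros Ca Cb Hnz Hn Hc.
destruct (continuity_ab_min (fun s => a s * a s + b s * b s) (s0 - n) (s0 + n))
  as [smin [Hmin _]]; [lra | |].
{ intros t _. change (continuity_pt (a * a + b * b)%F t).
  apply continuity_pt_plus; apply continuity_pt_mult; auto. }
set (m := a smin * a smin + b smin * b smin) in *.
assert (Hm : 0 < m).
{ unfold m. destruct (Hnz smin) as [H | H]; [pose proof (Rle_0_sqr (b smin)) | pose proof (Rle_0_sqr (a smin))];
  unfold Rsqr in *; pose proof (Rsqr_pos_lt _ H); unfold Rsqr in *; lra. }
(* Vectors of squared length at least [m] whose coordinates differ by less than [e] have positive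
   dot product: u.v = (|u|^2 + |v|^2 - |u - v|^2) / 2. *)
set (e := sqrt m / 2).
assert (He : 0 < e) by (unfold e; pose proof (sqrt_lt_R0 m Hm); lra).
assert (Hee : 4 * (e * e) = m).
{ unfold e. replace (4 * (sqrt m / 2 * (sqrt m / 2))) with (sqrt m * sqrt m) by field.
  apply sqrt_sqrt. lra. }
destruct (Heine_cor2 (f := a) (a := s0 - n) (b := s0 + n) (fun x _ => Ca x) (mkposreal e He)) as [d1 Hd1].
destruct (Heine_cor2 (f := b) (a := s0 - n) (b := s0 + n) (fun x _ => Cb x) (mkposreal e He)) as [d2 Hd2].
simpl in Hd1, Hd2.
assert (Hdot : forall s t, s0 - n <= s <= s0 + n -> s0 - n <= t <= s0 + n ->
  Rabs (s - t) < d1 -> Rabs (s - t) < d2 -> 0 < a s * a t + b s * b t).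
{ intros s t Hs Ht H1 H2.
  specialize (Hd1 s t Hs Ht H1). specialize (Hd2 s t Hs Ht H2).
  pose proof (Hmin s Hs) as Ms. pose proof (Hmin t Ht) as Mt. simpl in Ms, Mt. fold m in Ms, Mt.
  apply Rabs_def2 in Hd1. apply Rabs_def2 in Hd2. nra. }
destruct (archimed_cor1 (Rmin d1 d2 / n)) as [N [HN HN0]].
{ apply Rdiv_lt_0_compat; trivial. apply Rmin_pos; apply cond_pos. }
assert (HNpos : 0 < INR N) by (apply lt_0_INR; lia).
set (cl := fun s => Rmax (- n) (Rmin n (s - s0))).
assert (Hcl : forall s, - n <= cl s <= n).
{ intro s. unfold cl, Rmax, Rmin. repeat destruct Rle_dec; lra. }
assert (Ccl : continuity cl).
{ assert (Hl : forall s t, Rabs (cl s - cl t) <= Rabs (s - t)).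
  { intros s t. unfold cl, Rmax, Rmin. repeat destruct Rle_dec; unfold Rabs; repeat destruct Rcase_abs; lra. }
  intros s eps Heps. exists eps. split; trivial. intros t [_ Ht]. simpl in *. unfold Rdist in *.
  pose proof (Hl t s). lra. }
set (pt := fun (i : nat) s => s0 + cl s * (INR i / INR N)).
assert (Cpt : forall i, continuity (pt i)).
{ intros i. unfold pt. intro s.
  apply continuity_pt_plus; [apply continuity_pt_const; intros x y; reflexivity |].
  apply continuity_pt_mult; [apply Ccl | apply continuity_pt_const; intros x y; reflexivity]. }
assert (Hpt : forall i s, (i <= N)%nat -> s0 - n <= pt i s <= s0 + n).
{ intros i s Hi. unfold pt. specialize (Hcl s).
  assert (0 <= INR i / INR N <= 1).
  { split; [apply Rdiv_le_0_compat; [apply pos_INR | lra] |].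
    apply Rle_div_l; [lra |]. rewrite Rmult_1_l. now apply le_INR. }
  nra. }
assert (Hstep : forall i, (i <= N)%nat -> exists th, continuity th /\ th s0 = c /\
  forall s, is_angle (a (pt i s)) (b (pt i s)) (th s)).
{ induction i as [|i IH]; intros Hi.
  - exists (fun _ => c). split; [apply continuity_const; intros x y; reflexivity | split; trivial].
    intros s. unfold pt. simpl. replace (s0 + cl s * (0 / INR N)) with s0 by (field; lra). trivial.
  - destruct IH as [th [Cth [E0 Hth]]]; [lia |].
    assert (Hd : forall s, 0 < a (pt i s) * a (pt (S i) s) + b (pt i s) * b (pt (S i) s)).
    { intros s.
      assert (Rabs (pt i s - pt (S i) s) < Rmin d1 d2).
      { unfold pt. rewrite S_INR.
        replace (s0 + cl s * (INR i / INR N) - (s0 + cl s * ((INR i + 1) / INR N))) with (- (cl s / INR N)) by (field; lra).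
        rewrite Rabs_Ropp. unfold Rdiv. rewrite Rabs_mult, (Rabs_right (/ INR N)).
        2:{ apply Rle_ge, Rlt_le, Rinv_0_lt_compat; lra. }
        apply Rle_lt_trans with (n * / INR N).
        - apply Rmult_le_compat_r; [apply Rlt_le, Rinv_0_lt_compat; lra |].
          apply Rabs_le. apply Hcl.
        - apply Rlt_le_trans with (n * (Rmin d1 d2 / n)).
          + now apply Rmult_lt_compat_l.
          + right. field. lra. }
      pose proof (Rmin_l d1 d2). pose proof (Rmin_r d1 d2).
      apply Hdot; try (apply Hpt; lia); lra. }
    exists (fun s => th s + atan ((a (pt i s) * b (pt (S i) s) - b (pt i s) * a (pt (S i) s)) /
                        (a (pt i s) * a (pt (S i) s) + b (pt i s) * b (pt (S i) s)))).
    split; [| split].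
    + assert (Ka : forall i, continuity (fun s => a (pt i s))).
      { intros k s. apply (continuity_pt_comp (pt k) a); [apply Cpt | apply Ca]. }
      assert (Kb : forall i, continuity (fun s => b (pt i s))).
      { intros k s. apply (continuity_pt_comp (pt k) b); [apply Cpt | apply Cb]. }
      intros s. apply continuity_pt_plus; [apply Cth |].
      apply (continuity_pt_comp (fun s => _ / _) atan).
      2:{ apply derivable_continuous_pt, derivable_pt_atan. }
      apply continuity_pt_div.
      * apply continuity_pt_minus; apply continuity_pt_mult; (apply Ka || apply Kb).
      * apply continuity_pt_plus; apply continuity_pt_mult; (apply Ka || apply Kb).
      * specialize (Hd s). lra.
    + assert (E : forall k, pt k s0 = s0).
      { intro k. unfold pt, cl. replace (s0 - s0) with 0 by ring.
        rewrite Rmin_right, Rmax_right by lra. ring. }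
      rewrite !E, E0. replace (a s0 * b s0 - b s0 * a s0) with 0 by ring.
      unfold Rdiv. rewrite Rmult_0_l, atan_0. ring.
    + intros s. now apply is_angle_rotate. }
destruct (Hstep N (le_n N)) as [th [Cth [E0 Hth]]].
exists th. split; [| split]; trivial.
intros s Hs. specialize (Hth s).
replace (pt N s) with s in Hth; trivial.
unfold pt, cl. apply Rabs_le_between in Hs.
rewrite Rmin_right, Rmax_right by lra. field. lra.
Qed.

(** Lifts on growing intervals are glued. Two of them agree: their difference vanishes at [s0],
    never reaches PI or -PI, and has sine zero. *)
Lemma lift_exists (a b : R -> R) (s0 c : R) :
  continuity a -> continuity b -> (forall s, a s <> 0 \/ b s <> 0) ->
  is_angle (a s0) (b s0) c ->
  exists th, continuity th /\ th s0 = c /\ forall s, is_angle (a s) (b s) (th s).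
Proof.
intros Ca Cb Hnz Hc.
assert (Hex : forall n : nat, exists th, continuity th /\ th s0 = c /\
    forall s, Rabs (s - s0) <= INR (S n) -> is_angle (a s) (b s) (th s)).
{ intro n. apply lift_compact; trivial. apply lt_0_INR. lia. }
pose (T := fun n => proj1_sig (constructive_indefinite_description _ (Hex n))).
assert (HT : forall n, continuity (T n) /\ T n s0 = c /\
    forall s, Rabs (s - s0) <= INR (S n) -> is_angle (a s) (b s) (T n s)).
{ intro n. exact (proj2_sig (constructive_indefinite_description _ (Hex n))). }
clearbody T.
assert (Hagree : forall n m s, Rabs (s - s0) <= INR (S n) -> Rabs (s - s0) <= INR (S m) -> T n s = T m s).
{ intros n m s Hn Hm.
  destruct (HT n) as [C1 [E1 A1]]. destruct (HT m) as [C2 [E2 A2]].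
  assert (Hsame : forall t, Rmin s0 s <= t <= Rmax s0 s -> cos (T n t - T m t) > 0 /\ sin (T n t - T m t) = 0).
  { intros t Ht.
    assert (Rabs (t - s0) <= Rabs (s - s0)).
    { unfold Rmin, Rmax in Ht. destruct Rle_dec; unfold Rabs; repeat destruct Rcase_abs; lra. }
    destruct (is_angle_dot_cross _ _ _ _ _ _ (A2 t ltac:(lra)) (A1 t ltac:(lra))) as [r [Hr [Ed Ec]]].
    split.
    - destruct (A1 t ltac:(lra)) as [r' [Hr' [Ea Eb]]].
      assert (0 < a t * a t + b t * b t).
      { rewrite Ea, Eb. pose proof (sin2_cos2 (T n t)). unfold Rsqr in *. nra. }
      apply Rnot_le_gt. intro. nra.
    - replace (a t * b t - b t * a t) with 0 in Ec by ring.
      symmetry in Ec. apply Rmult_integral in Ec. destruct Ec; lra. }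
  assert (HH : - PI < T n s - T m s < PI).
  { apply (stays_between (fun t => T n t - T m t) (- PI) PI s0).
    - intro t. apply continuity_pt_minus; [apply C1 | apply C2].
    - rewrite E1, E2. pose proof PI_RGT_0. lra.
    - intros t Ht. destruct (Hsame t Ht) as [Hcs _].
      split; intro E; rewrite E in Hcs; rewrite ?cos_neg, cos_PI in Hcs; lra. }
  destruct (Hsame s) as [_ Hsin].
  { split; [apply Rmin_r | apply Rmax_r]. }
  pose proof (cos_eq_1_zero _ HH Hsin). lra. }
pose (N := fun s => Z.to_nat (up (Rabs (s - s0)))).
assert (HN : forall s, Rabs (s - s0) <= INR (N s)).
{ intros s. destruct (archimed (Rabs (s - s0))) as [H1 _].
  pose proof (Rabs_pos (s - s0)).
  unfold N. rewrite INR_IZR_INZ, Z2Nat.id.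
  - lra.
  - apply le_IZR. lra. }
exists (fun s => T (N s) s). split; [| split].
- intros s.
  (* The index [N] jumps, so near [s] the glued function is compared with one lift that is valid on
     a whole unit neighbourhood of [s]. *)
  apply continuity_pt_locally_ext with (f := T (S (N s))) (a := 1); [lra | | apply (HT (S (N s)))].
  intros t Ht. apply Hagree.
  + assert (Rabs (t - s0) <= Rabs (t - s) + Rabs (s - s0)).
    { replace (t - s0) with ((t - s) + (s - s0)) by ring. apply Rabs_triang. }
    unfold Rdist in Ht. rewrite !S_INR. pose proof (HN s). lra.
  + rewrite S_INR. pose proof (HN t). lra.
- apply HT.
- intros s. apply HT. rewrite S_INR. pose proof (HN s). lra.
Qed.

(* The normalisation at [-oo] makes the lifted argument of [(a,b)] unique. *)
Definition nlift (a b th : R -> R) : Prop :=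
  continuity th /\ (forall s, is_angle (a s) (b s) (th s)) /\
  exists S, forall s, s <= S -> PI / 2 < th s < 3 * (PI / 2).

Lemma nlift_exists (a b : R -> R) :
  continuity a -> continuity b -> (forall s, a s <> 0 \/ b s <> 0) ->
  (exists S, forall s, s <= S -> a s < 0) -> exists th, nlift a b th.
Proof.
intros Ca Cb Hnz [S HS].
pose proof (HS S (Rle_refl S)) as HaS.
assert (Hang : is_angle (a S) (b S) (PI + atan (b S / a S))).
{ set (t := atan (b S / a S)).
  set (K := / sqrt (1 + (b S / a S)²)).
  assert (HK : 0 < K).
  { apply Rinv_0_lt_compat, sqrt_lt_R0. pose proof (Rle_0_sqr (b S / a S)). lra. }
  exists (- a S / K). split; [apply Rdiv_lt_0_compat; lra |].
  rewrite (Rplus_comm PI), neg_cos, neg_sin.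
  unfold t. rewrite cos_atan, sin_atan.
  change (1 / sqrt (1 + (b S / a S)²)) with (1 * K).
  change (b S / a S / sqrt (1 + (b S / a S)²)) with (b S / a S * K).
  split; field; lra. }
destruct (lift_exists a b S _ Ca Cb Hnz Hang) as [th [Cth [E0 Hth]]].
exists th. split; [| split]; trivial.
exists S. intros s Hs.
apply (stays_between th _ _ S); trivial.
- rewrite E0. pose proof (atan_bound (b S / a S)). lra.
- intros t Ht.
  assert (Hat : a t < 0).
  { apply HS. rewrite Rmax_left in Ht by lra. lra. }
  destruct (Hth t) as [r [Hr [Ea _]]].
  split; intro E; rewrite E in Ea.
  + rewrite cos_PI2 in Ea. lra.
  + rewrite cos_3PI2 in Ea. lra.
Qed.

(** The normalisation puts the difference of the lifts into (-PI, PI) near -oo. It can leave this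
    interval only where the vectors are opposite, and there the cross product vanishes while the dot
    product is negative. *)
Lemma nlift_near (a b th a' b' th' : R -> R) :
  nlift a b th -> nlift a' b' th' ->
  (forall s, 0 < a s * a' s + b s * b' s \/ a s * b' s - b s * a' s <> 0) ->
  forall s, - PI < th' s - th s < PI.
Proof.
intros [C1 [A1 [S1 H1]]] [C2 [A2 [S2 H2]]] Hna s.
set (S := Rmin S1 S2).
specialize (H1 S (Rmin_l _ _)). specialize (H2 S (Rmin_r _ _)).
apply (stays_between (fun s => th' s - th s) (- PI) PI S).
- intro t. apply continuity_pt_minus; [apply C2 | apply C1].
- lra.
- intros t _.
  destruct (is_angle_dot_cross _ _ _ _ _ _ (A1 t) (A2 t)) as [r [Hr [Ed Ec]]].
  split; intro E; cbv beta in E; rewrite E in Ed, Ec;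
    rewrite ?cos_neg, ?cos_PI in Ed; rewrite ?sin_neg, ?sin_PI in Ec;
    (destruct (Hna t) as [H | H]; [lra | apply H; rewrite Ec; ring]).
Qed.

(** * Essential curves and the action of the map on directions *)

Lemma cos_pos_range (x : R) : - (3 * (PI / 2)) < x < 3 * (PI / 2) -> 0 < cos x -> - (PI / 2) < x < PI / 2.
Proof.
intros Hx Hc. split; apply Rnot_le_lt; intros H.
- pose proof (cos_le_0 (- x)). rewrite cos_neg in H0. lra.
- pose proof (cos_le_0 x). lra.
Qed.

Lemma pos_lower_bound (e : R -> R) (S : R) :
  continuity e -> (forall s, 0 < e s) -> (forall s, S < Rabs s -> 1 <= e s) ->
  exists rho, 0 < rho /\ forall s, rho <= e s.
Proof.
intros Ce Hpos Hout.
destruct (continuity_ab_min e (- Rabs S) (Rabs S)) as [m [Hm _]].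
{ pose proof (Rabs_pos S). lra. }
{ intros; apply Ce. }
exists (Rmin 1 (e m)). split; [apply Rmin_pos; [lra | apply Hpos] |].
intros s. destruct (Rle_dec (Rabs s) (Rabs S)) as [H | H].
- apply Rle_trans with (e m); [apply Rmin_r | apply Hm]. now apply Rabs_le_between.
- apply Rle_trans with 1; [apply Rmin_l | apply Hout].
  pose proof (Rle_abs S). lra.
Qed.

Lemma floor_split (s : R) : exists (n : Z) (u : R), s = u + IZR n /\ 0 <= u < 1.
Proof.
destruct (archimed s) as [H1 H2].
exists (up s - 1)%Z, (s - IZR (up s - 1)). rewrite minus_IZR. split; [ring | lra].
Qed.

Lemma shift_periodic (f : R -> R) (c : R) :
  (forall s, f (s + 1) = f s + c) -> forall n s, f (s + IZR n) = f s + c * IZR n.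
Proof.
intros Hf.
assert (Hn : forall (n : nat) s, f (s + INR n) = f s + c * INR n).
{ induction n as [|n IH]; intros s; [simpl; rewrite Rplus_0_r; ring |].
  rewrite S_INR, <- Rplus_assoc, Hf, IH. ring. }
intros n s. destruct (Z_le_dec 0 n) as [H | H].
- rewrite <- (Z2Nat.id n H), <- INR_IZR_INZ. apply Hn.
- replace s with ((s + IZR n) + INR (Z.to_nat (- n))) at 2.
  + rewrite Hn, INR_IZR_INZ, Z2Nat.id, opp_IZR by lia. ring.
  + rewrite INR_IZR_INZ, Z2Nat.id, opp_IZR by lia. ring.
Qed.

Lemma periodic_bounded (f : R -> R) :
  continuity f -> (forall s, f (s + 1) = f s) -> exists C, forall s, Rabs (f s) <= C.
Proof.
intros Cf Hper.
destruct (continuity_ab_maj (fun s => Rabs (f s)) 0 1) as [m [Hm _]]; [lra | |].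
{ intros t _. apply (continuity_pt_comp f Rabs); [apply Cf | apply Rcontinuity_abs]. }
exists (Rabs (f m)). intros s.
destruct (floor_split s) as [n [u [-> Hu]]].
rewrite (shift_periodic f 0) by (intro; rewrite Hper; ring).
rewrite Rmult_0_l, Rplus_0_r. apply Hm. lra.
Qed.

(** A lift of the closed curve to the plane. [curve_inj] concerns the lifted path alone;
    disjointness from the integer translates is a separate hypothesis where it is used. *)
Record curve (k : nat) (X Y : R -> R) : Prop := {
  curve_pos : (0 < k)%nat;
  curve_contX : continuity X;
  curve_contY : continuity Y;
  curve_perX : forall s, X (s + 1) = X s + INR k;
  curve_perY : forall s, Y (s + 1) = Y s;
  curve_inj : forall s t, X s = X t -> Y s = Y t -> s = t
}.

Lemma curve_boundX k X Y : curve k X Y -> exists C, forall s, Rabs (X s - INR k * s) <= C.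
Proof.
intros H. apply periodic_bounded.
- intros s. apply continuity_pt_minus; [apply H |].
  apply continuity_pt_mult; [apply continuity_pt_const; intros x y; reflexivity | apply continuity_pt_id].
- intros s. rewrite (curve_perX _ _ _ H). ring.
Qed.

Lemma curve_boundY k X Y : curve k X Y -> exists C, forall s, Rabs (Y s) <= C.
Proof. intros H. apply periodic_bounded; apply H. Qed.

Lemma curve_kge1 k X Y : curve k X Y -> 1 <= INR k.
Proof. intros H. apply (le_INR 1). apply H. Qed.

Lemma curve_X_large k X Y : curve k X Y ->
  forall M, exists S, 0 < S /\ (forall s, S <= s -> M < X s) /\ (forall s, s <= - S -> X s < - M).
Proof.
intros H M. destruct (curve_boundX _ _ _ H) as [C HC].
pose proof (curve_kge1 _ _ _ H) as Hk.
exists (Rabs M + Rabs C + 1).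
pose proof (Rle_abs M). pose proof (Rle_abs C). pose proof (Rabs_pos M). pose proof (Rabs_pos C).
split; [lra | split]; intros s Hs; pose proof (HC s) as Hcs; apply Rabs_le_between in Hcs; nra.
Qed.

Definition avoids (X Y : R -> R) (x y : R) : Prop := forall s, X s = x -> Y s = y -> False.

(** Compactness, since [X] tends to infinity at both ends. Where the path meets the point, the
    weight [w] makes up for the vanishing distance: [w = 0] serves for avoided points, and a tent
    around one parameter yields continuity of the inverse parametrisation. *)
Lemma curve_far k X Y x y (w : R -> R) : curve k X Y -> continuity w -> (forall s, 0 <= w s) ->
  (forall s, X s = x -> Y s = y -> 0 < w s) ->
  exists rho, 0 < rho /\ forall s, rho <= Rabs (X s - x) + Rabs (Y s - y) + w s.
Proof.
intros H Cw Hw Hpos.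
destruct (curve_X_large _ _ _ H (Rabs x + 1)) as [S [HS [H1 H2]]].
apply (pos_lower_bound _ S).
- assert (Habs : forall (f : R -> R) c, continuity f -> continuity (fun s => Rabs (f s - c))).
  { intros f c Cf s. apply (continuity_pt_comp (fun s => f s - c) Rabs); [| apply Rcontinuity_abs].
    apply continuity_pt_minus; [apply Cf | apply continuity_pt_const; intros u v; reflexivity]. }
  intros s. apply continuity_pt_plus; [apply continuity_pt_plus |]; try apply Habs; try apply H; apply Cw.
- intros s. pose proof (Rabs_pos (X s - x)). pose proof (Rabs_pos (Y s - y)). pose proof (Hw s).
  destruct (Req_dec (X s) x) as [E1 | E1].
  + destruct (Req_dec (Y s) y) as [E2 | E2].
    * pose proof (Hpos s E1 E2). lra.
    * assert (Y s - y <> 0) by lra. pose proof (Rabs_pos_lt _ H5). lra.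
  + assert (X s - x <> 0) by lra. pose proof (Rabs_pos_lt _ H5). lra.
- intros s Hs. pose proof (Rabs_pos (Y s - y)). pose proof (Hw s).
  assert (1 <= Rabs (X s - x)); [| lra].
  unfold Rabs in Hs. destruct (Rcase_abs s).
  + specialize (H2 s ltac:(lra)). pose proof (Rle_abs (- x)). rewrite Rabs_Ropp in H4.
    rewrite Rabs_left1; lra.
  + specialize (H1 s ltac:(lra)). pose proof (Rle_abs x). rewrite Rabs_right; lra.
Qed.

Lemma curve_dist k X Y x y : curve k X Y -> avoids X Y x y ->
  exists rho, 0 < rho /\ forall s, rho <= Rabs (X s - x) + Rabs (Y s - y).
Proof.
intros H Hav.
destruct (curve_far k X Y x y (fun _ => 0) H) as [rho [Hr Hd]].
- apply continuity_const; intros u v; reflexivity.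
- intros; lra.
- intros s E1 E2. destruct (Hav s E1 E2).
- exists rho. split; trivial. intros s. specialize (Hd s). lra.
Qed.

(** The lifted direction in which the curve is seen from [(x,y)], normalised around PI at -oo. *)
Definition alift (X Y : R -> R) (x y : R) : (R -> R) -> Prop :=
  nlift (fun s => X s - x) (fun s => Y s - y).

Lemma continuity_minus_cst (f : R -> R) (c : R) : continuity f -> continuity (fun s => f s - c).
Proof.
intros Cf s. apply continuity_pt_minus; [apply Cf | apply continuity_pt_const; intros u v; reflexivity].
Qed.

Lemma alift_exists k X Y x y : curve k X Y -> avoids X Y x y -> exists th, alift X Y x y th.
Proof.
intros H Hav. apply nlift_exists.
- apply continuity_minus_cst, H.
- apply continuity_minus_cst, H.
- intros s. destruct (Req_dec (X s) x) as [E1 | E1]; [right | left; lra].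
  intros E2. apply (Hav s); lra.
- destruct (curve_X_large _ _ _ H (Rabs x)) as [S [HS [_ H2]]].
  exists (- S). intros s Hs. specialize (H2 s Hs). pose proof (Rle_abs (- x)).
  rewrite Rabs_Ropp in H0. lra.
Qed.

Lemma alift_avoids X Y x y th : alift X Y x y th -> avoids X Y x y.
Proof.
intros [_ [Ha _]] s E1 E2. destruct (Ha s) as [r [Hr [Ec Es]]].
rewrite E1, E2 in *. pose proof (sin2_cos2 (th s)) as Hsc. unfold Rsqr in Hsc. nra.
Qed.

(** The point keeps a positive distance from the curve, so a small displacement turns all directions
    by a uniformly small angle; [nlift_near] excludes a jump by a full turn. *)
Lemma alift_perturb k X Y x y th (eps : R) :
  curve k X Y -> alift X Y x y th -> 0 < eps ->
  exists r, 0 < r /\ forall x' y', Rabs (x' - x) < r -> Rabs (y' - y) < r ->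
    avoids X Y x' y' /\
    forall th', alift X Y x' y' th' -> forall s, Rabs (th' s - th s) < eps.
Proof.
intros H Hth Heps.
set (e := Rmin eps (PI / 4)).
pose proof PI_RGT_0 as Hpi.
assert (He : 0 < e < PI / 2).
{ unfold e. split; [apply Rmin_pos; lra | pose proof (Rmin_r eps (PI / 4)); lra]. }
set (tau := tan e).
assert (Htau : 0 < tau) by (apply tan_gt_0; lra).
destruct (curve_dist _ _ _ _ _ H (alift_avoids _ _ _ _ _ Hth)) as [rho [Hrho Hd]].
(* With u + v >= rho and rho (u + v) <= 2 (u^2 + v^2), this radius gives r (u + v) (1 + tau) < tau
   (u^2 + v^2), which keeps the tangent of the turn below [tau]. *)
exists (rho * tau / (4 * (1 + tau))). split.
{ apply Rdiv_lt_0_compat; [apply Rmult_lt_0_compat |]; lra. }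
intros x' y' Hx' Hy'.
set (r := rho * tau / (4 * (1 + tau))) in *.
assert (Hr : r * (4 * (1 + tau)) = rho * tau) by (unfold r; field; lra).
set (a := fun s => X s - x). set (b := fun s => Y s - y).
set (dx := x' - x) in *. set (dy := y' - y) in *.
assert (Hkey : forall s, Rabs (b s * dx - a s * dy) < tau * (a s * a s + b s * b s - a s * dx - b s * dy)).
{ intros s.
  set (u := Rabs (a s)). set (v := Rabs (b s)).
  assert (Hu : 0 <= u) by apply Rabs_pos. assert (Hv : 0 <= v) by apply Rabs_pos.
  assert (Huv : rho <= u + v) by apply Hd.
  assert (E1 : a s * a s = u * u) by (unfold u; rewrite <- Rabs_mult, Rabs_right; [trivial | apply Rle_ge, Rle_0_sqr]).
  assert (E2 : b s * b s = v * v) by (unfold v; rewrite <- Rabs_mult, Rabs_right; [trivial | apply Rle_ge, Rle_0_sqr]).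
  rewrite E1, E2.
  assert (B : forall p q : R, Rabs q < r -> - (Rabs p * r) <= p * q <= Rabs p * r).
  { intros p q Hq. apply Rabs_le_between. rewrite Rabs_mult.
    apply Rmult_le_compat_l; [apply Rabs_pos | lra]. }
  pose proof (B (a s) dx Hx') as B1. pose proof (B (b s) dx Hx') as B2.
  pose proof (B (a s) dy Hy') as B3. pose proof (B (b s) dy Hy') as B4.
  fold u in B1, B3. fold v in B2, B4.
  assert (Hsum : rho * (u + v) <= 2 * (u * u + v * v)).
  { assert (0 <= (u - v) * (u - v)) by apply Rle_0_sqr. nra. }
  assert (Hr0 : 0 < r) by (pose proof (Rabs_pos dx); lra).
  assert (Hmain : (u + v) * r * (1 + tau) < tau * (u * u + v * v)).
  { replace ((u + v) * r * (1 + tau)) with (tau * (rho * (u + v)) / 4) by (apply Rmult_eq_reg_r with 4; [nra | lra]).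
    assert (0 < rho * (u + v)) by (apply Rmult_lt_0_compat; lra).
    assert (rho * (u + v) / 4 < u * u + v * v) by lra. nra. }
  apply Rabs_def1; nra. }
assert (Hav : avoids X Y x' y').
{ intros s E1 E2. pose proof (Hkey s) as K.
  replace (a s) with dx in K by (unfold dx, a; lra). replace (b s) with dy in K by (unfold dy, b; lra).
  replace (dx * dx + dy * dy - dx * dx - dy * dy) with 0 in K by ring.
  pose proof (Rabs_pos (dy * dx - dx * dy)). lra. }
split; trivial.
intros th' Hth' s.
assert (Hclose : forall s, - PI < th' s - th s < PI).
{ apply (nlift_near _ _ _ _ _ _ Hth Hth'). intros t. left.
  pose proof (Hkey t) as K. pose proof (Rabs_pos (b t * dx - a t * dy)).
  assert (0 < a t * a t + b t * b t - a t * dx - b t * dy) by nra.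
  unfold a, b, dx, dy in *. nra. }
destruct Hth as [_ [Ath _]], Hth' as [_ [Ath' _]].
destruct (is_angle_dot_cross _ _ _ _ _ _ (Ath s) (Ath' s)) as [q [Hq [Ed Ec]]].
pose proof (Hkey s) as K. pose proof (Rabs_pos (b s * dx - a s * dy)) as K0.
set (eta := th' s - th s) in *.
assert (Ed' : a s * a s + b s * b s - a s * dx - b s * dy = q * cos eta) by (rewrite <- Ed; unfold a, b, dx, dy; ring).
assert (Ec' : b s * dx - a s * dy = q * sin eta) by (rewrite <- Ec; unfold a, b, dx, dy; ring).
rewrite Ed', Ec' in K.
assert (Hcos : 0 < cos eta).
{ rewrite Ec' in K0. apply Rnot_le_lt. intros Hle.
  assert (0 < tau * q) by (now apply Rmult_lt_0_compat). nra. }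
destruct (Hclose s) as [L1 L2]. fold eta in L1, L2.
assert (Hrange : - (PI / 2) < eta < PI / 2) by (apply cos_pos_range; trivial; lra).
apply Rabs_def2 in K. destruct K as [K1 K2].
assert (Ht : - tau < tan eta < tau).
{ unfold tan. split; [apply Rlt_div_r | apply Rlt_div_l]; trivial; nra. }
apply Rlt_le_trans with e; [| apply Rmin_l].
apply Rabs_def1; apply Rnot_le_lt; intros Hle.
- destruct Hle as [Hlt | E].
  + pose proof (tan_increasing e eta ltac:(lra) Hlt ltac:(lra)) as T. fold tau in T. lra.
  + rewrite <- E in Ht. fold tau in Ht. lra.
- destruct Hle as [Hlt | E].
  + pose proof (tan_increasing eta (- e) ltac:(lra) Hlt ltac:(lra)) as T. rewrite tan_neg in T. fold tau in T. lra.
  + rewrite E, tan_neg in Ht. fold tau in Ht. lra.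
Qed.

(* The curve [(X,Y)] is invariant under [(x,y) -> (x+y-j, y+f(x+y))], which acts on the parameter by [g]. *)
Record icurve (f : R -> R) (j : Z) (g : R -> R) (k : nat) (X Y : R -> R) : Prop := {
  icurve_curve : curve k X Y;
  icurve_contf : continuity f;
  icurve_contg : continuity g;
  icurve_X : forall s, X s + Y s = X (g s) + IZR j;
  icurve_Y : forall s, Y s + f (X s + Y s) = Y (g s)
}.

Lemma icurve_param f j g k X Y : icurve f j g k X Y -> exists C, forall s, Rabs (g s - s) <= C.
Proof.
intros H.
destruct (curve_boundX _ _ _ (icurve_curve _ _ _ _ _ _ H)) as [C1 H1].
destruct (curve_boundY _ _ _ (icurve_curve _ _ _ _ _ _ H)) as [C2 H2].
pose proof (curve_kge1 _ _ _ (icurve_curve _ _ _ _ _ _ H)) as Hk.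
exists (2 * C1 + C2 + Rabs (IZR j)). intros s.
pose proof (H1 s) as A1. pose proof (H1 (g s)) as A2. pose proof (H2 s) as A3.
pose proof (icurve_X _ _ _ _ _ _ H s) as E.
pose proof (Rle_abs (IZR j)). pose proof (Rle_abs (- IZR j)) as Hj. rewrite Rabs_Ropp in Hj.
apply Rabs_le_between in A1, A2, A3.
assert (B : - (2 * C1 + C2 + Rabs (IZR j)) <= INR k * (g s - s) <= 2 * C1 + C2 + Rabs (IZR j)) by lra.
apply Rabs_le. split; apply Rnot_lt_le; intros Hlt; nra.
Qed.

Lemma icurve_surj f j g k X Y : icurve f j g k X Y -> forall t, exists s, g s = t.
Proof.
intros H t. destruct (icurve_param _ _ _ _ _ _ H) as [C HC].
assert (HC0 : 0 <= C) by (pose proof (HC 0); pose proof (Rabs_pos (g 0 - 0)); lra).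
assert (Cg : forall x, continuity_pt g x) by apply H.
destruct (IVT_gen g (t - C) (t + C) t Cg) as [s [_ Es]].
- pose proof (HC (t - C)) as A1. pose proof (HC (t + C)) as A2.
  apply Rabs_le_between in A1, A2. split.
  + apply Rle_trans with (g (t - C)); [apply Rmin_l | lra].
  + apply Rle_trans with (g (t + C)); [lra | apply Rmax_r].
- now exists s.
Qed.

Lemma icurve_avoids f j g k X Y x y : icurve f j g k X Y -> avoids X Y x y ->
  avoids X Y (x + y - IZR j) (y + f (x + y)).
Proof.
intros H Hav t E1 E2. destruct (icurve_surj _ _ _ _ _ _ H t) as [s <-].
rewrite <- (icurve_Y _ _ _ _ _ _ H) in E2. pose proof (icurve_X _ _ _ _ _ _ H s) as E.
assert (E' : X s + Y s = x + y) by lra. rewrite E' in E2.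
apply (Hav s); lra.
Qed.

(* The horizontal shear turns every direction clockwise by less than a right angle, and strictly so off the
   horizontal; the vertical shear moves no direction across the vertical. *)
Lemma icurve_transport f j g k X Y x y th th' :
  icurve f j g k X Y -> alift X Y x y th -> alift X Y (x + y - IZR j) (y + f (x + y)) th' ->
  (forall s c, cos c = 0 -> th s <= c -> th' (g s) < c) /\
  (forall c, cos c = 1 ->
    (exists S, forall s, S <= s -> - (PI / 2) < th s - c < PI / 2) ->
    (exists S, forall s, S <= s -> - (PI / 2) < th' s - c < PI / 2)).
Proof.
intros H Hth Hth'.
pose proof (icurve_curve _ _ _ _ _ _ H) as Hc.
pose proof (alift_avoids _ _ _ _ _ Hth) as Hav.
pose proof PI_RGT_0 as Hpi.
destruct (icurve_param _ _ _ _ _ _ H) as [C HC].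
set (a := fun s => X s - x). set (b := fun s => Y s - y).
set (a1 := fun s => (X s - x) + (Y s - y)).
set (b2 := fun s => (Y s - y) + (f (X s + Y s) - f (x + y))).
assert (Hab : forall s, 0 < a s * a s + b s * b s).
{ intros s. destruct Hth as [_ [Ha _]]. destruct (Ha s) as [r [Hr [E1 E2]]]. unfold a, b.
  cbv beta in E1, E2. rewrite E1, E2.
  pose proof (sin2_cos2 (th s)). unfold Rsqr in *. nra. }
destruct (curve_boundY _ _ _ Hc) as [CY HCY].
destruct (curve_X_large _ _ _ Hc (Rabs x + Rabs y + CY)) as [S0 [HS0 [HXp HXm]]].
pose proof (Rle_abs x). pose proof (Rle_abs y). pose proof (Rle_abs (- x)) as Hx'. pose proof (Rle_abs (- y)) as Hy'.
rewrite Rabs_Ropp in Hx', Hy'.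
assert (Ha1p : forall s, S0 <= s -> 0 < a1 s).
{ intros s Hs. specialize (HXp s Hs). pose proof (HCY s) as B. apply Rabs_le_between in B. unfold a1. lra. }
assert (Ha1m : forall s, s <= - S0 -> a1 s < 0).
{ intros s Hs. specialize (HXm s Hs). pose proof (HCY s) as B. apply Rabs_le_between in B. unfold a1. lra. }
(* The map is the horizontal shear followed by the vertical one; [th1] is the lifted direction in
   between. *)
assert (Hth1 : exists th1, nlift a1 b th1).
{ apply nlift_exists.
  - intros s. apply continuity_pt_plus; apply continuity_minus_cst; apply Hc.
  - apply continuity_minus_cst, Hc.
  - intros s. destruct (Req_dec (b s) 0) as [E | E]; [left | now right].
    specialize (Hab s). unfold a1, a, b in *. intro. nra.
  - exists (- S0). exact Ha1m. }
destruct Hth1 as [th1 Hth1].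
(* [g] displaces parameters by a bounded amount, so the normalisation at -oo survives composition
   with it. *)
assert (Hth2 : nlift a1 b2 (fun s => th' (g s))).
{ destruct Hth' as [C' [A' [S' HS']]]. split; [| split].
  - intro s. apply (continuity_pt_comp g th'); [apply H | apply C'].
  - intros s. destruct (A' (g s)) as [r [Hr [E1 E2]]]. cbv beta in E1, E2.
    exists r. split; trivial. rewrite <- E1, <- E2, <- (icurve_Y _ _ _ _ _ _ H).
    pose proof (icurve_X _ _ _ _ _ _ H s). unfold a1, b2. split; lra.
  - exists (S' - C). intros s Hs. apply HS'. pose proof (HC s) as B. apply Rabs_le_between in B. lra. }
assert (N1 : forall s, - PI < th1 s - th s < PI).
{ apply (nlift_near _ _ _ _ _ _ Hth Hth1). intros s. left. specialize (Hab s). unfold a1, a, b in *.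
  set (p := X s - x) in *. set (q := Y s - y) in *. nra. }
assert (N2 : forall s, - PI < th' (g s) - th1 s < PI).
{ apply (nlift_near _ _ _ _ _ _ Hth1 Hth2). intros s.
  destruct (Req_dec (a1 s) 0) as [E0 | E0].
  - left. rewrite E0. unfold b2. replace (X s + Y s) with (x + y) by (unfold a1 in E0; lra).
    specialize (Hab s). unfold a1, a, b in *. nra.
  - destruct (Req_dec (b2 s) (b s)) as [E1 | E1].
    + left. rewrite E1. pose proof (Rlt_0_sqr _ E0). pose proof (Rle_0_sqr (b s)). unfold Rsqr in *. lra.
    + right. replace (a1 s * b2 s - b s * a1 s) with (a1 s * (b2 s - b s)) by ring.
      apply Rmult_integral_contrapositive. split; lra. }
assert (A0 := proj1 (proj2 Hth)). assert (A1 := proj1 (proj2 Hth1)). assert (A2 := proj1 (proj2 Hth2)).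
cbv beta in A0, A2.
assert (D1 : forall s, - (PI / 2) < th1 s - th s <= 0 /\ (th1 s = th s -> sin (th s) = 0)).
{ intros s. specialize (N1 s).
  destruct (is_angle_dot_cross _ _ _ _ _ _ (A0 s) (A1 s)) as [r [Hr [Ed Ec]]].
  assert (Hd : 0 < cos (th1 s - th s)).
  { specialize (Hab s). unfold a1, a, b in *. set (p := X s - x) in *. set (q := Y s - y) in *.
    assert (0 < p * (p + q) + q * q) by nra. rewrite Ed in H2. nra. }
  assert (Hs : r * sin (th1 s - th s) = - (b s * b s)).
  { rewrite <- Ec. unfold a1, b. ring. }
  pose proof (cos_pos_range (th1 s - th s) ltac:(lra) Hd) as Hr2.
  split; [split; [lra |] |].
  - apply Rnot_lt_le. intros Hlt. pose proof (sin_gt_0 (th1 s - th s) ltac:(lra) ltac:(lra)).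
    pose proof (Rle_0_sqr (b s)). unfold Rsqr in *. nra.
  - intros E. rewrite E, Rminus_diag, sin_0 in Hs.
    assert (Eb : b s = 0) by nra.
    destruct (A0 s) as [r0 [Hr0 [_ Es]]]. unfold b in Eb. rewrite Eb in Es.
    symmetry in Es. apply Rmult_integral in Es. destruct Es; lra. }
split.
- intros s c Hcc Hle.
  destruct (D1 s) as [[_ Dle] Deq].
  assert (Hsc : sin c * sin c = 1).
  { pose proof (sin2_cos2 c) as Hs. unfold Rsqr in Hs. rewrite Hcc in Hs. lra. }
  assert (L1 : th1 s < c).
  { destruct (Rle_lt_or_eq_dec (th1 s) c ltac:(lra)) as [L | L]; trivial.
    assert (E : th s = c) by lra. pose proof (Deq ltac:(lra)) as Hz. rewrite E in Hz. nra. }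
  apply Rnot_le_lt. intros L2. specialize (N2 s).
  destruct (A1 s) as [r1 [Hr1 [E1 F1]]]. destruct (A2 s) as [r2 [Hr2 [E2 F2]]].
  (* On the vertical the second shear changes nothing. Off it, both directions have the horizontal
     component [a1 s], while angles on different sides of [c] would give it opposite signs. *)
  destruct (Req_dec (a1 s) 0) as [E0 | E0].
  + assert (Eb : b2 s = b s).
    { unfold b2, b. replace (X s + Y s) with (x + y) by (unfold a1 in E0; lra). ring. }
    destruct (is_angle_dot_cross _ _ _ _ _ _ (A1 s) (A2 s)) as [r [Hr [Ed Ec]]].
    rewrite Eb in Ec. replace (a1 s * b s - b s * a1 s) with 0 in Ec by ring.
    symmetry in Ec. apply Rmult_integral in Ec. destruct Ec as [Ec | Ec]; [lra |].
    pose proof (cos_eq_1_zero _ N2 Ec). lra.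
  + assert (L3 : th' (g s) <> c).
    { intros E. rewrite E, Hcc in E2. lra. }
    assert (P1 : cos (th1 s) = sin c * sin (c - th1 s)).
    { replace (th1 s) with (c - (c - th1 s)) at 1 by ring. rewrite cos_minus, Hcc. ring. }
    assert (P2 : cos (th' (g s)) = - (sin c * sin (th' (g s) - c))).
    { replace (th' (g s)) with (c + (th' (g s) - c)) at 1 by ring. rewrite cos_plus, Hcc. ring. }
    pose proof (sin_gt_0 (c - th1 s) ltac:(lra) ltac:(lra)).
    pose proof (sin_gt_0 (th' (g s) - c) ltac:(lra) ltac:(lra)).
    rewrite P1 in E1. rewrite P2 in E2.
    assert (Q : 0 < a1 s * a1 s) by (pose proof (Rlt_0_sqr _ E0); unfold Rsqr in *; lra).
    rewrite E1 in Q at 1. rewrite E2 in Q.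
    assert (0 < r1 * r2 * (sin (c - th1 s) * sin (th' (g s) - c))).
    { apply Rmult_lt_0_compat; apply Rmult_lt_0_compat; trivial. }
    replace (r1 * (sin c * sin (c - th1 s)) * (r2 * - (sin c * sin (th' (g s) - c)))) with
      (- (sin c * sin c) * (r1 * r2 * (sin (c - th1 s) * sin (th' (g s) - c)))) in Q by ring.
    rewrite Hsc in Q. lra.
- intros c Hcc [S HS].
  assert (Hsc : sin c = 0).
  { pose proof (sin2_cos2 c) as Hs. unfold Rsqr in Hs. rewrite Hcc in Hs. nra. }
  assert (Hcm : forall t, cos (t - c) = cos t) by (intro; rewrite cos_minus, Hcc, Hsc; ring).
  exists (Rmax S S0 + C). intros s' Hs'.
  destruct (icurve_surj _ _ _ _ _ _ H s') as [s <-].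
  pose proof (HC s) as B. apply Rabs_le_between in B.
  pose proof (Rmax_l S S0). pose proof (Rmax_r S S0).
  specialize (HS s ltac:(lra)). specialize (Ha1p s ltac:(lra)).
  specialize (N2 s). destruct (D1 s) as [D _].
  destruct (A1 s) as [r1 [Hr1 [E1 _]]]. destruct (A2 s) as [r2 [Hr2 [E2 _]]].
  assert (R1 : - (PI / 2) < th1 s - c < PI / 2).
  { apply cos_pos_range; [lra |]. rewrite Hcm. rewrite E1 in Ha1p. nra. }
  apply cos_pos_range; [lra |]. rewrite Hcm. rewrite E2 in Ha1p. nra.
Qed.

(** * Recurrence *)

Lemma pigeonhole {A B : Type} (l : list A) (l' : list B) (h : A -> B) :
  NoDup l -> (forall x, In x l -> In (h x) l') -> (length l' < length l)%nat ->
  exists x y, In x l /\ In y l /\ x <> y /\ h x = h y.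
Proof.
intros Hnd Hin Hlen. apply NNPP. intros Hno.
assert (Hinj : NoDup (map h l)).
{ apply Injective_map_NoDup_in; trivial.
  intros x y Hx Hy E. apply NNPP. intros Hne. apply Hno. now exists x, y. }
assert (Hincl : incl (map h l) l').
{ intros z Hz. apply in_map_iff in Hz. destruct Hz as [x [<- Hx]]. now apply Hin. }
pose proof (NoDup_incl_length Hinj Hincl) as Hl. rewrite length_map in Hl. lia.
Qed.

Lemma NoDup_list_prod {A B : Type} (l : list A) (l' : list B) :
  NoDup l -> NoDup l' -> NoDup (list_prod l l').
Proof.
intros Hl Hl'. induction Hl as [|x l Hx Hl IH]; simpl; [constructor |].
apply NoDup_app; trivial.
- apply Injective_map_NoDup_in; trivial. intros u v _ _ E. now injection E.
- intros [u v] H1 H2. apply in_map_iff in H1. destruct H1 as [z [E _]]. injection E as <- <-.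
  apply in_prod_iff in H2. tauto.
Qed.

Definition shear (f : R -> R) (j : Z) (p : R * R) : R * R :=
  (fst p + snd p - IZR j, snd p + f (fst p + snd p)).

(** Coordinates are counted in units of 1/N. Only the kick is rounded, and it depends on the new
    first coordinate alone, so the rounded map is still a composition of two shears of the integer
    lattice and is injective. *)
Definition grid_shear (f : R -> R) (j : Z) (N : nat) (c : Z * Z) : Z * Z :=
  (fst c + snd c - j * Z.of_nat N,
   snd c + Int_part (INR N * f (IZR (fst c + snd c) / INR N))%R)%Z.

Lemma grid_shear_error (f : R -> R) (j : Z) (L : R) (n : nat) :
  0 <= L -> (forall u v, Rabs (f u - f v) <= L * Rabs (u - v)) ->
  exists E, 0 <= E /\ forall (N : nat) (c : Z * Z), (0 < N)%nat ->
    forall i, (i <= n)%nat ->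
    let p := Nat.iter i (shear f j) (IZR (fst c) / INR N, IZR (snd c) / INR N) in
    let c' := Nat.iter i (grid_shear f j N) c in
    Rabs (IZR (fst c') / INR N - fst p) <= E / INR N /\
    Rabs (IZR (snd c') / INR N - snd p) <= E / INR N.
Proof.
intros HL Hf. induction n as [|n [E [HE IH]]].
- exists 0. split; [lra |]. intros N c HN i Hi. replace i with 0%nat by lia. simpl.
  rewrite !Rminus_diag, Rabs_R0. unfold Rdiv. lra.
- exists (2 * E + 1 + 2 * L * E). split; [nra |].
  intros N c HN i Hi.
  assert (HN' : 0 < INR N) by (apply lt_0_INR; lia).
  assert (Hi' : 0 < / INR N) by now apply Rinv_0_lt_compat.
  destruct (Nat.eq_dec i (S n)) as [-> | Hne].
  2:{ destruct (IH N c HN i ltac:(lia)) as [A B]. simpl in *.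
      assert (E / INR N <= (2 * E + 1 + 2 * L * E) / INR N).
      { apply Rmult_le_compat_r; [lra | nra]. }
      lra. }
  destruct (IH N c HN n (le_n n)) as [A B]. simpl in *.
  set (p := Nat.iter n (shear f j) _) in *. set (d := Nat.iter n (grid_shear f j N) c) in *.
  unfold shear, grid_shear; simpl.
  assert (Es : IZR (fst d + snd d) / INR N = IZR (fst d) / INR N + IZR (snd d) / INR N).
  { rewrite plus_IZR. field. lra. }
  set (s := fst p + snd p).
  assert (Hs : Rabs (IZR (fst d + snd d) / INR N - s) <= 2 * E / INR N).
  { rewrite Es. unfold s.
    replace (IZR (fst d) / INR N + IZR (snd d) / INR N - (fst p + snd p)) with
     ((IZR (fst d) / INR N - fst p) + (IZR (snd d) / INR N - snd p)) by ring.
    eapply Rle_trans; [apply Rabs_triang |]. unfold Rdiv in *. lra. }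
  split.
  + rewrite minus_IZR, mult_IZR, <- INR_IZR_INZ.
    replace ((IZR (fst d + snd d) - IZR j * INR N) / INR N - (s - IZR j)) with
     (IZR (fst d + snd d) / INR N - s) by (field; lra).
    eapply Rle_trans; [apply Hs |].
    apply Rmult_le_compat_r; [lra | nra].
  + set (w := IZR (fst d + snd d) / INR N) in *.
    destruct (base_Int_part (INR N * f w)) as [I1 I2].
    rewrite plus_IZR.
    set (I := IZR (Int_part (INR N * f w))) in *.
    assert (HI : Rabs (I / INR N - f w) <= 1 / INR N).
    { replace (I / INR N - f w) with ((I - INR N * f w) * / INR N) by (field; lra).
      rewrite Rabs_mult, (Rabs_right (/ INR N)) by lra.
      apply Rmult_le_compat_r; [lra |]. apply Rabs_le. lra. }
    replace ((IZR (snd d) + I) / INR N - (snd p + f s)) with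
      ((IZR (snd d) / INR N - snd p) + ((I / INR N - f w) + (f w - f s))) by (field; lra).
    pose proof (Rabs_triang (IZR (snd d) / INR N - snd p) ((I / INR N - f w) + (f w - f s))).
    pose proof (Rabs_triang (I / INR N - f w) (f w - f s)).
    pose proof (Hf w s).
    assert (L * Rabs (w - s) <= L * (2 * E / INR N)) by (apply Rmult_le_compat_l; trivial).
    unfold Rdiv in *. nra.
Qed.

Lemma mod_eq_shift (a b K : Z) : (K <> 0 -> a mod K = b mod K -> b = a + (b / K - a / K) * K)%Z.
Proof. intros HK E. pose proof (Z.div_mod a K HK). pose proof (Z.div_mod b K HK). nia. Qed.

Definition congr_cols (q : nat) (c c' : Z * Z) : Prop :=
  exists i : Z, fst c' = (fst c + i * Z.of_nat q)%Z /\ snd c' = snd c.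

(** Injectivity on the annulus of circumference [k]: first coordinates that differ by multiples of
    [k N] differ by whole periods of the force, so both points receive the same kick. *)
Lemma grid_shear_congr (f : R -> R) (j : Z) (k N : nat) (c c' : Z * Z) :
  (0 < N)%nat -> (forall u, f (u + 1) = f u) ->
  congr_cols (k * N) (grid_shear f j N c) (grid_shear f j N c') -> congr_cols (k * N) c c'.
Proof.
intros HN Hf [i [E1 E2]]. unfold grid_shear in *; simpl in *.
assert (HN' : 0 < INR N) by (apply lt_0_INR; lia).
assert (E : (fst c' + snd c' = fst c + snd c + (i * Z.of_nat k) * Z.of_nat N)%Z) by lia.
rewrite E in E2.
assert (Ef : f (IZR (fst c + snd c + i * Z.of_nat k * Z.of_nat N) / INR N) = f (IZR (fst c + snd c) / INR N)).
{ rewrite plus_IZR, mult_IZR, <- (INR_IZR_INZ N).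
  replace ((IZR (fst c + snd c) + IZR (i * Z.of_nat k) * INR N) / INR N) with
    (IZR (fst c + snd c) / INR N + IZR (i * Z.of_nat k)) by (field; lra).
  rewrite (shift_periodic f 0) by (intro; rewrite Hf; ring). ring. }
rewrite Ef in E2. exists i. lia.
Qed.

Lemma grid_shear_iter_congr (f : R -> R) (j : Z) (k N n d : nat) (c c' : Z * Z) :
  (0 < N)%nat -> (forall u, f (u + 1) = f u) ->
  congr_cols (k * N) (Nat.iter n (grid_shear f j N) c) (Nat.iter (n + d) (grid_shear f j N) c') ->
  congr_cols (k * N) c (Nat.iter d (grid_shear f j N) c').
Proof.
intros HN Hf. induction n as [|n IH]; simpl; trivial.
intros H. apply IH. now apply grid_shear_congr in H.
Qed.

Lemma nat_above (x : R) : exists n : nat, (0 < n)%nat /\ x < INR n.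
Proof.
destruct (archimed x) as [H _].
exists (S (Z.to_nat (up x))). split; [lia |]. rewrite S_INR, INR_IZR_INZ.
destruct (Z_le_dec 0 (up x)) as [H0 | H0].
- rewrite Z2Nat.id by trivial. lra.
- assert (IZR (up x) <= 0) by (apply (IZR_le _ 0); lia).
  replace (Z.to_nat (up x)) with 0%nat by lia. simpl. lra.
Qed.

(* Rounding both shears to the grid of mesh [1/N] gives a bijection of the grid that tracks finitely many
   iterates to within [O(1/N)], so the pigeonhole principle on grid points replaces Poincare recurrence. *)
Lemma shear_recurrence (f : R -> R) (j : Z) (L : R) (k : nat) (x0 y0 r Yb : R) :
  (0 < k)%nat -> 0 <= L -> (forall u v, Rabs (f u - f v) <= L * Rabs (u - v)) ->
  (forall u, f (u + 1) = f u) -> 0 < r ->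
  (forall p, Rabs (fst p - x0) < r -> Rabs (snd p - y0) < r ->
    forall n, Rabs (snd (Nat.iter n (shear f j) p)) <= Yb) ->
  exists p (n : nat) (i : Z), Rabs (fst p - x0) < r /\ Rabs (snd p - y0) < r /\
    Rabs (fst (Nat.iter (S n) (shear f j) p) + INR k * IZR i - x0) < r /\
    Rabs (snd (Nat.iter (S n) (shear f j) p) - y0) < r.
Proof.
intros Hk HL Hlip Hper Hr Hbd.
set (rho := Rmin (r / 4) 1).
assert (Hrho : 0 < rho <= 1 /\ rho <= r / 4).
{ unfold rho. split; [split; [apply Rmin_pos; lra | apply Rmin_r] | apply Rmin_l]. }
destruct (nat_above (Yb + 1)) as [Y1 [_ HY1]].
(* The starting box has m^2 >= (rho N)^2 / 4 grid points, and the orbits stay in at most k N (2 Y1 N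
   + 1) cells of the annulus, so [M] images of the box cannot be disjoint. [N] is chosen after [M],
   because the tracking error depends on the number of iterates. *)
destruct (nat_above (4 * (INR k * (2 * INR Y1 + 1)) / (rho * rho))) as [M [HM0 HM]].
destruct (grid_shear_error f j L M HL Hlip) as [E [HE Herr]].
destruct (nat_above ((E + 2) / rho)) as [N [HN0 HN]].
assert (HN' : 0 < INR N) by (apply lt_0_INR; lia).
assert (HNi : 0 < / INR N) by now apply Rinv_0_lt_compat.
assert (HNr : E + 2 < rho * INR N).
{ apply Rlt_div_l in HN; lra. }
assert (Hdiv : forall u v, u <= v * INR N -> u / INR N <= v).
{ intros u v Huv. apply Rle_div_l; lra. }
assert (HE1 : E / INR N <= rho) by (apply Hdiv; lra).
assert (HE2 : E / INR N <= 1) by lra.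
set (m := Z.to_nat (Int_part (rho * INR N))).
destruct (base_Int_part (rho * INR N)) as [Im1 Im2].
assert (Hm : INR m = IZR (Int_part (rho * INR N))).
{ unfold m. rewrite INR_IZR_INZ, Z2Nat.id; trivial. apply le_IZR.
  assert (0 < IZR (Int_part (rho * INR N))) by lra. lra. }
assert (Hmhalf : rho * INR N <= 2 * INR m) by lra.
assert (Hm1 : INR m <= rho * INR N) by lra.
set (a0 := Int_part (INR N * x0)). set (b0 := Int_part (INR N * y0)).
destruct (base_Int_part (INR N * x0)) as [Ia1 Ia2]. fold a0 in Ia1, Ia2.
destruct (base_Int_part (INR N * y0)) as [Ib1 Ib2]. fold b0 in Ib1, Ib2.
set (pt := fun t : nat * nat => ((a0 + Z.of_nat (fst t))%Z, (b0 + Z.of_nat (snd t))%Z)).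
set (emb := fun c : Z * Z => (IZR (fst c) / INR N, IZR (snd c) / INR N)).
assert (Hnear : forall z z0 i, IZR z0 <= INR N * z -> IZR z0 - INR N * z > -1 -> (i < m)%nat ->
  Rabs (IZR (z0 + Z.of_nat i) / INR N - z) <= rho).
{ intros z z0 i H1 H2 Hi. rewrite plus_IZR, <- INR_IZR_INZ.
  apply lt_INR in Hi. pose proof (pos_INR i).
  replace ((IZR z0 + INR i) / INR N - z) with ((IZR z0 + INR i - INR N * z) / INR N) by (field; lra).
  apply Rabs_le. split.
  - apply Rle_div_r; lra.
  - apply Rle_div_l; lra. }
assert (Hpt : forall t, (fst t < m)%nat -> (snd t < m)%nat ->
  Rabs (fst (emb (pt t)) - x0) <= rho /\ Rabs (snd (emb (pt t)) - y0) <= rho).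
{ intros t H1 H2. unfold emb, pt; simpl. split; apply Hnear; trivial. }
set (h := fun u : nat * (nat * nat) =>
  let c := Nat.iter (fst u) (grid_shear f j N) (pt (snd u)) in
  ((fst c mod Z.of_nat (k * N))%Z, snd c)).
set (src := list_prod (seq 0 M) (list_prod (seq 0 m) (seq 0 m))).
set (dst := list_prod (map Z.of_nat (seq 0 (k * N)))
  (map (fun n => (Z.of_nat n - Z.of_nat (Y1 * N))%Z) (seq 0 (2 * Y1 * N + 1)))).
destruct (pigeonhole src dst h) as [[n [i1 i2]] [[n' [i1' i2']] [H1 [H2 [Hne Heq]]]]].
- repeat apply NoDup_list_prod; apply seq_NoDup.
- intros [n t] Hin. unfold src in Hin.
  apply in_prod_iff in Hin. destruct Hin as [Hn Ht]. destruct t as [i1 i2].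
  apply in_prod_iff in Ht. destruct Ht as [Hi1 Hi2].
  apply in_seq in Hn, Hi1, Hi2. unfold h. simpl fst at 1. simpl snd at 1.
  set (c := Nat.iter _ _ _).
  apply in_prod_iff. split.
  + apply in_map_iff. exists (Z.to_nat (fst c mod Z.of_nat (k * N))).
    pose proof (Z.mod_pos_bound (fst c) (Z.of_nat (k * N)) ltac:(nia)).
    split; [lia | apply in_seq; lia].
  + destruct (Herr N (pt (i1, i2)) HN0 n ltac:(lia)) as [_ B]. fold (emb (pt (i1, i2))) in B. simpl in B. fold c in B.
    destruct (Hpt (i1, i2)) as [P1 P2]; [simpl; lia | simpl; lia |].
    pose proof (Hbd (emb (pt (i1, i2))) ltac:(lra) ltac:(lra) n) as B2.
    set (z := snd (Nat.iter n (shear f j) (emb (pt (i1, i2))))) in *.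
    apply Rabs_le_between in B, B2.
    assert (B3 : - INR Y1 <= IZR (snd c) / INR N <= INR Y1) by (split; lra).
    destruct B3 as [B3 B4]. apply Rle_div_r in B3; [| lra]. apply Rle_div_l in B4; [| lra].
    rewrite INR_IZR_INZ, INR_IZR_INZ in B3. rewrite INR_IZR_INZ, INR_IZR_INZ in B4.
    rewrite <- mult_IZR in B4. rewrite <- opp_IZR, <- mult_IZR in B3.
    apply le_IZR in B3, B4.
    apply in_map_iff. exists (Z.to_nat (snd c + Z.of_nat (Y1 * N))).
    split; [lia | apply in_seq; lia].
- unfold src, dst. rewrite !length_prod, !length_map, !length_seq.
  apply INR_lt. rewrite !mult_INR, plus_INR, !mult_INR. simpl (INR 1). simpl (INR 2).
  apply Rlt_div_l in HM; [| nra].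
  pose proof (pos_INR Y1). pose proof (pos_INR m). pose proof (pos_INR k). pose proof (pos_INR M).
  assert (1 <= INR N) by (apply (le_INR 1); lia).
  apply Rle_lt_trans with (INR k * INR N * ((2 * INR Y1 + 1) * INR N)).
  { apply Rmult_le_compat_l; [nra |]. nra. }
  assert (Q : rho * INR N * (rho * INR N) <= 4 * (INR m * INR m)) by nra.
  assert (0 < INR N * INR N) by nra.
  assert (Q2 : 4 * (INR k * (2 * INR Y1 + 1)) * (INR N * INR N) < INR M * (rho * rho) * (INR N * INR N)).
  { apply Rmult_lt_compat_r; trivial. }
  assert (Q3 : INR M * (rho * INR N * (rho * INR N)) <= INR M * (4 * (INR m * INR m))).
  { now apply Rmult_le_compat_l. }
  nra.
(* Two coinciding images at times [d] and [S n + d] are pulled back [d] times by injectivity, which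
   leaves a return to the box after [S n] steps. *)
- assert (Hret : forall n d t t', (fst t < m)%nat -> (snd t < m)%nat -> (fst t' < m)%nat -> (snd t' < m)%nat ->
    (S n + d < M)%nat -> h (d, t) = h ((S n + d)%nat, t') ->
    exists p (n : nat) (i : Z), Rabs (fst p - x0) < r /\ Rabs (snd p - y0) < r /\
    Rabs (fst (Nat.iter (S n) (shear f j) p) + INR k * IZR i - x0) < r /\
    Rabs (snd (Nat.iter (S n) (shear f j) p) - y0) < r).
  { clear - Hrho Hpt Herr HN0 HE1 HN' Hper Hk. intros n d t t' T1 T2 T3 T4 HnM Heq.
    assert (Hcg : congr_cols (k * N) (Nat.iter d (grid_shear f j N) (pt t)) (Nat.iter (d + S n) (grid_shear f j N) (pt t'))).
    { rewrite Nat.add_comm. unfold h in Heq. simpl fst in Heq. simpl snd in Heq.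
      injection Heq as E1 E2.
      set (c := Nat.iter d _ _) in *.
      change (grid_shear f j N (Nat.iter (n + d) (grid_shear f j N) (pt t'))) with (Nat.iter (S n + d) (grid_shear f j N) (pt t')) in E1, E2.
      set (c' := Nat.iter (S n + d) _ _) in *.
      exists (fst c' / Z.of_nat (k * N) - fst c / Z.of_nat (k * N))%Z. split; [| now symmetry].
      apply mod_eq_shift; [nia | exact E1]. }
    apply grid_shear_iter_congr in Hcg; trivial.
    destruct Hcg as [i [E1 E2]].
    destruct (Hpt t T1 T2) as [P1 P2]. destruct (Hpt t' T3 T4) as [P1' P2'].
    destruct (Herr N (pt t') HN0 (S n) ltac:(lia)) as [A B]. fold (emb (pt t')) in A, B. cbv zeta in A, B.
    rewrite E1 in A. rewrite E2 in B.
    exists (emb (pt t')), n, (- i)%Z.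
    split; [lra |]. split; [lra |].
    set (q := Nat.iter (S n) (shear f j) (emb (pt t'))) in *.
    split.
    - replace (IZR (fst (pt t) + i * Z.of_nat (k * N)) / INR N) with (fst (emb (pt t)) + INR k * IZR i) in A.
      2:{ unfold emb. cbn [fst]. rewrite plus_IZR, mult_IZR, <- INR_IZR_INZ, mult_INR. field. lra. }
      rewrite opp_IZR. apply Rabs_le_between in A, P1. apply Rabs_def1; lra.
    - change (IZR (snd (pt t)) / INR N) with (snd (emb (pt t))) in B.
      apply Rabs_le_between in B, P2. apply Rabs_def1; lra. }
  unfold src in H1, H2. rewrite !in_prod_iff, !in_seq in H1, H2.
  destruct (lt_eq_lt_dec n n') as [[Hlt | ->] | Hlt].
  + apply (Hret (n' - n - 1)%nat n (i1, i2) (i1', i2')); simpl; try lia.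
    replace (S (n' - n - 1 + n)) with n' by lia. exact Heq.
  (* At equal times injectivity makes the two starting points congruent, and they coincide because
     the box is no wider than the annulus. *)
  + exfalso. apply Hne. unfold h in Heq. simpl fst in Heq. simpl snd in Heq.
    injection Heq as E1 E2.
    assert (Hcg : congr_cols (k * N) (Nat.iter n' (grid_shear f j N) (pt (i1, i2))) (Nat.iter (n' + 0) (grid_shear f j N) (pt (i1', i2')))).
    { rewrite Nat.add_0_r.
      set (c := Nat.iter n' _ (pt (i1, i2))) in *. set (c' := Nat.iter n' _ (pt (i1', i2'))) in *.
      exists (fst c' / Z.of_nat (k * N) - fst c / Z.of_nat (k * N))%Z. split; [| now symmetry].
      apply mod_eq_shift; [nia | exact E1]. }
    apply grid_shear_iter_congr in Hcg; trivial.
    destruct Hcg as [i [F1 F2]]. simpl in F1, F2.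
    assert (Hmk : (m <= k * N)%nat).
    { apply INR_le. rewrite mult_INR.
      assert (1 <= INR k) by (apply (le_INR 1); lia). nra. }
    assert (i = 0)%Z by nia.
    assert (i1 = i1') by lia. assert (i2 = i2') by lia. congruence.
  + apply (Hret (n - n' - 1)%nat n' (i1', i2') (i1, i2)); simpl; try lia.
    replace (S (n - n' - 1 + n')) with n by lia. now symmetry.
Qed.

(** * Birkhoff's graph theorem *)

Lemma alift_left X Y x y th S : alift X Y x y th -> (forall s, s <= S -> X s < x) ->
  forall s, s <= S -> PI / 2 < th s < 3 * (PI / 2).
Proof.
intros [Cth [Ha [S0 H0]]] HX s Hs.
apply (stays_between th _ _ (Rmin S S0)); trivial.
- apply H0, Rmin_r.
- intros t Ht.
  assert (Hts : X t < x).
  { apply HX. pose proof (Rmin_l S S0). unfold Rmax in Ht. destruct Rle_dec; lra. }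
  destruct (Ha t) as [r [Hr [E _]]]. cbv beta in E.
  split; intro E'; rewrite E' in E; rewrite ?cos_PI2, ?cos_3PI2 in E; lra.
Qed.

Lemma alift_right X Y x y th S : alift X Y x y th -> (forall s, S <= s -> x < X s) ->
  forall c, cos c = 0 -> c < th S -> forall s, S <= s -> c < th s.
Proof.
intros [Cth [Ha _]] HX c Hc HS s Hs.
apply Rnot_le_lt. intros Hle.
assert (Cth' : forall x, continuity_pt th x) by exact Cth.
destruct (IVT_gen th S s c Cth') as [t [Ht E]].
{ split; [apply Rle_trans with (th s); [apply Rmin_r | lra] | apply Rle_trans with (th S); [lra | apply Rmax_l]]. }
rewrite Rmin_left in Ht by trivial.
destruct (Ha t) as [r [Hr [Ec _]]]. cbv beta in Ec. rewrite E, Hc in Ec.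
pose proof (HX t ltac:(lra)). lra.
Qed.

Lemma alift_below X Y x y th : alift X Y x y th -> (forall s, y < Y s) -> forall s, 0 < th s < PI.
Proof.
intros [Cth [Ha [S0 H0]]] HY s. pose proof PI_RGT_0.
apply (stays_between th _ _ S0); trivial.
- specialize (H0 S0 (Rle_refl _)). split; [lra |].
  apply Rnot_le_lt. intros Hle.
  destruct (Ha S0) as [r [Hr [_ E]]]. cbv beta in E.
  pose proof (sin_le_0 (th S0) Hle ltac:(lra)). pose proof (HY S0). nra.
- intros t _. destruct (Ha t) as [r [Hr [_ E]]]. cbv beta in E. pose proof (HY t).
  split; intro E'; rewrite E' in E; rewrite ?sin_0, ?sin_PI in E; lra.
Qed.

Lemma alift_above X Y x y th : alift X Y x y th -> (forall s, Y s < y) -> forall s, PI < th s < 2 * PI.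
Proof.
intros [Cth [Ha [S0 H0]]] HY s. pose proof PI_RGT_0.
apply (stays_between th _ _ S0); trivial.
- specialize (H0 S0 (Rle_refl _)). split; [| lra].
  apply Rnot_le_lt. intros Hle.
  destruct (Ha S0) as [r [Hr [_ E]]]. cbv beta in E.
  pose proof (sin_ge_0 (th S0) ltac:(lra) Hle). pose proof (HY S0). nra.
- intros t _. destruct (Ha t) as [r [Hr [_ E]]]. cbv beta in E. pose proof (HY t).
  split; intro E'; rewrite E' in E; rewrite ?sin_PI, ?sin_2PI in E; lra.
Qed.

(** At either bound the curve would have a point straight below [(x,y)]. *)
Lemma alift_visible X Y x y th : alift X Y x y th -> (forall s, X s = x -> y < Y s) ->
  forall s, - (PI / 2) < th s < 3 * (PI / 2).
Proof.
intros [Cth [Ha [S0 H0]]] HV s. pose proof PI_RGT_0.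
apply (stays_between th _ _ S0); trivial.
- specialize (H0 S0 (Rle_refl _)). lra.
- intros t _. destruct (Ha t) as [r [Hr [Ec Es]]]. cbv beta in Ec, Es.
  split; intro E'; rewrite E' in Ec, Es.
  + rewrite cos_neg, cos_PI2 in Ec. rewrite sin_neg, sin_PI2 in Es.
    pose proof (HV t ltac:(lra)). lra.
  + rewrite cos_3PI2 in Ec. rewrite sin_3PI2 in Es.
    pose proof (HV t ltac:(lra)). lra.
Qed.

(* The curve passes straight below the point after having gone around it clockwise. *)
Definition pocket (X Y : R -> R) (x y : R) : Prop :=
  exists th, alift X Y x y th /\ exists s, th s <= - (PI / 2).

Lemma pocket_shift k X Y x y (i : Z) : curve k X Y -> pocket X Y x y ->
  pocket X Y (x + INR k * IZR i) y.
Proof.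
intros H [th [[Cth [Ha [S0 H0]]] [s Hs]]].
exists (fun t => th (t + IZR (- i))). split; [split; [| split] |].
- intro t. apply (continuity_pt_comp (fun t => t + IZR (- i)) th); [| apply Cth].
  apply continuity_pt_plus; [apply continuity_pt_id | apply continuity_pt_const; intros u v; reflexivity].
- intros t. destruct (Ha (t + IZR (- i))) as [r [Hr [Ec Es]]]. cbv beta in Ec, Es.
  rewrite (shift_periodic X (INR k) (curve_perX _ _ _ H)) in Ec.
  rewrite (shift_periodic Y 0) in Es by (intro; rewrite (curve_perY _ _ _ H); ring).
  exists r. split; [trivial |]. rewrite <- Ec, <- Es, opp_IZR. split; ring.
- exists (S0 + IZR i). intros t Ht. apply H0. rewrite opp_IZR. lra.
- exists (s + IZR i). rewrite opp_IZR. replace (s + IZR i + - IZR i) with s by ring. trivial.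
Qed.

(** On a compact range of parameters the angle exceeds -PI/2 by a fixed margin, which small
    displacements respect; outside this range the curve is strictly to the left or to the right of
    the point and the angle cannot cross the vertical. *)
Lemma not_pocket_open k X Y x y : curve k X Y -> avoids X Y x y -> ~ pocket X Y x y ->
  exists r, 0 < r /\ forall x' y', Rabs (x' - x) < r -> Rabs (y' - y) < r -> ~ pocket X Y x' y'.
Proof.
intros H Hav Hnp. pose proof PI_RGT_0 as Hpi.
destruct (alift_exists _ _ _ _ _ H Hav) as [th Hth].
assert (Hth0 : forall s, - (PI / 2) < th s).
{ intros s. apply Rnot_le_lt. intros Hle. apply Hnp. exists th. split; trivial. now exists s. }
destruct (curve_X_large _ _ _ H (Rabs x + 1)) as [S [HS [HX1 HX2]]].
destruct (continuity_ab_min th (- S) S) as [m [Hm _]]; [lra | intros; apply Hth |].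
destruct (alift_perturb _ _ _ _ _ _ (th m + PI / 2) H Hth) as [r [Hr Hp]].
{ specialize (Hth0 m). lra. }
exists (Rmin r 1). split; [apply Rmin_pos; lra |].
intros x' y' Hx' Hy' [th' [Hth' [s Hs]]].
destruct (Hp x' y') as [_ Hclose].
{ eapply Rlt_le_trans; [apply Hx' | apply Rmin_l]. }
{ eapply Rlt_le_trans; [apply Hy' | apply Rmin_l]. }
specialize (Hclose th' Hth').
assert (Hx1 : Rabs (x' - x) < 1) by (eapply Rlt_le_trans; [apply Hx' | apply Rmin_r]).
apply Rabs_def2 in Hx1.
pose proof (Rle_abs x). pose proof (Rle_abs (- x)) as Hx. rewrite Rabs_Ropp in Hx.
assert (Hin : forall t, - S <= t <= S -> - (PI / 2) < th' t).
{ intros t Ht. pose proof (Hclose t) as Hc. apply Rabs_def2 in Hc. pose proof (Hm t Ht). lra. }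
apply Rle_not_lt in Hs. apply Hs.
destruct (Rle_dec (- S) s) as [L1 | L1].
- destruct (Rle_dec s S) as [L2 | L2]; [now apply Hin |].
  apply (alift_right _ _ _ _ _ S Hth'); try lra.
  + intros t Ht. specialize (HX1 t Ht). lra.
  + rewrite cos_neg. apply cos_PI2.
  + apply Hin. lra.
- pose proof (alift_left _ _ _ _ _ (- S) Hth') as Hl.
  destruct (Hl ltac:(intros t Ht; specialize (HX2 t Ht); lra) s ltac:(lra)). lra.
Qed.

(** Strictness of the clockwise turn makes an angle <= -PI/2 into one < -PI/2, which is an open
    condition. Hence even a boundary case has a whole neighbourhood of pocket points around its
    image. *)
Lemma pocket_image f j g k X Y x y : icurve f j g k X Y -> pocket X Y x y ->
  exists r, 0 < r /\ forall x' y', Rabs (x' - (x + y - IZR j)) < r ->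
    Rabs (y' - (y + f (x + y))) < r -> pocket X Y x' y'.
Proof.
intros H [th [Hth [s Hs]]]. pose proof PI_RGT_0 as Hpi.
pose proof (icurve_curve _ _ _ _ _ _ H) as Hc.
destruct (alift_exists _ _ _ _ _ Hc (icurve_avoids _ _ _ _ _ _ _ _ H (alift_avoids _ _ _ _ _ Hth))) as [th' Hth'].
destruct (icurve_transport _ _ _ _ _ _ _ _ _ _ H Hth Hth') as [T _].
specialize (T s (- (PI / 2)) ltac:(rewrite cos_neg; apply cos_PI2) Hs).
destruct (alift_perturb _ _ _ _ _ _ (- (PI / 2) - th' (g s)) Hc Hth' ltac:(lra)) as [r [Hr Hp]].
exists r. split; trivial. intros x' y' Hx' Hy'.
destruct (Hp x' y' Hx' Hy') as [Hav Hcl].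
destruct (alift_exists _ _ _ _ _ Hc Hav) as [th'' Hth''].
exists th''. split; trivial. exists (g s). specialize (Hcl _ Hth'' (g s)). apply Rabs_def2 in Hcl. lra.
Qed.

(** The limiting direction at +oo tells the side of the curve: [c = 0] for points below it, pockets
    included, and [c = 2 * PI] for points above it. *)
Definition ends (X Y : R -> R) (c x y : R) : Prop :=
  exists th, alift X Y x y th /\ exists S, forall s, S <= s -> - (PI / 2) < th s - c < PI / 2.

Lemma ends_image f j g k X Y c x y : icurve f j g k X Y -> cos c = 1 -> ends X Y c x y ->
  ends X Y c (x + y - IZR j) (y + f (x + y)).
Proof.
intros H Hcc [th [Hth Hend]].
pose proof (icurve_curve _ _ _ _ _ _ H) as Hc.
destruct (alift_exists _ _ _ _ _ Hc (icurve_avoids _ _ _ _ _ _ _ _ H (alift_avoids _ _ _ _ _ Hth))) as [th' Hth'].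
destruct (icurve_transport _ _ _ _ _ _ _ _ _ _ H Hth Hth') as [_ T].
exists th'. split; trivial. now apply T.
Qed.

Lemma ends_iter f j g k X Y c p : icurve f j g k X Y -> cos c = 1 -> ends X Y c (fst p) (snd p) ->
  forall n, ends X Y c (fst (Nat.iter n (shear f j) p)) (snd (Nat.iter n (shear f j) p)).
Proof.
intros H Hcc Hp. induction n as [|n IH]; trivial. simpl.
apply (ends_image _ _ _ _ _ _ _ _ _ H Hcc IH).
Qed.

Lemma ends_below_bound X Y x y C : (forall s, Y s <= C) -> ends X Y 0 x y -> y <= C.
Proof.
intros HC [th [Hth [S HS]]]. apply Rnot_lt_le. intros Hlt. pose proof PI_RGT_0.
pose proof (alift_above _ _ _ _ _ Hth ltac:(intro s; specialize (HC s); lra) S).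
specialize (HS S (Rle_refl _)). lra.
Qed.

Lemma ends_above_bound X Y x y C : (forall s, C <= Y s) -> ends X Y (2 * PI) x y -> C <= y.
Proof.
intros HC [th [Hth [S HS]]]. apply Rnot_lt_le. intros Hlt. pose proof PI_RGT_0.
pose proof (alift_below _ _ _ _ _ Hth ltac:(intro s; specialize (HC s); lra) S).
specialize (HS S (Rle_refl _)). lra.
Qed.

Lemma alift_cos_pos k X Y x y th : curve k X Y -> alift X Y x y th ->
  exists S, forall s, S <= s -> 0 < cos (th s).
Proof.
intros H Hth. destruct (curve_X_large _ _ _ H x) as [S [_ [HX _]]].
exists S. intros s Hs. destruct Hth as [_ [Ha _]]. destruct (Ha s) as [r [Hr [E _]]]. cbv beta in E.
specialize (HX s Hs). apply Rnot_le_lt. intro. nra.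
Qed.

(** Lowering the curve by [k m] removes [m] parameter periods per step, which the shift of [g]
    absorbs. The lowered invariant curve serves as a lower barrier for the orbits in the recurrence
    argument. *)
Lemma icurve_lower f j g k X Y (m : nat) : icurve f j g k X Y -> (forall u, f (u + 1) = f u) ->
  icurve f j (fun s => g s - INR m) k X (fun s => Y s - INR k * INR m).
Proof.
intros [[H1 H2 H3 H4 H5 H6] Cf Cg EX EY] Hper.
assert (P1 : forall s, X (s - INR m) = X s - INR k * INR m).
{ intros s. replace (s - INR m) with (s + IZR (- Z.of_nat m)) by (rewrite opp_IZR, <- INR_IZR_INZ; ring).
  rewrite (shift_periodic X (INR k) H4), opp_IZR, <- INR_IZR_INZ. ring. }
assert (P2 : forall s, Y (s - INR m) = Y s).
{ intros s. replace (s - INR m) with (s + IZR (- Z.of_nat m)) by (rewrite opp_IZR, <- INR_IZR_INZ; ring).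
  rewrite (shift_periodic Y 0) by (intro; rewrite H5; ring). ring. }
constructor; trivial.
- constructor; trivial.
  + now apply continuity_minus_cst.
  + intros s. now rewrite H5.
  + intros s t Ex Ey. apply H6; trivial. lra.
- now apply continuity_minus_cst.
- intros s. rewrite P1. pose proof (EX s). lra.
- intros s. rewrite P2.
  replace (X s + (Y s - INR k * INR m)) with (X s + Y s + IZR (- (Z.of_nat k * Z.of_nat m))).
  + rewrite (shift_periodic f 0) by (intro; rewrite Hper; ring). pose proof (EY s). lra.
  + rewrite opp_IZR, mult_IZR, <- !INR_IZR_INZ. ring.
Qed.

(* Birkhoff: if the image of a point visible from below were hidden, then pushing the point down the vertical
   would produce a ball of non-pocket points all of whose later images are pocket points, contradicting recurrence. *)
Lemma visible_image f j g k X Y L :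
  icurve f j g k X Y -> 0 <= L -> (forall u v, Rabs (f u - f v) <= L * Rabs (u - v)) ->
  (forall u, f (u + 1) = f u) ->
  forall x y, (forall s, X s = x -> y < Y s) ->
  forall s, X s = x + y - IZR j -> y + f (x + y) < Y s.
Proof.
intros H HL Hlip Hper x y HV s1 Hs1. apply Rnot_le_lt. intros Hs2.
pose proof (icurve_curve _ _ _ _ _ _ H) as Hc. pose proof PI_RGT_0 as Hpi.
set (qx := fun t => x + (y - t) - IZR j). set (qy := fun t => (y - t) + f (x + (y - t))).
assert (HVt : forall t, 0 <= t -> forall s, X s = x -> y - t < Y s).
{ intros t Ht s Hs. specialize (HV s Hs). lra. }
assert (Havt : forall t, 0 <= t -> avoids X Y x (y - t)).
{ intros t Ht s E1 E2. specialize (HVt t Ht s E1). lra. }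
assert (Havq : forall t, 0 <= t -> avoids X Y (qx t) (qy t)).
{ intros t Ht. apply (icurve_avoids _ _ _ _ _ _ _ _ H (Havt t Ht)). }
assert (Hends : forall t, 0 <= t -> ends X Y 0 (qx t) (qy t)).
{ intros t Ht. apply (ends_image _ _ _ _ _ _ _ _ _ H cos_0).
  destruct (alift_exists _ _ _ _ _ Hc (Havt t Ht)) as [th Hth].
  exists th. split; trivial. destruct (alift_cos_pos _ _ _ _ _ _ Hc Hth) as [S HS].
  exists S. intros s Hs. pose proof (alift_visible _ _ _ _ _ Hth (HVt t Ht) s).
  rewrite Rminus_0_r. apply cos_pos_range; [lra | now apply HS]. }
(* The curve passes straight below or through the image, so the angle there is -PI/2 modulo 2 PI;
   transport of the visible range keeps it below 3 PI/2. *)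
assert (Hpk0 : pocket X Y (qx 0) (qy 0)).
{ destruct (alift_exists _ _ _ _ _ Hc (Havt 0 (Rle_refl 0))) as [th Hth].
  destruct (alift_exists _ _ _ _ _ Hc (Havq 0 (Rle_refl 0))) as [th' Hth'].
  destruct (icurve_transport _ _ _ _ _ _ _ _ _ _ H Hth Hth') as [T _].
  exists th'. split; trivial. exists s1.
  assert (Hup : th' s1 < 3 * (PI / 2)).
  { destruct (icurve_surj _ _ _ _ _ _ H s1) as [s <-]. apply T; [apply cos_3PI2 |].
    pose proof (alift_visible _ _ _ _ _ Hth (HVt 0 (Rle_refl 0)) s). lra. }
  apply Rnot_lt_le. intros Hlow.
  destruct Hth' as [_ [Ha _]]. destruct (Ha s1) as [r [Hr [Ec Es]]]. cbv beta in Ec, Es.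
  unfold qx, qy in Ec, Es. rewrite Rminus_0_r in Ec, Es.
  assert (Hcos : cos (th' s1) = 0) by (rewrite Hs1 in Ec; nra).
  assert (Hz : th' s1 - PI / 2 = 0).
  { apply cos_eq_1_zero; [lra |]. rewrite sin_minus, Hcos, cos_PI2. ring. }
  replace (th' s1) with (PI / 2) in Es by lra. rewrite sin_PI2 in Es. lra. }
destruct (curve_boundY _ _ _ Hc) as [CY HCY].
assert (HCY' : forall s, - CY <= Y s <= CY) by (intro s; apply Rabs_le_between, HCY).
destruct (periodic_bounded f (icurve_contf _ _ _ _ _ _ H) Hper) as [Cf HCf].
(* The depths [t] for which the image of the lowered point is a pocket. They are bounded, since far
   down the image lies below the whole curve, and the supremum is attained because non-pockets form
   an open set. *)
set (E := fun t => 0 <= t /\ pocket X Y (qx t) (qy t)).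
assert (Hbd : bound E).
{ exists (Rabs y + Cf + CY). intros t [Ht [th [Hth [s Hs]]]]. apply Rnot_lt_le. intros Hlt.
  pose proof (HCf (x + (y - t))) as B. apply Rabs_le_between in B. pose proof (Rle_abs y).
  assert (Hbelow : forall s, qy t < Y s).
  { intros u. specialize (HCY' u). unfold qy. lra. }
  pose proof (alift_below _ _ _ _ _ Hth Hbelow s). lra. }
destruct (completeness E Hbd) as [m [Hub Hlub]].
{ exists 0. split; [lra | trivial]. }
assert (Hm0 : 0 <= m) by (apply Hub; split; [lra | trivial]).
assert (Hqx : forall t u, Rabs (qx t - qx u) <= Rabs (t - u)).
{ intros t u. unfold qx. right. rewrite <- Rabs_Ropp. f_equal. ring. }
assert (Hqy : forall t u, Rabs (qy t - qy u) <= (1 + L) * Rabs (t - u)).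
{ intros t u. unfold qy.
  replace (y - t + f (x + (y - t)) - (y - u + f (x + (y - u)))) with
    ((u - t) + (f (x + (y - t)) - f (x + (y - u)))) by ring.
  eapply Rle_trans; [apply Rabs_triang |].
  specialize (Hlip (x + (y - t)) (x + (y - u))).
  replace (x + (y - t) - (x + (y - u))) with (u - t) in Hlip by ring.
  rewrite (Rabs_minus_sym u t) in *. lra. }
assert (Hpm : pocket X Y (qx m) (qy m)).
{ apply NNPP. intros Hnp.
  destruct (not_pocket_open _ _ _ _ _ Hc (Havq m Hm0) Hnp) as [r [Hr Ho]].
  assert (Hd : 0 < r / (2 * (1 + L))) by (apply Rdiv_lt_0_compat; lra).
  assert (Hle : m <= m - r / (2 * (1 + L))); [| lra].
  apply Hlub. intros t [Ht Hpt]. apply Rnot_lt_le. intros Hlt.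
  assert (t <= m) by (apply Hub; now split).
  assert (Habs : Rabs (t - m) * (2 * (1 + L)) < r).
  { apply Rlt_div_r; [lra |]. apply Rabs_def1; lra. }
  pose proof (Rabs_pos (t - m)).
  apply (Ho (qx t) (qy t)); trivial.
  - eapply Rle_lt_trans; [apply Hqx | nra].
  - eapply Rle_lt_trans; [apply Hqy | nra]. }
destruct (pocket_image _ _ _ _ _ _ _ _ H Hpm) as [r1 [Hr1 Hp1]].
set (K := 2 + 2 * L). assert (HK : 2 <= K) by (unfold K; lra).
assert (Hsx : forall x1 y1 x2 y2 d, Rabs (x1 - x2) <= d -> Rabs (y1 - y2) <= d ->
  Rabs ((x1 + y1 - IZR j) - (x2 + y2 - IZR j)) <= K * d /\
  Rabs ((y1 + f (x1 + y1)) - (y2 + f (x2 + y2))) <= K * d).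
{ intros x1 y1 x2 y2 d D1 D2.
  assert (D3 : Rabs ((x1 + y1) - (x2 + y2)) <= 2 * d).
  { replace (x1 + y1 - (x2 + y2)) with ((x1 - x2) + (y1 - y2)) by ring.
    eapply Rle_trans; [apply Rabs_triang | lra]. }
  assert (0 <= d) by (pose proof (Rabs_pos (x1 - x2)); lra).
  split.
  - replace (x1 + y1 - IZR j - (x2 + y2 - IZR j)) with (x1 + y1 - (x2 + y2)) by ring. unfold K; nra.
  - replace (y1 + f (x1 + y1) - (y2 + f (x2 + y2))) with ((y1 - y2) + (f (x1 + y1) - f (x2 + y2))) by ring.
    eapply Rle_trans; [apply Rabs_triang |]. specialize (Hlip (x1 + y1) (x2 + y2)).
    assert (L * Rabs (x1 + y1 - (x2 + y2)) <= L * (2 * d)) by now apply Rmult_le_compat_l.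
    unfold K. nra. }
(* Just past the last pocket: this point is not a pocket, but it is so close to the one at [m] that
   its image is one. [K] is a Lipschitz constant of the map in the maximum norm. *)
set (m' := m + r1 / (4 * K * K)).
assert (Hmm : 0 < r1 / (4 * K * K)) by (apply Rdiv_lt_0_compat; nra).
assert (Hnp' : ~ pocket X Y (qx m') (qy m')).
{ intros Hp. assert (m' <= m); [| unfold m' in *; lra]. apply Hub. split; [unfold m'; lra | trivial]. }
assert (Hm'0 : 0 <= m') by (unfold m'; lra).
destruct (not_pocket_open _ _ _ _ _ Hc (Havq m' Hm'0) Hnp') as [r2 [Hr2 Hp2]].
destruct (Hends m' Hm'0) as [th0 [Hth0 [S0 HS0]]].
destruct (alift_perturb _ _ _ _ _ _ PI Hc Hth0 Hpi) as [r3 [Hr3 Hp3]].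
set (r := Rmin (Rmin (r1 / (4 * K)) r2) (Rmin r3 1)).
assert (Hr : 0 < r) by (repeat apply Rmin_pos; trivial; [apply Rdiv_lt_0_compat |]; lra).
assert (Hrle : r <= r1 / (4 * K) /\ r <= r2 /\ r <= r3 /\ r <= 1).
{ unfold r. pose proof (Rmin_l (Rmin (r1 / (4 * K)) r2) (Rmin r3 1)). pose proof (Rmin_r (Rmin (r1 / (4 * K)) r2) (Rmin r3 1)).
  pose proof (Rmin_l (r1 / (4 * K)) r2). pose proof (Rmin_r (r1 / (4 * K)) r2).
  pose proof (Rmin_l r3 1). pose proof (Rmin_r r3 1). lra. }
destruct Hrle as [Hle1 [Hle2 [Hle3 Hle4]]].
set (ball := fun p : R * R => Rabs (fst p - qx m') < r /\ Rabs (snd p - qy m') < r).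
assert (Bnp : forall p, ball p -> ~ pocket X Y (fst p) (snd p)).
{ intros p [B1 B2]. apply Hp2; lra. }
assert (Bp : forall p, ball p -> forall n, let q := Nat.iter (S n) (shear f j) p in pocket X Y (fst q) (snd q)).
{ intros p [B1 B2] n. induction n as [|n IH].
  - assert (Q : Rabs (fst p - qx m) <= r + r1 / (4 * K * K) * (1 + L) /\ Rabs (snd p - qy m) <= r + r1 / (4 * K * K) * (1 + L)).
    { assert (Em : Rabs (m' - m) = r1 / (4 * K * K)).
      { unfold m'. replace (m + r1 / (4 * K * K) - m) with (r1 / (4 * K * K)) by ring. apply Rabs_right. lra. }
      pose proof (Hqx m' m). pose proof (Hqy m' m). rewrite Em in *.
      split; [replace (fst p - qx m) with ((fst p - qx m') + (qx m' - qx m)) by ring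
             | replace (snd p - qy m) with ((snd p - qy m') + (qy m' - qy m)) by ring];
      eapply Rle_trans; try apply Rabs_triang; nra. }
    destruct (Hsx _ _ _ _ _ (proj1 Q) (proj2 Q)) as [Q1 Q2].
    assert (HKr : K * r <= r1 / 4).
    { apply (Rmult_le_compat_l K) in Hle1; [| lra]. replace (K * (r1 / (4 * K))) with (r1 / 4) in Hle1 by (field; lra). lra. }
    replace (K * (r + r1 / (4 * K * K) * (1 + L))) with (K * r + r1 / 8) in Q1, Q2 by (unfold K; field; lra).
    simpl. apply Hp1; unfold shear; simpl; lra.
  - destruct (pocket_image _ _ _ _ _ _ _ _ H IH) as [r4 [Hr4 Hp4]].
    apply Hp4; rewrite Rminus_diag, Rabs_R0; trivial. }
(* Chosen so that the ball lies above the curve lowered by [k M]. Its orbits then stay between the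
   two invariant curves, which gives the bound required for recurrence. *)
destruct (nat_above (CY + 1 + Rabs (qy m'))) as [M [HM0 HM]].
pose proof (curve_kge1 _ _ _ Hc) as Hk1.
assert (Hkm : CY + 1 + Rabs (qy m') < INR k * INR M).
{ eapply Rlt_le_trans; [apply HM |]. pose proof (pos_INR M). nra. }
pose proof (icurve_lower _ _ _ _ _ _ M H Hper) as Hlow.
destruct (shear_recurrence f j L k (qx m') (qy m') r (CY + INR k * INR M)) as [p [n [i [P1 [P2 [P3 P4]]]]]]; trivial.
- apply Hc.
- intros p B1 B2 n.
  assert (He0 : ends X Y 0 (fst p) (snd p)).
  { destruct (Hp3 (fst p) (snd p) ltac:(lra) ltac:(lra)) as [Hav Hcl].
    destruct (alift_exists _ _ _ _ _ Hc Hav) as [th Hth]. exists th. split; trivial.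
    destruct (alift_cos_pos _ _ _ _ _ _ Hc Hth) as [S HS].
    exists (Rmax S S0). intros s Hs. rewrite Rminus_0_r.
    specialize (HS0 s (Rle_trans _ _ _ (Rmax_r _ _) Hs)). specialize (Hcl _ Hth s). apply Rabs_def2 in Hcl.
    apply cos_pos_range; [lra |]. apply HS. apply (Rle_trans _ _ _ (Rmax_l _ _) Hs). }
  assert (He1 : ends X (fun s => Y s - INR k * INR M) (2 * PI) (fst p) (snd p)).
  { pose proof (icurve_curve _ _ _ _ _ _ Hlow) as Hcl.
    assert (Hab : forall s, Y s - INR k * INR M < snd p).
    { intros s. specialize (HCY' s). apply Rabs_def2 in B2.
      pose proof (Rle_abs (- qy m')) as A. rewrite Rabs_Ropp in A. lra. }
    destruct (alift_exists _ _ _ (fst p) (snd p) Hcl) as [th Hth].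
    { intros s _ E2. specialize (Hab s). lra. }
    exists th. split; trivial. destruct (alift_cos_pos _ _ _ _ _ _ Hcl Hth) as [S HS].
    exists S. intros s Hs. pose proof (alift_above _ _ _ _ _ Hth Hab s).
    apply cos_pos_range; [lra |]. rewrite cos_minus, cos_2PI, sin_2PI. specialize (HS s Hs). lra. }
  pose proof (ends_below_bound _ _ _ _ CY (fun s => proj2 (HCY' s)) (ends_iter _ _ _ _ _ _ _ _ H cos_0 He0 n)).
  assert (HlowY : forall s, - CY - INR k * INR M <= Y s - INR k * INR M) by (intro s; specialize (HCY' s); lra).
  pose proof (ends_above_bound _ _ _ _ _ HlowY
    (ends_iter _ _ _ _ _ _ _ _ Hlow cos_2PI He1 n)).
  apply Rabs_le. pose proof (pos_INR M). assert (0 <= INR k * INR M) by nra.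
  assert (0 <= CY) by (specialize (HCY' 0); lra). lra.
- apply (Bnp (fst (Nat.iter (S n) (shear f j) p) + INR k * IZR i, snd (Nat.iter (S n) (shear f j) p))).
  + split; trivial.
  + simpl fst. simpl snd. apply (pocket_shift k); trivial. apply (Bp p (conj P1 P2) n).
Qed.

(** An injective proper path has a continuous inverse on its image. The tent of width [eps] around
    [h s0] is the weight in [curve_far]: a nearby point of the curve must have a nearby
    parameter. *)
Lemma param_continuous k X Y (A B h : R -> R) : curve k X Y -> continuity A -> continuity B ->
  (forall s, A s = X (h s)) -> (forall s, B s = Y (h s)) -> continuity h.
Proof.
intros H CA CB EA EB s0.
intros eps Heps.
destruct (curve_far k X Y (A s0) (B s0) (fun t => Rmax 0 (eps - Rabs (t - h s0))) H) as [rho [Hrho Hd]].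
- assert (Hl : forall s t, Rabs (Rmax 0 (eps - Rabs (s - h s0)) - Rmax 0 (eps - Rabs (t - h s0))) <= Rabs (s - t)).
  { intros s t. unfold Rmax, Rabs. repeat destruct Rle_dec; repeat destruct Rcase_abs; lra. }
  intros s e He. exists e. split; trivial. intros t [_ Ht]. simpl in *. unfold Rdist in *.
  specialize (Hl t s). lra.
- intros s. apply Rmax_l.
- intros s E1 E2. rewrite EA in E1. rewrite EB in E2.
  rewrite (curve_inj _ _ _ H _ _ E1 E2), Rminus_diag, Rabs_R0.
  eapply Rlt_le_trans; [| apply Rmax_r]. lra.
- destruct (CA s0 (rho / 2) ltac:(lra)) as [d1 [Hd1 HA]].
  destruct (CB s0 (rho / 2) ltac:(lra)) as [d2 [Hd2 HB]].
  exists (Rmin d1 d2). split; [now apply Rmin_pos |].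
  intros s [Hne Hs]. simpl in *. unfold Rdist in *.
  specialize (HA s (conj Hne (Rlt_le_trans _ _ _ Hs (Rmin_l _ _)))).
  specialize (HB s (conj Hne (Rlt_le_trans _ _ _ Hs (Rmin_r _ _)))).
  specialize (Hd (h s)). rewrite <- EA, <- EB in Hd.
  apply Rnot_le_lt. intros Hle. rewrite Rmax_left in Hd by lra. lra.
Qed.

(* [(x,y) -> (-x, y - f x)] conjugates the inverse of the map to the map of the reflected force. *)
Lemma icurve_mirror f j g k X Y : icurve f j g k X Y -> (forall u, f (u + 1) = f u) ->
  exists g', icurve (fun z => - f (- z)) j g' k (fun s => - X (- s)) (fun s => Y (- s) - f (X (- s))).
Proof.
intros H Hper.
pose proof (icurve_curve _ _ _ _ _ _ H) as Hc.
assert (Hfj : forall z, f (z + IZR j) = f z).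
{ intros z. rewrite (shift_periodic f 0) by (intro; rewrite Hper; ring). ring. }
pose (d := fun t => proj1_sig (constructive_indefinite_description _ (icurve_surj _ _ _ _ _ _ H t))).
assert (Hd : forall t, g (d t) = t).
{ intros t. exact (proj2_sig (constructive_indefinite_description _ (icurve_surj _ _ _ _ _ _ H t))). }
clearbody d.
assert (EB : forall t, Y t - f (X t) = Y (d t)).
{ intros t. pose proof (icurve_X _ _ _ _ _ _ H (d t)) as E1. pose proof (icurve_Y _ _ _ _ _ _ H (d t)) as E2.
  rewrite Hd in *. rewrite E1, Hfj in E2. lra. }
assert (EA : forall t, X t + IZR j - (Y t - f (X t)) = X (d t)).
{ intros t. pose proof (icurve_X _ _ _ _ _ _ H (d t)) as E1. rewrite Hd in E1. rewrite EB. lra. }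
assert (CB : continuity (fun t => Y t - f (X t))).
{ intros t. apply continuity_pt_minus; [apply Hc |].
  apply (continuity_pt_comp X f); [apply Hc | apply H]. }
(* [d] is a right inverse of [g] chosen pointwise; it is continuous because its composites with [X]
   and [Y] are. *)
assert (Cd : continuity d).
{ apply (param_continuous k X Y (fun t => X t + IZR j - (Y t - f (X t))) (fun t => Y t - f (X t))); trivial.
  intros t. apply continuity_pt_minus; [| apply CB].
  apply continuity_pt_plus; [apply Hc | apply continuity_pt_const; intros u v; reflexivity]. }
assert (Copp : forall u : R -> R, continuity u -> continuity (fun s => u (- s))).
{ intros u Cu s. apply (continuity_pt_comp (fun s => - s) u); [| apply Cu].
  apply continuity_pt_opp, continuity_pt_id. }
exists (fun s => - d (- s)). constructor.
- constructor; try apply Hc.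
  + intros s. apply continuity_pt_opp, (Copp X), Hc.
  + exact (Copp _ CB).
  + intros s. replace (- (s + 1)) with (- s + IZR (-1)) by (simpl; ring).
    rewrite (shift_periodic X (INR k) (curve_perX _ _ _ Hc)). simpl. ring.
  + intros s. replace (- (s + 1)) with (- s + IZR (-1)) by (simpl; ring).
    rewrite (shift_periodic X (INR k) (curve_perX _ _ _ Hc)).
    rewrite (shift_periodic Y 0) by (intro; rewrite (curve_perY _ _ _ Hc); ring).
    replace (X (- s) + INR k * IZR (-1)) with (X (- s) + IZR (- Z.of_nat k)) by (rewrite opp_IZR, <- INR_IZR_INZ; simpl; ring).
    rewrite (shift_periodic f 0) by (intro; rewrite Hper; ring). ring.
  + intros s t E1 E2. assert (E1' : X (- s) = X (- t)) by lra. rewrite E1' in E2.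
    pose proof (curve_inj _ _ _ Hc (- s) (- t) E1' ltac:(lra)). lra.
- intros z. apply continuity_pt_opp, (Copp f), H.
- intros s. apply continuity_pt_opp, (Copp d), Cd.
- intros s. rewrite Ropp_involutive, <- EA. ring.
- intros s. cbv beta. rewrite Ropp_involutive, <- (EB (- s)).
  replace (- (- X (- s) + (Y (- s) - f (X (- s))))) with (X (d (- s)) + IZR (- j)).
  + rewrite (shift_periodic f 0) by (intro; rewrite Hper; ring). ring.
  + rewrite <- EA, opp_IZR. ring.
Qed.

(** The mirror conjugacy preserves the order on each vertical, so visibility from below passes to
    the mirrored curve. *)
Lemma visible_preimage f j g k X Y L :
  icurve f j g k X Y -> 0 <= L -> (forall u v, Rabs (f u - f v) <= L * Rabs (u - v)) ->
  (forall u, f (u + 1) = f u) ->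
  forall x y, (forall s, X s = x -> y < Y s) ->
  forall s, X s = x - (y - f x) + IZR j -> y - f x < Y s.
Proof.
intros H HL Hlip Hper x y HV s Hs.
destruct (icurve_mirror _ _ _ _ _ _ H Hper) as [g' H'].
assert (Hlip' : forall u v, Rabs (- f (- u) - - f (- v)) <= L * Rabs (u - v)).
{ intros u v. specialize (Hlip (- v) (- u)).
  replace (- f (- u) - - f (- v)) with (f (- v) - f (- u)) by ring.
  replace (- v - - u) with (u - v) in Hlip by ring. trivial. }
assert (Hper' : forall u, - f (- (u + 1)) = - f (- u)).
{ intros u. f_equal. rewrite <- (Hper (- (u + 1))). f_equal. ring. }
pose proof (visible_image _ _ _ _ _ _ _ H' HL Hlip' Hper' (- x) (y - f x)) as T. cbv beta in T.
specialize (T ltac:(intros t Ht; specialize (HV (- t) ltac:(lra)); replace (X (- t)) with x by lra; lra) (- s)).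
rewrite !Ropp_involutive in T. specialize (T ltac:(lra)).
replace (- (- x + (y - f x))) with (X s + IZR (- j)) in T by (rewrite opp_IZR; lra).
rewrite (shift_periodic f 0) in T by (intro; rewrite Hper; ring). lra.
Qed.

(** [D] vanishes exactly where an integer translate of the curve lies over [x] at the infimal height
    [-c]. Its minimum over one parameter period is zero, since a positive minimum would allow a
    better bound than [c]. *)
Lemma lowest_point k X Y x : curve k X Y ->
  exists s (m : Z), X s + IZR m = x /\ forall s' (m' : Z), X s' + IZR m' = x -> Y s <= Y s'.
Proof.
intros H.
destruct (curve_boundY _ _ _ H) as [C HC].
set (E := fun v => exists s (m : Z), X s + IZR m = x /\ v = - Y s).
destruct (completeness E) as [c [Hub Hlub]].
{ exists C. intros v [s [m [_ ->]]]. specialize (HC s). apply Rabs_le_between in HC. lra. }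
{ destruct (curve_X_large _ _ _ H (Rabs x)) as [S [HS [H1 H2]]].
  pose proof (Rle_abs x). pose proof (Rle_abs (- x)) as Hx. rewrite Rabs_Ropp in Hx.
  assert (CX : forall x, continuity_pt X x) by apply H.
  destruct (IVT_gen X (- S) S x CX) as [s [_ Es]].
  - specialize (H1 S (Rle_refl _)). specialize (H2 (- S) (Rle_refl _)). split.
    + apply Rle_trans with (X (- S)); [apply Rmin_l | lra].
    + apply Rle_trans with (X S); [lra | apply Rmax_r].
  - exists (- Y s), s, 0%Z. split; [lra | trivial]. }
set (D := fun s => Rabs (sin (PI * (X s - x))) + Rabs (Y s + c)).
assert (CD : continuity D).
{ intros s. unfold D. apply continuity_pt_plus.
  - apply (continuity_pt_comp (fun s => sin (PI * (X s - x))) Rabs); [| apply Rcontinuity_abs].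
    apply (continuity_pt_comp (fun s => PI * (X s - x)) sin); [| apply continuity_sin].
    apply continuity_pt_mult; [apply continuity_pt_const; intros u v; reflexivity |].
    apply continuity_minus_cst, H.
  - apply (continuity_pt_comp (fun s => Y s + c) Rabs); [| apply Rcontinuity_abs].
    apply continuity_pt_plus; [apply H | apply continuity_pt_const; intros u v; reflexivity]. }
destruct (continuity_ab_min D 0 1) as [s0 [Hmin Hs0]]; [lra | intros; apply CD |].
destruct (Rle_lt_or_eq_dec 0 (D s0)) as [Hpos | Hz].
{ unfold D. pose proof (Rabs_pos (sin (PI * (X s0 - x)))). pose proof (Rabs_pos (Y s0 + c)). lra. }
- exfalso.
  assert (Hle : c <= c - D s0); [| lra].
  apply Hlub. intros v [s [m [Es ->]]]. apply Rnot_lt_le. intros Hlt.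
  assert (Hb : - Y s <= c) by (apply Hub; now exists s, m).
  destruct (floor_split s) as [n [u [-> Hu]]].
  rewrite (shift_periodic X (INR k) (curve_perX _ _ _ H)) in Es.
  rewrite (shift_periodic Y 0) in Hlt, Hb by (intro; rewrite (curve_perY _ _ _ H); ring).
  specialize (Hmin u ltac:(lra)).
  assert (HDu : D u = Rabs (Y u + c)).
  { unfold D. replace (PI * (X u - x)) with (IZR (- (m + Z.of_nat k * n)) * PI).
    - rewrite (sin_eq_0_1 (IZR (- (m + Z.of_nat k * n)) * PI)), Rabs_R0; [ring | now eexists].
    - rewrite opp_IZR, plus_IZR, mult_IZR, <- INR_IZR_INZ. replace x with (X u + INR k * IZR n + IZR m) by lra. ring. }
  rewrite HDu, Rabs_right in Hmin by lra. lra.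
- unfold D in Hz. pose proof (Rabs_pos (sin (PI * (X s0 - x)))). pose proof (Rabs_pos (Y s0 + c)).
  assert (Es : sin (PI * (X s0 - x)) = 0) by (apply Rabs_eq_0; lra).
  assert (Ey : Y s0 + c = 0) by (apply Rabs_eq_0; lra).
  destruct (sin_eq_0_0 _ Es) as [m Em].
  exists s0, (- m)%Z. split.
  + rewrite opp_IZR. pose proof PI_RGT_0. assert (X s0 - x = IZR m); [| lra].
    apply Rmult_eq_reg_l with PI; lra.
  + intros s' m' E'. assert (- Y s' <= c) by (apply Hub; now exists s', m'). lra.
Qed.

(** [phi] is the lower envelope of the integer translates; [G x] and [B x] are the first coordinates
    of the image and the preimage of its point over [x]. Invariance of the region below [phi] under
    the map and its inverse says that [z < G x] if and only if [B z < x], and from this equivalence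
    everything else follows. *)
Lemma graph_theorem f j g k X Y L :
  icurve f j g k X Y -> 0 <= L -> (forall u v, Rabs (f u - f v) <= L * Rabs (u - v)) ->
  (forall u, f (u + 1) = f u) ->
  exists G B : R -> R,
    continuity G /\ continuity B /\ (forall x, B (G x) = x) /\ (forall x, G (B x) = x) /\
    (forall x y, x <= y -> G x <= G y) /\ (forall x y, x <= y -> B x <= B y) /\
    (forall x, G (x + 1) = G x + 1) /\ (forall x, B (x + 1) = B x + 1) /\
    (forall x, G x + B x = 2 * x + f x) /\
    forall x, exists s (m : Z), X s + IZR m = x /\ Y s = G x - x.
Proof.
intros H HL Hlip Hper.
pose proof (icurve_curve _ _ _ _ _ _ H) as Hc.
assert (Hperj : forall z (i : Z), f (z + IZR i) = f z).
{ intros z i. rewrite (shift_periodic f 0) by (intro; rewrite Hper; ring). ring. }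
assert (Hlow : forall x, exists v, (exists s (m : Z), X s + IZR m = x /\ Y s = v) /\
   forall s (m : Z), X s + IZR m = x -> v <= Y s).
{ intros x. destruct (lowest_point k X Y x Hc) as [s [m [E Hm]]].
  exists (Y s). split; trivial. now exists s, m. }
pose (phi := fun x => proj1_sig (constructive_indefinite_description _ (Hlow x))).
assert (Hphi : forall x, (exists s (m : Z), X s + IZR m = x /\ Y s = phi x) /\
   forall s (m : Z), X s + IZR m = x -> phi x <= Y s).
{ intros x. exact (proj2_sig (constructive_indefinite_description _ (Hlow x))). }
clearbody phi. clear Hlow.
assert (Hvis : forall x y, y < phi x <-> forall s (m : Z), X s + IZR m = x -> y < Y s).
{ intros x y. destruct (Hphi x) as [[s [m [E1 E2]]] Hle]. split.
  - intros Hy s' m' E. specialize (Hle s' m' E). lra.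
  - intros HV. rewrite <- E2. now apply (HV s m). }
assert (Hfwd : forall x y, y < phi x -> y + f (x + y) < phi (x + y)).
{ intros x y Hy. rewrite Hvis in *. intros s m E.
  assert (Hx' : forall s', X s' = x + IZR (j - m) -> y < Y s').
  { intros s' E'. apply (Hy s' (m - j)%Z). rewrite E', !minus_IZR. ring. }
  pose proof (visible_image _ _ _ _ _ _ _ H HL Hlip Hper _ _ Hx' s) as T.
  replace (x + IZR (j - m) + y) with ((x + y) + IZR (j - m)) in T by ring.
  rewrite Hperj in T. apply T. rewrite minus_IZR. lra. }
assert (Hbwd : forall x y, y < phi x -> y - f x < phi (x - (y - f x))).
{ intros x y Hy. rewrite Hvis in *. intros s m E.
  assert (Hx' : forall s', X s' = x + IZR (- j - m) -> y < Y s').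
  { intros s' E'. apply (Hy s' (m + j)%Z). rewrite E', minus_IZR, opp_IZR, plus_IZR. ring. }
  pose proof (visible_preimage _ _ _ _ _ _ _ H HL Hlip Hper _ _ Hx' s) as T.
  rewrite Hperj in T. apply T. rewrite minus_IZR, opp_IZR. lra. }
assert (Hphi1 : forall x, phi (x + 1) = phi x).
{ intros x. destruct (Hphi x) as [[s [m [E1 E2]]] Hle]. destruct (Hphi (x + 1)) as [[s' [m' [E1' E2']]] Hle'].
  apply Rle_antisym.
  - rewrite <- E2. apply (Hle' s (m + 1)%Z). rewrite plus_IZR. lra.
  - rewrite <- E2'. apply (Hle s' (m' - 1)%Z). rewrite minus_IZR. lra. }
set (G := fun x => x + phi x). set (B := fun x => x - phi x + f x).
assert (Gal : forall x z, z < G x <-> B z < x).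
{ intros x z. unfold G, B. split; intros Hlt.
  - pose proof (Hfwd x (z - x) ltac:(lra)) as T. replace (x + (z - x)) with z in T by ring. lra.
  - pose proof (Hbwd z (z - x + f z) ltac:(lra)) as T.
    replace (z - (z - x + f z - f z)) with x in T by ring. lra. }
assert (Gmon : forall x y, x <= y -> G x <= G y).
{ intros x y Hxy. apply Rnot_lt_le. intros Hlt. apply Gal in Hlt.
  assert (Hlt' : B (G y) < y) by lra. apply Gal in Hlt'. lra. }
assert (Bmon : forall x y, x <= y -> B x <= B y).
{ intros x y Hxy. apply Rnot_lt_le. intros Hlt. apply Gal in Hlt.
  assert (Hlt' : x < G (B x)) by lra. apply Gal in Hlt'. lra. }
assert (HGB : forall x, G x + B x = 2 * x + f x) by (intros; unfold G, B; ring).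
(* Two nondecreasing functions with a Lipschitz sum are both Lipschitz, as neither can increase more
   than the sum. *)
assert (Gcont : forall x y, Rabs (G x - G y) <= (2 + L) * Rabs (x - y)).
{ assert (W : forall x y, x <= y -> Rabs (G x - G y) <= (2 + L) * Rabs (x - y)).
  { intros x y Hxy. pose proof (Gmon x y Hxy). pose proof (Bmon x y Hxy).
    pose proof (HGB x). pose proof (HGB y). pose proof (Hlip x y) as Hl.
    rewrite (Rabs_left1 (x - y)) in * by lra. apply Rabs_le_between in Hl.
    rewrite Rabs_left1 by lra. lra. }
  intros x y. destruct (Rle_dec x y); [now apply W |].
  rewrite (Rabs_minus_sym (G x)), (Rabs_minus_sym x). apply W. lra. }
assert (Bcont : forall x y, Rabs (B x - B y) <= (2 + L) * Rabs (x - y)).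
{ assert (W : forall x y, x <= y -> Rabs (B x - B y) <= (2 + L) * Rabs (x - y)).
  { intros x y Hxy. pose proof (Gmon x y Hxy). pose proof (Bmon x y Hxy).
    pose proof (HGB x). pose proof (HGB y). pose proof (Hlip x y) as Hl.
    rewrite (Rabs_left1 (x - y)) in * by lra. apply Rabs_le_between in Hl.
    rewrite Rabs_left1 by lra. lra. }
  intros x y. destruct (Rle_dec x y); [now apply W |].
  rewrite (Rabs_minus_sym (B x)), (Rabs_minus_sym x). apply W. lra. }
assert (Lip_cont : forall u : R -> R, (forall x y, Rabs (u x - u y) <= (2 + L) * Rabs (x - y)) -> continuity u).
{ intros u Hu x e He. exists (e / (2 + L)). split; [apply Rdiv_lt_0_compat; lra |].
  intros y [_ Hy]. simpl in *. unfold Rdist in *.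
  eapply Rle_lt_trans; [apply Hu |]. apply Rlt_div_r in Hy; lra. }
exists G, B. split; [now apply Lip_cont |]. split; [now apply Lip_cont |].
split; [| split].
- intros x. apply Rle_antisym.
  + apply Rnot_lt_le. intros Hlt. set (e := (B (G x) - x)) in *.
    assert (He : 0 < e) by (unfold e; lra).
    set (z := G x - e / (2 + L)).
    assert (Hd : 0 < e / (2 + L)) by (apply Rdiv_lt_0_compat; lra).
    assert (Hz : z < G x) by (unfold z; lra). apply Gal in Hz.
    pose proof (Bcont (G x) z) as T. replace (G x - z) with (e / (2 + L)) in T by (unfold z; ring).
    rewrite (Rabs_right (e / _)) in T by lra.
    replace ((2 + L) * (e / (2 + L))) with e in T by (field; lra).
    apply Rabs_le_between in T. unfold e in *. lra.
  + apply Rnot_lt_le. intros Hlt. apply Gal in Hlt. lra.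
- intros x. apply Rle_antisym.
  + apply Rnot_lt_le. intros Hlt. apply Gal in Hlt. lra.
  + apply Rnot_lt_le. intros Hlt. set (e := (x - G (B x))) in *.
    assert (He : 0 < e) by (unfold e; lra).
    assert (Hd : 0 < e / (2 + L)) by (apply Rdiv_lt_0_compat; lra).
    set (z := B x + e / (2 + L)).
    assert (Hz : B x < z) by (unfold z; lra). apply Gal in Hz.
    pose proof (Gcont z (B x)) as T. replace (z - B x) with (e / (2 + L)) in T by (unfold z; ring).
    rewrite (Rabs_right (e / _)) in T by lra.
    replace ((2 + L) * (e / (2 + L))) with e in T by (field; lra).
    apply Rabs_le_between in T. unfold e in *. lra.
- repeat (split; trivial).
  + intros x. unfold G. rewrite Hphi1. ring.
  + intros x. unfold B. rewrite Hphi1, Hper. ring.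
  + intros x. destruct (Hphi x) as [[s [m [E1 E2]]] _]. exists s, m. split; trivial. unfold G. lra.
Qed.

(** * Slow circles pass close to the fixed point *)

(* A lift [G] of a circle homeomorphism, with inverse [B], satisfying the Euler-Lagrange equation
   of [(x'-x)^2/2 + P x'], where [f] is the derivative of [P]. *)
Record circle_map (f G B : R -> R) : Prop := {
  cm_contG : continuity G;
  cm_contB : continuity B;
  cm_BG : forall x, B (G x) = x;
  cm_GB : forall x, G (B x) = x;
  cm_monG : forall x y, x <= y -> G x <= G y;
  cm_monB : forall x y, x <= y -> B x <= B y;
  cm_perG : forall x, G (x + 1) = G x + 1;
  cm_perB : forall x, B (x + 1) = B x + 1;
  cm_eq : forall x, G x + B x = 2 * x + f x
}.

(** The Euler-Lagrange equation is symmetric in time; negative rotation numbers thus reduce to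
    positive ones. *)
Lemma circle_map_inverse f G B : circle_map f G B -> circle_map f B G.
Proof. intros [H1 H2 H3 H4 H5 H6 H7 H8 H9]. constructor; trivial. intros x. rewrite Rplus_comm. apply H9. Qed.

Definition rotates (G : R -> R) (al : R) : Prop :=
  forall x, is_lim_seq (fun n => Nat.iter n G x / INR n) al.

Lemma iter_mono (G : R -> R) : (forall x y, x <= y -> G x <= G y) ->
  forall n x y, x <= y -> Nat.iter n G x <= Nat.iter n G y.
Proof. intros H. induction n as [|n IH]; intros x y Hxy; simpl; trivial. apply H, IH, Hxy. Qed.

Lemma iter_shift (G : R -> R) : (forall x, G (x + 1) = G x + 1) ->
  forall (n : nat) x (m : Z), Nat.iter n G (x + IZR m) = Nat.iter n G x + IZR m.
Proof.
intros H n x m. induction n as [|n IH]; simpl; trivial.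
rewrite IH, (shift_periodic G 1 H). ring.
Qed.

Lemma iter_cancel (G B : R -> R) : (forall x, G (B x) = x) ->
  forall n x, Nat.iter n G (Nat.iter n B x) = x.
Proof.
intros H. induction n as [|n IH]; intros x; trivial.
rewrite Nat.iter_succ_r. simpl Nat.iter at 2. rewrite H. apply IH.
Qed.

Lemma inv_n_lim (c : R) : is_lim_seq (fun n => c / INR n) 0.
Proof.
replace (Finite 0) with (Rbar_mult c (Rbar_inv p_infty)) by (simpl; f_equal; ring).
apply (is_lim_seq_scal_l (fun n => / INR n)).
apply is_lim_seq_inv; [apply is_lim_seq_INR | discriminate].
Qed.

(** Up to an error of 1, the n-th iterate of [B] at [x] is [x] minus the n-th iterate of [G] at
    0. *)
Lemma rotates_inverse f G B al : circle_map f G B -> rotates G al -> rotates B (- al).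
Proof.
intros H Hrot x.
assert (Hb : forall n, x - Nat.iter n G 0 - 1 <= Nat.iter n B x <= x - Nat.iter n G 0 + 1).
{ intros n. destruct (floor_split (Nat.iter n B x)) as [m [u [E Hu]]].
  assert (E2 : Nat.iter n G (u + IZR m) = x) by (rewrite <- E; apply iter_cancel, H).
  rewrite (iter_shift G) in E2 by apply H.
  pose proof (iter_mono G (cm_monG _ _ _ H) n 0 u ltac:(lra)) as M1.
  pose proof (iter_mono G (cm_monG _ _ _ H) n u (0 + IZR 1) ltac:(simpl; lra)) as M2.
  rewrite (iter_shift G) in M2 by apply H. simpl in M2. lra. }
assert (Hdiv : forall c, is_lim_seq (fun n => (x - Nat.iter n G 0 + c) / INR n) (- al)).
{ intros c. apply is_lim_seq_ext with (fun n => (x + c) / INR n - Nat.iter n G 0 / INR n).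
  - intros n. unfold Rdiv. ring.
  - replace (Finite (- al)) with (Rbar_minus 0 al) by (simpl; f_equal; ring).
    apply is_lim_seq_minus'; [apply inv_n_lim | apply Hrot]. }
apply is_lim_seq_le_le_loc with (fun n => (x - Nat.iter n G 0 + -1) / INR n) (fun n => (x - Nat.iter n G 0 + 1) / INR n);
  try apply Hdiv.
exists 1%nat. intros n Hn.
assert (0 < / INR n) by (apply Rinv_0_lt_compat, lt_0_INR; lia).
specialize (Hb n). unfold Rdiv. split; apply Rmult_le_compat_r; lra.
Qed.

Lemma rotates_bounded (G : R -> R) al x M : rotates G al ->
  (forall n, Nat.iter n G x <= M) -> al <= 0.
Proof.
intros Hrot HM.
apply (is_lim_seq_le (fun n => Nat.iter (S n) G x / INR (S n)) (fun n => M / INR (S n)) al 0).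
- intros n. apply Rmult_le_compat_r; [apply Rlt_le, Rinv_0_lt_compat, lt_0_INR; lia | apply HM].
- apply (is_lim_seq_incr_1 (fun n => Nat.iter n G x / INR n)), Hrot.
- apply (is_lim_seq_incr_1 (fun n => M / INR n)), inv_n_lim.
Qed.

Lemma rotates_pos f G B al : circle_map f G B -> rotates G al -> 0 < al -> forall x, x < G x.
Proof.
intros H Hrot Hal x. apply Rnot_le_lt. intros Hle.
assert (al <= 0); [| lra].
apply (rotates_bounded G al x x Hrot).
induction n as [|n IH]; simpl; [lra |].
apply Rle_trans with (G x); trivial. now apply H.
Qed.

Lemma rotates_unbounded (G : R -> R) al : rotates G al -> 0 < al -> forall x M, exists n, M < Nat.iter n G x.
Proof.
intros Hrot Hal x M. apply NNPP. intros Hno.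
assert (al <= 0); [| lra].
apply (rotates_bounded G al x M Hrot). intros n. apply Rnot_lt_le. intros Hlt. apply Hno. now exists n.
Qed.

(** By monotonicity and commutation with the unit translation, one turn in [N] steps yields n turns
    in [n * N] steps. In use: a slow map cannot complete a turn quickly. *)
Lemma rotates_turn f G B al x N : circle_map f G B -> rotates G al ->
  x + 1 <= Nat.iter N G x -> 1 <= INR N * al.
Proof.
intros H Hrot HN.
destruct N as [|N']; [simpl in HN; lra |]. set (N := S N') in *.
assert (Hn : forall n, x + INR n <= Nat.iter (n * N) G x).
{ induction n as [|n IH]; [simpl; lra |].
  rewrite Nat.mul_succ_l, Nat.add_comm, Nat.iter_add.
  apply Rle_trans with (Nat.iter N G (x + IZR (Z.of_nat n))).
  - rewrite (iter_shift G) by apply H. rewrite <- INR_IZR_INZ, S_INR. lra.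
  - apply iter_mono; [apply H |]. rewrite <- INR_IZR_INZ. exact IH. }
assert (HN0 : 0 < INR N) by (apply lt_0_INR; lia).
assert (Hle : / INR N <= al).
{ apply (is_lim_seq_le (fun n => x / INR N / INR (S n) + / INR N)
    (fun n => Nat.iter (S n * N) G x / INR (S n * N)) (/ INR N) al).
  - intros n. rewrite mult_INR.
    assert (0 < INR (S n)) by (apply lt_0_INR; lia).
    replace (x / INR N / INR (S n) + / INR N) with ((x + INR (S n)) / (INR (S n) * INR N)) by (field; lra).
    apply Rmult_le_compat_r; [apply Rlt_le, Rinv_0_lt_compat; nra | apply Hn].
  - replace (Finite (/ INR N)) with (Finite (0 + / INR N)) by (f_equal; ring).
    apply is_lim_seq_plus'; [| apply is_lim_seq_const].
    apply (is_lim_seq_incr_1 (fun n => x / INR N / INR n)), inv_n_lim.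
  - apply (is_lim_seq_subseq (fun n => Nat.iter n G x / INR n) al (fun n => (S n * N)%nat)); [| apply Hrot].
    apply eventually_subseq. intros n. lia. }
apply (Rmult_le_compat_l (INR N)) in Hle; [| lra]. rewrite Rinv_r in Hle; lra.
Qed.

(* Near the hyperbolic fixed point the distance grows geometrically; after that the orbit crosses
   the middle in [O(1/s)] steps. *)
Lemma hyperbolic_escape (x : nat -> R) (F : R -> R) (A nu s d : R) (n0 m : nat) :
  x 0%nat = 0 -> x 1%nat = d -> 0 < d -> (forall n, x n <= x (S n)) ->
  (forall n, x (S (S n)) - 2 * x (S n) + x n = F (x (S n))) ->
  (forall y, 0 <= y <= 1 / 4 -> A * y <= F y) -> (forall y, 0 <= y <= 1 / 2 -> - nu <= F y) ->
  0 < s <= 1 -> s * s <= A -> 0 <= nu -> nu * INR m <= s / 16 -> 4 <= INR m * s ->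
  1 / 4 < d * (1 + s) ^ n0 -> 1 / 2 <= x (n0 + 1 + m)%nat.
Proof.
intros Hx0 Hx1 Hd Hinc Hrec HF1 HF2 Hs HsA Hnu Hnum Hm Hbig.
apply Rnot_lt_le. intros Hlt.
assert (Hmon : forall n i, x n <= x (n + i)%nat).
{ intros n i. induction i as [|i IH]; [rewrite Nat.add_0_r; lra |].
  rewrite Nat.add_succ_r. pose proof (Hinc (n + i)%nat). lra. }
assert (Hpos : forall n, 0 <= x n) by (intro n; rewrite <- Hx0; apply (Hmon 0%nat n)).
(* The growth factor 1 + s reproduces itself through the recurrence: (1 + s) (2 + s^2) - 1 = (1 +
   s)^2 + s^3. *)
assert (Hgrow : forall n, x n <= 1 / 4 -> (1 + s) * x n <= x (S n)).
{ induction n as [|n IH]; intros Hn; [rewrite Hx0, Hx1; lra |].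
  pose proof (Hinc n) as Hi. specialize (IH ltac:(lra)).
  pose proof (Hrec n) as R. pose proof (HF1 (x (S n)) ltac:(split; [apply Hpos | lra])) as F1.
  pose proof (Hpos n). pose proof (Hpos (S n)).
  assert (Hq : (1 + s) * (x (S n) - x n) >= s * x (S n)) by lra.
  assert (s * s * x (S n) <= A * x (S n)) by (apply Rmult_le_compat_r; lra).
  assert (G1 : x (S (S n)) >= (2 + s * s) * x (S n) - x n) by lra.
  assert (G2 : (1 + s) * x (S (S n)) >= (1 + s) * ((2 + s * s) * x (S n)) - x (S n)).
  { assert ((1 + s) * x (S (S n)) >= (1 + s) * ((2 + s * s) * x (S n) - x n)) by (apply Rmult_ge_compat_l; lra). lra. }
  assert (G3 : (1 + s) * ((1 + s) * x (S n)) <= (1 + s) * x (S (S n))).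
  { assert (0 <= s * s * s * x (S n)) by (apply Rmult_le_pos; [nra | lra]). nra. }
  apply Rmult_le_reg_l in G3; lra. }
assert (Hgeo : forall n, x n <= 1 / 4 -> d * (1 + s) ^ n <= x (S n)).
{ induction n as [|n IH]; intros Hn; [simpl; lra |].
  pose proof (Hinc n). specialize (IH ltac:(lra)). specialize (Hgrow (S n) Hn). simpl.
  apply Rle_trans with ((1 + s) * x (S n)); trivial.
  replace (d * ((1 + s) * (1 + s) ^ n)) with ((1 + s) * (d * (1 + s) ^ n)) by ring.
  apply Rmult_le_compat_l; lra. }
assert (Hfirst : exists n1, (n1 <= n0)%nat /\ x n1 <= 1 / 4 /\ 1 / 4 < x (S n1)).
{ apply NNPP. intros Hno.
  assert (Hall : forall n, (n <= n0)%nat -> x n <= 1 / 4).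
  { induction n as [|n IH]; intros Hn; [rewrite Hx0; lra |].
    specialize (IH ltac:(lia)). apply Rnot_lt_le. intros Hc. apply Hno. exists n. repeat split; trivial. lia. }
  apply Hno. exists n0. repeat split; [lia | now apply Hall |].
  pose proof (Hgeo n0 (Hall n0 (le_n _))). lra. }
destruct Hfirst as [n1 [Hn1 [Hle Hgt]]].
assert (Hstep : s / 8 <= x (S n1) - x n1).
{ pose proof (Hgrow n1 Hle). nra. }
(* The step length starts at s/8 or more and loses at most [nu] per iterate, s/16 in all; [m] steps
   of length s/16 then cover the second quarter. *)
assert (Hrun : forall i, (i <= m)%nat -> s / 8 - INR i * nu <= x (S (n1 + i)) - x (n1 + i)%nat /\
  1 / 4 + INR i * (s / 16) <= x (S (n1 + i))).
{ induction i as [|i IH]; intros Hi.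
  - rewrite Nat.add_0_r. simpl. lra.
  - destruct (IH ltac:(lia)) as [I1 I2]. rewrite Nat.add_succ_r.
    pose proof (Hrec (n1 + i)%nat) as R.
    assert (x (S (n1 + i)) <= x (n0 + 1 + m)%nat).
    { replace (n0 + 1 + m)%nat with (S (n1 + i) + (n0 - n1 + (m - i)))%nat by lia. apply Hmon. }
    pose proof (HF2 (x (S (n1 + i))) ltac:(split; [apply Hpos | lra])) as F2.
    assert (INR (S i) <= INR m) by now apply le_INR.
    rewrite S_INR in *.
    assert (nu * (INR i + 1) <= nu * INR m) by (apply Rmult_le_compat_l; lra).
    split; lra. }
destruct (Hrun m (le_n m)) as [_ Hend].
assert (x (S (n1 + m)) <= x (n0 + 1 + m)%nat).
{ replace (n0 + 1 + m)%nat with (S (n1 + m) + (n0 - n1))%nat by lia. apply Hmon. }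
lra.
Qed.

(** If [G 0] were larger, the forward orbit of 0 would reach 1/2 and the backward orbit -1/2 within
    [n0 + 1 + m] steps each, a full turn too fast for [al]. The backward orbit, negated, obeys the
    recurrence with force [- f (- y)]. *)
Lemma slow_circle_near_fixed_point f G B al A nu s (n0 m : nat) :
  circle_map f G B -> rotates G al -> 0 < al ->
  (forall y, 0 <= y <= 1 / 4 -> A * y <= f y) -> (forall y, 0 <= y <= 1 / 2 -> - nu <= f y) ->
  (forall y, 0 <= y <= 1 / 4 -> A * y <= - f (- y)) -> (forall y, 0 <= y <= 1 / 2 -> - nu <= - f (- y)) ->
  f 0 = 0 ->
  0 < s <= 1 -> s * s <= A -> 0 <= nu -> nu * INR m <= s / 16 -> 4 <= INR m * s ->
  2 * INR (n0 + 1 + m) * al < 1 -> G 0 * (1 + s) ^ n0 <= 1 / 4.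
Proof.
intros H Hrot Hal F1 F2 F3 F4 Hf0 Hs HsA Hnu Hnum Hm Hslow.
apply Rnot_lt_le. intros Hbig.
pose proof (rotates_pos _ _ _ _ H Hrot Hal) as Hpos.
assert (HposB : forall x, B x < x).
{ intros x. pose proof (Hpos (B x)). rewrite (cm_GB _ _ _ H) in H0. trivial. }
assert (EB0 : B 0 = - G 0) by (pose proof (cm_eq _ _ _ H 0); lra).
assert (U1 : 1 / 2 <= Nat.iter (n0 + 1 + m) G 0).
{ apply (hyperbolic_escape (fun n => Nat.iter n G 0) f A nu s (G 0)); simpl; trivial.
  - intros n. apply Rlt_le, Hpos.
  - intros n. pose proof (cm_eq _ _ _ H (G (Nat.iter n G 0))). rewrite (cm_BG _ _ _ H) in H0. lra. }
assert (U2 : 1 / 2 <= - Nat.iter (n0 + 1 + m) B 0).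
{ apply (hyperbolic_escape (fun n => - Nat.iter n B 0) (fun y => - f (- y)) A nu s (G 0)); simpl; trivial.
  - ring.
  - lra.
  - intros n. pose proof (HposB (Nat.iter n B 0)). lra.
  - intros n. rewrite Ropp_involutive. pose proof (cm_eq _ _ _ H (B (Nat.iter n B 0))). rewrite (cm_GB _ _ _ H) in H0. lra. }
set (N := (n0 + 1 + m)%nat) in *.
assert (U3 : 0 + 1 <= Nat.iter (N + N) G 0).
{ rewrite Nat.iter_add.
  apply Rle_trans with (Nat.iter N G (- (1 / 2) + IZR 1)).
  - rewrite (iter_shift G) by apply H. apply Rplus_le_compat_r.
    rewrite <- (iter_cancel G B (cm_GB _ _ _ H) N 0) at 1.
    apply iter_mono; [apply H | lra].
  - apply iter_mono; [apply H |]. simpl. lra. }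
pose proof (rotates_turn _ _ _ _ _ _ H Hrot U3) as U4. rewrite plus_INR in U4. lra.
Qed.

(* A primitive of the height of an invariant graph calibrates the generating function: all orbits
   on the graph minimise the action. *)
Lemma calibration (P f G B : R -> R) : circle_map f G B -> (forall x, is_derive P x (f x)) ->
  exists (Phi : R -> R) (be : R), (forall x, is_derive Phi x (G x - x)) /\
    (forall x x', Phi x' - Phi x - be <= (x' - x) ^ 2 / 2 + P x') /\
    (forall x, Phi (G x) - Phi x - be = (G x - x) ^ 2 / 2 + P (G x)).
Proof.
intros H HP.
assert (Cphi : forall x, continuous (fun x => G x - x) x).
{ intros x. apply continuity_pt_filterlim. apply continuity_pt_minus; [apply H | apply continuity_pt_id]. }
set (Phi := fun x => RInt (fun t => G t - t) 0 x).
assert (HPhi : forall x, is_derive Phi x (G x - x)).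
{ intros x. apply (is_derive_RInt (fun t => G t - t) Phi 0 x); [| apply Cphi].
  apply filter_forall. intros y. apply (RInt_correct (fun t => G t - t)).
  apply ex_RInt_continuous. intros; apply Cphi. }
assert (Dcont : forall (u du : R -> R), (forall x, is_derive u x (du x)) -> forall x, continuity_pt u x).
{ intros u du Hu x. apply continuity_pt_filterlim. apply (ex_derive_continuous u). eexists. apply Hu. }
(* The generating function with the calibration removed. For fixed [x] it is minimal at [x' = G x],
   because its derivative [B x' - x] is nondecreasing. *)
set (Hf := fun x x' => (x' - x) ^ 2 / 2 + P x' + Phi x - Phi x').
assert (D2 : forall x x', is_derive (fun z => Hf x z) x' (B x' - x)).
{ intros x x'. unfold Hf.
  evar_last.
  - apply (is_derive_minus (fun z => (z - x) ^ 2 / 2 + P z + Phi x) Phi); [| apply HPhi].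
    apply (is_derive_plus (fun z => (z - x) ^ 2 / 2 + P z) (fun _ => Phi x)); [| apply is_derive_const].
    apply (is_derive_plus (fun z => (z - x) ^ 2 / 2) P); [| apply HP].
    instantiate (1 := x' - x). auto_derive; trivial. lra.
  - unfold minus, plus, opp, zero; simpl. pose proof (cm_eq _ _ _ H x'). lra. }
assert (D1 : forall x x', is_derive (fun z => Hf z x') x (G x - x')).
{ intros x x'. unfold Hf.
  evar_last.
  - apply (is_derive_minus (fun z => (x' - z) ^ 2 / 2 + P x' + Phi z) (fun _ => Phi x')); [| apply is_derive_const].
    apply (is_derive_plus (fun z => (x' - z) ^ 2 / 2 + P x') Phi); [| apply HPhi].
    instantiate (1 := x - x'). auto_derive; trivial. lra.
  - unfold minus, plus, opp, zero; simpl. lra. }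
assert (Hmin : forall x x', Hf x (G x) <= Hf x x').
{ intros x x'.
  destruct (MVT_gen (fun z => Hf x z) (G x) x' (fun z => B z - x)) as [c [Hc E]].
  - intros z _. apply D2.
  - intros z _. apply (Dcont _ _ (D2 x)).
  - assert (0 <= (B c - x) * (x' - G x)); [| lra].
    destruct (Rle_dec (G x) x') as [L | L].
    + rewrite Rmin_left in Hc by lra.
      pose proof (cm_monB _ _ _ H (G x) c ltac:(lra)) as M. rewrite (cm_BG _ _ _ H) in M.
      apply Rmult_le_pos; lra.
    + rewrite Rmax_left in Hc by lra.
      pose proof (cm_monB _ _ _ H c (G x) ltac:(lra)) as M. rewrite (cm_BG _ _ _ H) in M.
      replace ((B c - x) * (x' - G x)) with ((x - B c) * (G x - x')) by ring.
      apply Rmult_le_pos; lra. }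
set (eta := fun x => Hf x (G x)).
(* [G] is merely continuous, so [eta] cannot be differentiated by the chain rule. Comparing with the
   fixed second argument [G x] bounds its increments by a product of two small factors, whence its
   derivative vanishes. *)
assert (Hup : forall x y, eta y - eta x <= Rabs (G y - G x) * Rabs (y - x)).
{ intros x y.
  destruct (MVT_gen (fun z => Hf z (G x)) x y (fun z => G z - G x)) as [c [Hc E]].
  - intros z _. apply D1.
  - intros z _. apply (Dcont _ _ (fun z => D1 z (G x))).
  - apply Rle_trans with (Hf y (G x) - Hf x (G x)).
    + unfold eta. pose proof (Hmin y (G x)). lra.
    + rewrite E. eapply Rle_trans; [apply Rle_abs |]. rewrite Rabs_mult.
      apply Rmult_le_compat_r; [apply Rabs_pos |].
      destruct (Rle_dec x y) as [L | L].
      * rewrite Rmin_left, Rmax_right in Hc by lra.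
        pose proof (cm_monG _ _ _ H x c ltac:(lra)). pose proof (cm_monG _ _ _ H c y ltac:(lra)).
        rewrite !Rabs_right by lra. lra.
      * rewrite Rmin_right, Rmax_left in Hc by lra.
        pose proof (cm_monG _ _ _ H c x ltac:(lra)). pose proof (cm_monG _ _ _ H y c ltac:(lra)).
        rewrite !Rabs_left1 by lra. lra. }
assert (Heta : forall x, is_derive eta x 0).
{ intros x. apply is_derive_Reals. intros e He.
  destruct (cm_contG _ _ _ H x e He) as [dl [Hdl Hc]].
  exists (mkposreal dl Hdl). intros h Hh0 Hh. simpl in Hh.
  specialize (Hc (x + h)). simpl in Hc. unfold Rdist in Hc.
  assert (Hg : Rabs (G (x + h) - G x) < e).
  { apply Hc. split; [split; [exact I | lra] |]. replace (x + h - x) with h by ring. trivial. }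
  pose proof (Hup x (x + h)) as U1. pose proof (Hup (x + h) x) as U2.
  rewrite (Rabs_minus_sym (G x)), (Rabs_minus_sym x) in U2.
  replace (x + h - x) with h in U1, U2 by ring.
  rewrite Rminus_0_r. unfold Rdiv. rewrite Rabs_mult, Rabs_inv.
  assert (Hha : 0 < Rabs h) by now apply Rabs_pos_lt.
  apply Rle_lt_trans with (Rabs (G (x + h) - G x)); trivial.
  apply Rle_div_l; trivial. apply Rabs_le. split; lra. }
assert (Hconst : forall x, eta x = eta 0).
{ intros x. destruct (MVT_gen eta 0 x (fun _ => 0)) as [c [_ E]].
  - intros; apply Heta.
  - intros z _. apply (Dcont _ _ Heta).
  - lra. }
exists Phi, (- eta 0). split; [exact HPhi | split].
- intros x x'. rewrite <- (Hconst x). pose proof (Hmin x x') as M. unfold eta. unfold Hf in *. lra.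
- intros x. rewrite <- (Hconst x). unfold eta, Hf. lra.
Qed.

(** * Chains of the Frenkel-Kontorova action *)

(* The chain runs from [x] through [l] to [1]; its end points carry no potential. *)
Fixpoint action (V : R -> R) (x : R) (l : list R) : R :=
  match l with
  | nil => (1 - x) ^ 2 / 2
  | y :: l' => (y - x) ^ 2 / 2 + V y + action V y l'
  end.

Fixpoint ascending (x : R) (l : list R) : Prop :=
  match l with
  | nil => x <= 1
  | y :: l' => x <= y /\ ascending y l'
  end.

Definition sum_over (v : R -> R) (l : list R) : R := fold_right (fun y a => v y + a) 0 l.

(** The potential in use vanishes at 0 and 1. Keeping clear of these points gives each chain point a
    minimal cost and so bounds the number of points. *)
Definition away (sg : R) (l : list R) : Prop := forall y, In y l -> sg <= y <= 1 - sg.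

Lemma action_split (V W v : R -> R) (b : R) : (forall x, V x = W x + b * v x) ->
  forall l x, action V x l = action W x l + b * sum_over v l.
Proof.
intros HV. induction l as [|y l IH]; intros x; simpl; [ring |].
rewrite IH, HV. ring.
Qed.

Lemma sum_over_nonneg (v : R -> R) l : (forall x, 0 <= v x) -> 0 <= sum_over v l.
Proof. intros Hv. induction l as [|y l IH]; simpl; [lra |]. specialize (Hv y). lra. Qed.

Lemma sum_over_ge (v : R -> R) l x : (forall x, 0 <= v x) -> In x l -> v x <= sum_over v l.
Proof.
intros Hv. induction l as [|y l IH]; simpl; [tauto |].
intros [-> | Hin].
- pose proof (sum_over_nonneg v l Hv). lra.
- specialize (Hv y). specialize (IH Hin). lra.
Qed.

Lemma sum_over_le_action (V : R -> R) l x : sum_over V l <= action V x l.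
Proof.
revert x. induction l as [|y l IH]; intros x; simpl.
- pose proof (pow2_ge_0 (1 - x)). simpl in *. lra.
- pose proof (pow2_ge_0 (y - x)). specialize (IH y). simpl in *. lra.
Qed.

Lemma last_cons {T : Type} (y : T) l x : last (y :: l) x = last l y.
Proof. revert y x. induction l as [|z l IH]; intros; [reflexivity |]. change (last (z :: l) x = last (z :: l) y). now rewrite !IH. Qed.

Lemma action_app (V : R -> R) l1 l2 l2' x :
  action V x (l1 ++ l2) - action V x (l1 ++ l2') =
  action V (last l1 x) l2 - action V (last l1 x) l2'.
Proof.
revert x. induction l1 as [|y l1 IH]; intros x; [reflexivity |].
rewrite last_cons. specialize (IH y). cbn [app action]. lra.
Qed.

Lemma ascending_app l1 l2 x : ascending x (l1 ++ l2) -> ascending (last l1 x) l2 /\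
  x <= last l1 x /\ (forall y, In y l1 -> y <= last l1 x).
Proof.
revert x. induction l1 as [|z l1 IH]; intros x; simpl app.
- simpl. intros H. repeat split; trivial; [lra | tauto].
- intros [H1 H2]. rewrite last_cons. destruct (IH z H2) as [A1 [A2 A3]].
  repeat split; trivial; [lra |]. intros y [-> | Hy]; [lra | now apply A3].
Qed.

Lemma ascending_le1 l x : ascending x l -> x <= 1 /\ forall y, In y l -> x <= y <= 1.
Proof.
revert x. induction l as [|z l IH]; intros x; simpl.
- intros H. split; [trivial | tauto].
- intros [H1 H2]. destruct (IH z H2) as [A1 A2]. split; [lra |].
  intros y [-> | Hy]; [lra |]. specialize (A2 y Hy). lra.
Qed.

Lemma ascending_drop l1 l2 b x : ascending x (l1 ++ b :: l2) -> ascending x (l1 ++ l2).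
Proof.
revert x. induction l1 as [|z l1 IH]; intros x; simpl.
- intros [H1 H2]. destruct l2 as [|c l2]; simpl in *; [lra |]. destruct H2. split; [lra | trivial].
- intros [H1 H2]. split; trivial. now apply IH.
Qed.

Lemma ascending_cut (c : R) l x : ascending x l ->
  exists l1 l2, l = l1 ++ l2 /\ (forall y, In y l1 -> y < c) /\ (forall y, In y l2 -> c <= y).
Proof.
revert x. induction l as [|z l IH]; intros x; simpl.
- intros _. exists nil, nil. simpl. tauto.
- intros [H1 H2]. destruct (Rlt_dec z c) as [Hz | Hz].
  + destruct (IH z H2) as [l1 [l2 [-> [A1 A2]]]].
    exists (z :: l1), l2. simpl. repeat split; trivial. intros y [<- | Hy]; [trivial | now apply A1].
  + exists nil, (z :: l). simpl. repeat split; try tauto.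
    intros y [<- | Hy]; [lra |]. pose proof (proj2 (ascending_le1 _ _ H2) y Hy). lra.
Qed.

(** Only the first bond changes, and its square grows by at most twice the displacement, as all
    points lie in [0,1]. *)
Lemma action_start (V : R -> R) l a b : 0 <= a <= b -> ascending b l ->
  action V a l - action V b l <= b - a.
Proof.
intros Hab Hl. destruct (ascending_le1 _ _ Hl) as [Hb1 Hb2].
destruct l as [|c l]; simpl.
- nra.
- specialize (Hb2 c (or_introl eq_refl)). nra.
Qed.

(** The infimum runs over chains with any number of points; the defect [tau] later fits into the
    margin of the barrier. *)
Definition near_minimal (V : R -> R) (sg tau : R) (z : list R) : Prop :=
  ascending 0 z /\ away sg z /\
  forall l, ascending 0 l -> away sg l -> action V 0 z <= action V 0 l + tau.

Lemma near_minimal_exists (V : R -> R) (sg tau : R) :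
  (forall x, 0 <= V x) -> 0 < tau -> exists z, near_minimal V sg tau z.
Proof.
intros HV Htau.
set (E := fun v => exists l, ascending 0 l /\ away sg l /\ v = - action V 0 l).
destruct (completeness E) as [c [Hub Hlub]].
{ exists 0. intros v [l [_ [_ ->]]].
  pose proof (sum_over_le_action V l 0). pose proof (sum_over_nonneg V l HV). lra. }
{ exists (- action V 0 nil), nil. repeat split; simpl in *; try lra; tauto. }
apply NNPP. intros Hno.
assert (Hle : c <= c - tau); [| lra].
apply Hlub. intros v [l [H1 [H2 ->]]]. apply Rnot_lt_le. intros Hlt.
apply Hno. exists l. repeat split; trivial; try apply H2; trivial.
intros l' H1' H2'. assert (- action V 0 l' <= c) by (apply Hub; now exists l'). lra.
Qed.

(* If the step of the chain across [1/2] were short, deleting its right end would lower the action. *)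
Lemma near_minimal_gap (u : R -> R) (A sg tau : R) (z : list R) :
  0 < A <= 1 / 2 -> tau <= A / 2 -> (forall x, 1 / 2 <= x <= 3 / 4 -> 1 <= u x) ->
  near_minimal (fun x => A * u x) sg tau z ->
  exists xi, 1 / 4 <= xi <= 3 / 4 /\ forall y, In y z -> A / 4 <= Rabs (y - xi).
Proof.
intros HA Htau Hu [Hz [Haw Hmin]].
destruct (ascending_cut (1 / 2) z 0 Hz) as [l1 [l2 [E [H1 H2]]]].
subst z.
destruct (ascending_app _ _ _ Hz) as [B1 [B2 B3]].
set (a := last l1 0) in *.
assert (Ha : 0 <= a < 1 / 2).
{ split; trivial. destruct l1 as [|y l1]; [unfold a; simpl; lra |].
  apply H1. unfold a. rewrite (app_removelast_last (l := y :: l1) 0) at 2 by discriminate.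
  apply in_or_app. right. now left. }
assert (Hb : exists b, 1 / 2 <= b <= 1 /\ A / 2 <= b - a /\ forall y, In y l2 -> b <= y).
{ destruct l2 as [|b l2].
  - exists 1. repeat split; try lra. simpl. tauto.
  - simpl in B1. destruct B1 as [B1 B1']. destruct (ascending_le1 _ _ B1') as [C1 C2].
    pose proof (H2 b (or_introl eq_refl)) as Hb.
    exists b. repeat split; trivial.
    (* Beyond 3/4 the gap already exceeds 1/4 >= A/2. Otherwise deleting [b] saves at least A and
       costs at most b - a, so A <= b - a + tau. *)
    + destruct (Rle_dec b (3 / 4)) as [L | L]; [| lra].
      specialize (Hu b ltac:(lra)).
      assert (Hd : ascending 0 (l1 ++ l2)) by (apply (ascending_drop _ _ b); trivial).
      assert (Hd2 : away sg (l1 ++ l2)).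
      { intros y Hy. apply Haw. apply in_app_or in Hy. apply in_or_app. simpl. tauto. }
      specialize (Hmin _ Hd Hd2).
      pose proof (action_app (fun x => A * u x) l1 (b :: l2) l2 0) as Happ. fold a in Happ. simpl in Happ.
      pose proof (action_start (fun x => A * u x) l2 a b ltac:(lra) B1') as Hst.
      assert (0 <= (b - a) * ((b - a) * 1) / 2) by nra. nra.
    + intros y [<- | Hy]; [lra |]. now apply C2. }
destruct Hb as [b [Hb1 [Hb2 Hb3]]].
exists ((a + b) / 2). split; [lra |].
intros y Hy. apply in_app_or in Hy. destruct Hy as [Hy | Hy].
- specialize (B3 y Hy). rewrite Rabs_left1 by lra. lra.
- specialize (Hb3 y Hy). rewrite Rabs_right by lra. lra.
Qed.

Lemma away_length (V : R -> R) (c sg : R) l x : (forall y, sg <= y <= 1 - sg -> c <= V y) ->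
  away sg l -> INR (length l) * c <= action V x l.
Proof.
intros HV Haw. apply Rle_trans with (sum_over V l); [| apply sum_over_le_action].
induction l as [|y l IH]; [simpl; lra |].
change (length (y :: l)) with (S (length l)). rewrite S_INR. simpl sum_over.
assert (c <= V y) by (apply HV, Haw; now left).
assert (INR (length l) * c <= sum_over V l) by (apply IH; intros w Hw; apply Haw; now right).
lra.
Qed.

(** The calibration inequality telescopes along the chain, with [be] charged once for each of its
    [S (length l)] bonds. *)
Lemma action_calibrated (P Phi : R -> R) (be : R) : P 1 = 0 ->
  (forall x x', Phi x' - Phi x - be <= (x' - x) ^ 2 / 2 + P x') ->
  forall l x, Phi 1 - Phi x - INR (S (length l)) * be <= action P x l.
Proof.
intros HP HPhi. induction l as [|y l IH]; intros x.
- simpl. pose proof (HPhi x 1). rewrite HP in H. simpl in H. lra.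
- specialize (IH y). pose proof (HPhi x y) as Hxy.
  change (length (y :: l)) with (S (length l)). rewrite S_INR. cbn [action]. lra.
Qed.

Fixpoint orbit_list (G : R -> R) (n : nat) (x : R) : list R :=
  match n with
  | O => x :: nil
  | S n' => x :: orbit_list G n' (G x)
  end.

Lemma orbit_list_in (G : R -> R) n i x : (i <= n)%nat -> In (Nat.iter i G x) (orbit_list G n x).
Proof.
revert i x. induction n as [|n IH]; intros i x Hi.
- replace i with 0%nat by lia. now left.
- destruct i as [|i]; [now left |]. right. rewrite Nat.iter_succ_r. apply IH. lia.
Qed.

Lemma orbit_list_range (G : R -> R) n x hi : (forall x, x < G x) -> Nat.iter n G x <= hi ->
  forall y, In y (orbit_list G n x) -> x <= y <= hi.
Proof.
intros HG. revert x. induction n as [|n IH]; intros x Hhi y Hy.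
- simpl in *. destruct Hy as [<- | []]. lra.
- rewrite Nat.iter_succ_r in Hhi. specialize (HG x).
  assert (x <= hi).
  { assert (G x <= hi); [| lra]. apply (IH (G x) Hhi). destruct n; now left. }
  destruct Hy as [<- | Hy]; [lra |]. specialize (IH _ Hhi y Hy). lra.
Qed.

Lemma orbit_list_ascending (G : R -> R) n w x : (forall x, x < G x) -> w <= x -> Nat.iter n G x <= 1 ->
  ascending w (orbit_list G n x).
Proof.
intros HG. revert w x. induction n as [|n IH]; intros w x Hw H1.
- simpl in *. lra.
- rewrite Nat.iter_succ_r in H1. simpl. split; trivial. apply IH; trivial. apply Rlt_le, HG.
Qed.

(** The calibration equality telescopes along the orbit. Replacing the last target [G x] by the end
    point 1 costs at most 1 - G x <= sg, and [be] enters with the favourable sign. *)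
Lemma orbit_list_action (G P Phi : R -> R) (be sg : R) :
  (forall x, 0 <= P x) -> 0 <= be ->
  (forall x, x < G x) -> (forall x y, x <= y -> Phi x <= Phi y) ->
  (forall x, Phi (G x) - Phi x - be = (G x - x) ^ 2 / 2 + P (G x)) ->
  forall n x w, 0 <= x -> Nat.iter n G x <= 1 - sg -> 1 - sg < Nat.iter (S n) G x <= 1 ->
  action P w (orbit_list G n x) <= (x - w) ^ 2 / 2 + P x + Phi 1 - Phi x + sg.
Proof.
intros HP Hbe HG HPhi Hcal. induction n as [|n IH]; intros x w Hx H1 H2.
- simpl in H1, H2. cbn [orbit_list action].
  pose proof (Hcal x) as C. pose proof (HPhi (G x) 1 ltac:(lra)). pose proof (HP (G x)).
  assert ((1 - x) ^ 2 / 2 <= (G x - x) ^ 2 / 2 + (1 - G x)).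
  { specialize (HG x). nra. }
  lra.
- rewrite Nat.iter_succ_r in H1. rewrite Nat.iter_succ_r in H2.
  cbn [orbit_list action]. specialize (HG x).
  specialize (IH (G x) x ltac:(lra) H1 H2). pose proof (Hcal x). lra.
Qed.

(** The orbit through [xi], cut to [sg, 1 - sg], competes with [z] for the action of [A u]. With the
    bump included, both actions are compared to [Phi 1 - Phi 0]: from above for the orbit, from
    below for [z]. What remains is that the bump at [xi] is paid for by the errors. *)
Lemma slow_circle_barrier (P f G B u v : R -> R) (al A b sg tau xi : R) (z : list R) :
  circle_map f G B -> rotates G al -> 0 < al < 1 ->
  (forall x, is_derive P x (f x)) -> (forall x, 0 <= P x) -> P 0 = 0 -> P 1 = 0 -> f 0 = 0 ->
  (forall x, P x = A * u x + b * v x) -> (forall x, 0 <= v x) -> 0 <= b ->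
  near_minimal (fun x => A * u x) sg tau z ->
  G 0 <= sg -> sg <= xi <= 1 - sg -> sg <= 1 / 2 ->
  b * v xi <= 2 * sg + tau + b * sum_over v z + INR (S (length z)) * G 0.
Proof.
intros H Hrot Hal HP HP0 HPz HP1 Hf0 HPuv Hv Hb [Hz [Haw Hmin]] Hd Hxi Hsg.
pose proof (rotates_pos _ _ _ _ H Hrot (proj1 Hal)) as HG.
assert (HGB := cm_GB _ _ _ H). assert (HBG := cm_BG _ _ _ H).
assert (HG1 : forall x, G x < x + 1).
{ intros x. apply Rnot_le_lt. intros Hle. pose proof (rotates_turn _ _ _ _ x 1 H Hrot Hle). simpl in H0. lra. }
destruct (calibration P f G B H HP) as [Phi [be [DPhi [Cle Ceq]]]].
assert (CPhi : forall x, continuity_pt Phi x).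
{ intros x. apply continuity_pt_filterlim. apply (ex_derive_continuous Phi). eexists. apply DPhi. }
assert (HPhi : forall x y, x <= y -> Phi x <= Phi y /\ Phi y - Phi x <= y - x).
{ intros x y Hxy. destruct (MVT_gen Phi x y (fun t => G t - t)) as [c [_ E]].
  - intros t _. apply DPhi.
  - intros t _. apply CPhi.
  - pose proof (HG c). pose proof (HG1 c). split; nra. }
assert (Hbe0 : 0 <= be).
{ pose proof (Cle 0 0). rewrite HPz in H0. simpl in H0. lra. }
assert (HG0 : 0 < G 0) by apply HG.
(* The calibration equality at 0, where [Phi] grows by at most the displacement. *)
assert (Hbed : be <= G 0).
{ pose proof (Ceq 0) as C. pose proof (HP0 (G 0)). pose proof (proj2 (HPhi 0 (G 0) ltac:(lra))).
  pose proof (pow2_ge_0 (G 0 - 0)). lra. }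
assert (HB0 : B 0 = - G 0) by (pose proof (cm_eq _ _ _ H 0); lra).
assert (Hback : exists k, sg <= Nat.iter k B xi /\ Nat.iter (S k) B xi < sg).
{ apply NNPP. intros Hno.
  assert (Hall : forall k, sg <= Nat.iter k B xi).
  { induction k as [|k IH]; [simpl; lra |]. apply Rnot_lt_le. intros Hlt. apply Hno. now exists k. }
  destruct (rotates_unbounded G al Hrot (proj1 Hal) 0 xi) as [n Hn].
  pose proof (iter_mono B (cm_monB _ _ _ H) n _ _ (Rlt_le _ _ Hn)) as M.
  rewrite (iter_cancel B G HBG) in M. specialize (Hall n). lra. }
destruct Hback as [k [Hk1 Hk2]].
set (e := Nat.iter k B xi) in *.
assert (Hek : Nat.iter k G e = xi) by (unfold e; apply iter_cancel, HGB).
assert (He : Nat.iter (S k) B xi = B e) by reflexivity. rewrite He in Hk2.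
assert (HBe : 0 <= B e).
{ pose proof (cm_monB _ _ _ H (G 0) e ltac:(lra)). rewrite HBG in H0. lra. }
assert (Hfwd : exists n, (k <= n)%nat /\ Nat.iter n G e <= 1 - sg /\ 1 - sg < Nat.iter (S n) G e).
{ apply NNPP. intros Hno.
  assert (Hall : forall i, Nat.iter (i + k) G e <= 1 - sg).
  { induction i as [|i IH]; [simpl; lra |]. apply Rnot_lt_le. intros Hlt. apply Hno.
    exists (i + k)%nat. repeat split; trivial. lia. }
  destruct (rotates_unbounded G al Hrot (proj1 Hal) e 1) as [n Hn].
  assert (Hge : forall i, Nat.iter n G e <= Nat.iter (i + n) G e).
  { induction i as [|i IHi]; [simpl; lra |]. simpl. pose proof (HG (Nat.iter (i + n) G e)). lra. }
  specialize (Hge k). rewrite Nat.add_comm in Hge. specialize (Hall n). lra. }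
destruct Hfwd as [n [Hkn [Hn1 Hn2]]].
(* Closeness to the fixed point enters here: B 1 = 1 - G 0 >= 1 - sg, so the orbit cannot jump past
   1. Likewise B e >= 0 at the other end. *)
assert (Hn3 : Nat.iter (S n) G e <= 1).
{ simpl. assert (Nat.iter n G e <= B 1).
  { replace 1 with (0 + 1) by ring. rewrite (cm_perB _ _ _ H), HB0. lra. }
  pose proof (cm_monG _ _ _ H _ _ H0). rewrite HGB in H1. trivial. }
set (E := orbit_list G n e).
assert (HEr : forall y, In y E -> e <= y <= 1 - sg) by (apply orbit_list_range; trivial).
assert (HE1 : ascending 0 E) by (apply orbit_list_ascending; trivial; lra).
assert (HE2 : away sg E) by (intros y Hy; specialize (HEr y Hy); lra).
assert (HE3 : action P 0 E <= Phi 1 - Phi 0 + 2 * sg).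
{ pose proof (orbit_list_action G P Phi be sg HP0 Hbe0 HG (fun x y L => proj1 (HPhi x y L)) Ceq n e 0
    ltac:(lra) Hn1 (conj Hn2 Hn3)) as T. fold E in T.
  pose proof (Ceq (B e)) as C. rewrite HGB in C.
  pose proof (proj1 (HPhi 0 (B e) HBe)).
  assert (e <= 1) by (specialize (HEr e ltac:(unfold E; destruct n; now left)); lra).
  assert ((e - 0) ^ 2 / 2 <= (e - B e) ^ 2 / 2 + sg).
  { replace ((e - 0) ^ 2 / 2) with ((e - B e) ^ 2 / 2 + B e * (e - B e / 2)) by field.
    assert (0 <= (sg - B e)) by lra. nra. }
  lra. }
assert (HE4 : v xi <= sum_over v E).
{ apply sum_over_ge; trivial. rewrite <- Hek. now apply orbit_list_in. }
specialize (Hmin E HE1 HE2).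
pose proof (action_split P (fun x => A * u x) v b HPuv E 0) as SE.
pose proof (action_split P (fun x => A * u x) v b HPuv z 0) as Sz.
pose proof (action_calibrated P Phi be HP1 Cle z 0) as Cz.
assert (INR (S (length z)) * be <= INR (S (length z)) * G 0) by (apply Rmult_le_compat_l; [apply pos_INR | trivial]).
assert (b * v xi <= b * sum_over v E) by now apply Rmult_le_compat_l.
lra.
Qed.

(** * Trigonometric polynomials in amplitude-phase form *)

Definition term_val (x : R) (t : R * Z * R) : R :=
  let '(c, k, th) := t in c * cos (2 * PI * IZR k * x + th).

Definition terms_val (l : list (R * Z * R)) (x : R) : R :=
  fold_right (fun t a => term_val x t + a) 0 l.

Definition amplitude (l : list (R * Z * R)) : R :=
  fold_right (fun t a => Rabs (fst (fst t)) + a) 0 l.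

(** [W] bounds the sum of the amplitudes, a norm that is submultiplicative, dominates the supremum,
    and grows by at most 2 PI N under differentiation. Frequencies are signed and may repeat, which
    keeps products simple. *)
Definition trigonometric (N : nat) (W : R) (g : R -> R) : Prop :=
  exists l, (forall t, In t l -> (Z.abs (snd (fst t)) <= Z.of_nat N)%Z) /\ amplitude l <= W /\
    forall x, g x = terms_val l x.

Lemma trigonometric_ext N W g h : (forall x, h x = g x) -> trigonometric N W g -> trigonometric N W h.
Proof. intros E [l [H1 [H2 H3]]]. exists l. repeat split; trivial. intros x. now rewrite E. Qed.

Lemma trigonometric_weaken N N' W W' g : (N <= N')%nat -> W <= W' -> trigonometric N W g -> trigonometric N' W' g.
Proof.
intros HN HW [l [H1 [H2 H3]]]. exists l. repeat split; trivial; [| lra].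
intros t Ht. specialize (H1 t Ht). lia.
Qed.

Lemma terms_val_app l l' x : terms_val (l ++ l') x = terms_val l x + terms_val l' x.
Proof. induction l as [|t l IH]; simpl; [ring | rewrite IH; ring]. Qed.

Lemma amplitude_app l l' : amplitude (l ++ l') = amplitude l + amplitude l'.
Proof. induction l as [|t l IH]; simpl; [ring | rewrite IH; ring]. Qed.

Lemma trigonometric_bound N W g : trigonometric N W g -> forall x, Rabs (g x) <= W.
Proof.
intros [l [_ [H2 H3]]] x. rewrite H3. eapply Rle_trans; [| apply H2]. clear.
induction l as [|[[c k] th] l IH]; simpl; [rewrite Rabs_R0; lra |].
eapply Rle_trans; [apply Rabs_triang |]. apply Rplus_le_compat; trivial.
rewrite Rabs_mult. rewrite <- (Rmult_1_r (Rabs c)) at 2.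
apply Rmult_le_compat_l; [apply Rabs_pos |]. apply Rabs_le. apply COS_bound.
Qed.

Lemma trigonometric_cos N c (k : Z) th : (Z.abs k <= Z.of_nat N)%Z ->
  trigonometric N (Rabs c) (fun x => c * cos (2 * PI * IZR k * x + th)).
Proof.
intros Hk. exists ((c, k, th) :: nil). simpl. repeat split; [| lra |].
- intros t [<- | []]. exact Hk.
- intros x. unfold terms_val; simpl. ring.
Qed.

Lemma trigonometric_const N c : trigonometric N (Rabs c) (fun _ => c).
Proof.
apply trigonometric_ext with (fun x => c * cos (2 * PI * IZR 0 * x + 0)).
- intros x. replace (2 * PI * IZR 0 * x + 0) with 0 by ring. rewrite cos_0. ring.
- apply trigonometric_cos. simpl. lia.
Qed.

Lemma trigonometric_plus N W W' g h : trigonometric N W g -> trigonometric N W' h ->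
  trigonometric N (W + W') (fun x => g x + h x).
Proof.
intros [l [H1 [H2 H3]]] [l' [H1' [H2' H3']]]. exists (l ++ l'). repeat split.
- intros t Ht. apply in_app_or in Ht. destruct Ht; auto.
- rewrite amplitude_app. lra.
- intros x. now rewrite terms_val_app, H3, H3'.
Qed.

Lemma trigonometric_rescale N W g c (q : nat) : trigonometric N W g ->
  trigonometric (q * N) (Rabs c * W) (fun x => c * g (INR q * x)).
Proof.
intros [l [H1 [H2 H3]]].
exists (map (fun t => let '(a, k, th) := t in (c * a, (Z.of_nat q * k)%Z, th)) l).
repeat split.
- intros t Ht. apply in_map_iff in Ht. destruct Ht as [[[a k] th] [<- Hin]].
  specialize (H1 _ Hin). simpl in *. rewrite Z.abs_mul. nia.
- apply Rle_trans with (Rabs c * amplitude l); [| apply Rmult_le_compat_l; [apply Rabs_pos | trivial]].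
  right. clear. induction l as [|[[a k] th] l IH]; simpl; [ring |]. rewrite IH, Rabs_mult. ring.
- intros x. rewrite H3. clear. induction l as [|[[a k] th] l IH]; unfold terms_val in *; simpl; [ring |].
  rewrite <- IH, mult_IZR, <- INR_IZR_INZ, Rmult_plus_distr_l.
  replace (2 * PI * (INR q * IZR k) * x + th) with (2 * PI * IZR k * (INR q * x) + th) by ring. ring.
Qed.

Lemma trigonometric_scal N W g c : trigonometric N W g ->
  trigonometric N (Rabs c * W) (fun x => c * g x).
Proof.
intros H. apply (trigonometric_rescale _ _ _ c 1) in H. rewrite Nat.mul_1_l in H.
eapply trigonometric_ext; [| exact H]. intros x. simpl. now rewrite Rmult_1_l.
Qed.

Lemma trigonometric_mult N N' W W' g h : trigonometric N W g -> trigonometric N' W' h ->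
  trigonometric (N + N') (W * W') (fun x => g x * h x).
Proof.
intros [l [H1 [H2 H3]]] Hh.
assert (HW' : 0 <= W').
{ pose proof (trigonometric_bound _ _ _ Hh 0). pose proof (Rabs_pos (h 0)). lra. }
assert (Hterm : forall c k th, (Z.abs k <= Z.of_nat N)%Z ->
  trigonometric (N + N') (Rabs c * W') (fun x => c * cos (2 * PI * IZR k * x + th) * h x)).
{ intros c k th Hk. destruct Hh as [l' [H1' [H2' H3']]].
  exists (flat_map (fun t => let '(a, j, ph) := t in
     (c * a / 2, (k + j)%Z, th + ph) :: (c * a / 2, (k - j)%Z, th - ph) :: nil) l').
  repeat split.
  - intros t Ht. apply in_flat_map in Ht. destruct Ht as [[[a j] ph] [Hin Ht]].
    specialize (H1' _ Hin). simpl in *. destruct Ht as [<- | [<- | []]]; simpl; lia.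
  - apply Rle_trans with (Rabs c * amplitude l'); [| apply Rmult_le_compat_l; [apply Rabs_pos | trivial]].
    right. clear. induction l' as [|[[a j] ph] l' IH]; simpl; [ring |]. rewrite IH.
    unfold Rdiv. rewrite !Rabs_mult, (Rabs_right (/ 2)) by lra. lra.
  - intros x. rewrite H3'. clear. induction l' as [|[[a j] ph] l' IH]; unfold terms_val in *; simpl; [ring |].
    rewrite <- IH, plus_IZR, minus_IZR.
    replace (2 * PI * (IZR k + IZR j) * x + (th + ph)) with ((2 * PI * IZR k * x + th) + (2 * PI * IZR j * x + ph)) by ring.
    replace (2 * PI * (IZR k - IZR j) * x + (th - ph)) with ((2 * PI * IZR k * x + th) - (2 * PI * IZR j * x + ph)) by ring.
    set (p := 2 * PI * IZR k * x + th). set (q := 2 * PI * IZR j * x + ph).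
    rewrite cos_plus, cos_minus. field. }
apply trigonometric_ext with (fun x => terms_val l x * h x); [intros x; now rewrite H3 |].
apply trigonometric_weaken with (N + N')%nat (amplitude l * W'); [lia | now apply Rmult_le_compat_r |].
clear H2 H3. induction l as [|[[c k] th] l IH].
- apply trigonometric_weaken with (N + N')%nat (Rabs 0); [lia | simpl; rewrite Rabs_R0; lra |].
  apply trigonometric_ext with (fun _ => 0); [| apply trigonometric_const].
  intros x. unfold terms_val. simpl. ring.
- apply trigonometric_ext with (fun x => c * cos (2 * PI * IZR k * x + th) * h x + terms_val l x * h x).
  + intros x. unfold terms_val. simpl. ring.
  + apply trigonometric_weaken with (N + N')%nat (Rabs c * W' + amplitude l * W'); [lia | simpl; lra |].
    apply trigonometric_plus.
    * apply Hterm. apply (H1 (c, k, th)). now left.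
    * apply IH. intros t Ht. apply H1. now right.
Qed.

Lemma trigonometric_pow N g (M : nat) : trigonometric N 1 g -> trigonometric (M * N) 1 (fun x => g x ^ M).
Proof.
intros H. induction M as [|M IH].
- simpl. apply trigonometric_weaken with 0%nat (Rabs 1); [lia | rewrite Rabs_R1; lra | apply trigonometric_const].
- simpl. apply trigonometric_weaken with (N + M * N)%nat (1 * 1); [lia | lra | now apply trigonometric_mult].
Qed.

Lemma trigonometric_derive N W g : trigonometric N W g ->
  exists g', (forall x, is_derive g x (g' x)) /\ trigonometric N (2 * PI * INR N * W) g'.
Proof.
intros [l [H1 [H2 H3]]].
pose proof PI_RGT_0 as Hpi. pose proof (pos_INR N) as HN.
set (l' := map (fun t => let '(c, k, th) := t in (2 * PI * IZR k * c, k, th + PI / 2)) l).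
exists (terms_val l'). split.
- intros x. apply is_derive_ext with (terms_val l); [intros; now rewrite H3 |].
  unfold l'. clear. induction l as [|[[c k] th] l IH]; unfold terms_val in *; simpl.
  + apply (is_derive_const (K := R_AbsRing) (V := R_NormedModule)).
  + apply (is_derive_plus (fun x => c * cos (2 * PI * IZR k * x + th)) (fun x => fold_right _ 0 l)); [| exact IH].
    rewrite <- Rplus_assoc, cos_plus, cos_PI2, sin_PI2. auto_derive; trivial. ring.
- exists l'. repeat split.
  + intros t Ht. apply in_map_iff in Ht. destruct Ht as [[[c k] th] [<- Hin]]. apply (H1 _ Hin).
  + apply Rle_trans with (2 * PI * INR N * amplitude l); [| apply Rmult_le_compat_l; [nra | trivial]].
    unfold l'. clear H2 H3. induction l as [|[[c k] th] l IH]; simpl; [lra |].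
    assert (Hk : Rabs (IZR k) <= INR N).
    { rewrite <- abs_IZR, INR_IZR_INZ. apply IZR_le. apply (H1 (c, k, th)). now left. }
    specialize (IH (fun t Ht => H1 t (or_intror Ht))).
    rewrite !Rabs_mult, (Rabs_right 2), (Rabs_right PI) by lra.
    pose proof (Rabs_pos c).
    assert (Rabs (IZR k) * Rabs c <= INR N * Rabs c) by now apply Rmult_le_compat_r. nra.
Qed.

Lemma trigonometric_Derive_n N W g (j : nat) : trigonometric N W g ->
  trigonometric N ((2 * PI * INR N) ^ j * W) (Derive_n g j).
Proof.
intros H. induction j as [|j IH].
- simpl. rewrite Rmult_1_l. exact H.
- destruct (trigonometric_derive _ _ _ IH) as [g' [D H']].
  apply trigonometric_ext with g'.
  + intros x. simpl. apply is_derive_unique, D.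
  + simpl. rewrite Rmult_assoc. exact H'.
Qed.

Lemma trigonometric_periodic N W g : trigonometric N W g -> forall x, g (x + 1) = g x.
Proof.
intros [l [_ [_ H3]]] x. rewrite !H3. clear.
induction l as [|[[c k] th] l IH]; unfold terms_val in *; simpl; trivial.
rewrite IH. f_equal. f_equal.
replace (2 * PI * IZR k * (x + 1) + th) with (2 * PI * IZR k * x + th + IZR k * (2 * PI)) by ring.
destruct (Z_le_dec 0 k) as [Hk | Hk].
- rewrite <- (Z2Nat.id k Hk), <- INR_IZR_INZ.
  replace (INR (Z.to_nat k) * (2 * PI)) with (2 * INR (Z.to_nat k) * PI) by ring. apply cos_period.
- set (y := 2 * PI * IZR k * x + th).
  rewrite <- (cos_period (y + IZR k * (2 * PI)) (Z.to_nat (- k))).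
  f_equal. rewrite INR_IZR_INZ, Z2Nat.id, opp_IZR by lia. ring.
Qed.

Lemma trigonometric_lipschitz N W g : trigonometric N W g ->
  forall x y, Rabs (g x - g y) <= 2 * PI * INR N * W * Rabs (x - y).
Proof.
intros H x y. destruct (trigonometric_derive _ _ _ H) as [g' [D H']].
destruct (MVT_gen g y x g') as [c [_ E]].
- intros; apply D.
- intros t _. apply continuity_pt_filterlim. apply (ex_derive_continuous g). eexists. apply D.
- rewrite E, Rabs_mult. apply Rmult_le_compat_r; [apply Rabs_pos |].
  apply (trigonometric_bound _ _ _ H').
Qed.

Lemma sum_seq_plus (F F' : nat -> R) l :
  fold_right Rplus 0 (map (fun k => F k + F' k) l) = fold_right Rplus 0 (map F l) + fold_right Rplus 0 (map F' l).
Proof. induction l as [|k l IH]; simpl; [ring | rewrite IH; ring]. Qed.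

Lemma sum_seq_single (F : nat -> R) n m l :
  (forall k, k <> n -> F k = 0) -> (m <= n < m + l)%nat ->
  fold_right Rplus 0 (map F (seq m l)) = F n.
Proof.
intros HF. revert m. induction l as [|l IH]; intros m Hn; [lia |]. simpl.
destruct (Nat.eq_dec m n) as [-> | Hne].
- assert (Hz : forall i k, (n < k)%nat -> fold_right Rplus 0 (map F (seq k i)) = 0).
  { induction i as [|i IHi]; intros k Hk; simpl; trivial. rewrite IHi by lia. rewrite HF by lia. ring. }
  rewrite Hz by lia. ring.
- rewrite IH by lia. rewrite HF by trivial. ring.
Qed.

Lemma trig_poly_plus N a b a' b' x :
  trig_poly N (fun k => a k + a' k) (fun k => b k + b' k) x = trig_poly N a b x + trig_poly N a' b' x.
Proof.
unfold trig_poly.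
rewrite (map_ext _ (fun k => (a k * cos (2 * PI * INR k * x) + b k * sin (2 * PI * INR k * x)) +
   (a' k * cos (2 * PI * INR k * x) + b' k * sin (2 * PI * INR k * x)))) by (intro; ring).
rewrite sum_seq_plus. ring.
Qed.

Lemma trig_poly_zero N x : trig_poly N (fun _ => 0) (fun _ => 0) x = 0.
Proof.
unfold trig_poly. generalize (seq 1 N). intros l.
induction l as [|k l IH]; simpl in *; [ring |]. lra.
Qed.

Lemma trig_poly_cos N c (k : Z) th : (Z.abs k <= Z.of_nat N)%Z ->
  exists a b, forall x, trig_poly N a b x = c * cos (2 * PI * IZR k * x + th).
Proof.
intros Hk.
assert (Hn : exists n ph, (n <= N)%nat /\ forall x, cos (2 * PI * IZR k * x + th) = cos (2 * PI * INR n * x + ph)).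
{ destruct (Z_le_dec 0 k) as [H | H].
  - exists (Z.to_nat k), th. split; [lia |]. intros x. now rewrite INR_IZR_INZ, Z2Nat.id.
  - exists (Z.to_nat (- k)), (- th). split; [lia |]. intros x. rewrite INR_IZR_INZ, Z2Nat.id by lia.
    rewrite opp_IZR, <- cos_neg. f_equal. ring. }
destruct Hn as [n [ph [Hn E]]].
exists (fun i => if Nat.eq_dec i n then c * cos ph else 0), (fun i => if Nat.eq_dec i n then - (c * sin ph) else 0).
intros x. rewrite E. unfold trig_poly.
destruct (Nat.eq_dec 0 n) as [<- | Hn0].
- rewrite (map_ext_in _ (fun _ => 0)).
  + assert (Hz : forall l : list nat, fold_right Rplus 0 (map (fun _ => 0) l) = 0).
    { induction l as [|i l IH]; simpl; [trivial | rewrite IH; ring]. }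
    rewrite Hz. simpl. replace (2 * PI * 0 * x + ph) with ph by ring. ring.
  + intros i Hi. apply in_seq in Hi. destruct (Nat.eq_dec i 0); [lia | ring].
- rewrite (sum_seq_single _ n).
  + destruct (Nat.eq_dec n n) as [_ | []]; trivial. rewrite cos_plus. ring.
  + intros i Hi. destruct (Nat.eq_dec i n); [contradiction | ring].
  + lia.
Qed.

Lemma trigonometric_trig_poly N W g : trigonometric N W g ->
  exists a b, forall x, trig_poly N a b x = g x.
Proof.
intros [l [H1 [_ H3]]].
assert (Hl : exists a b, forall x, trig_poly N a b x = terms_val l x).
{ clear H3. induction l as [|[[c k] th] l IH].
  - exists (fun _ => 0), (fun _ => 0). intros x. apply trig_poly_zero.
  - destruct IH as [a [b E]]; [intros t Ht; apply H1; now right |].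
    destruct (trig_poly_cos N c k th (H1 (c, k, th) (or_introl eq_refl))) as [a' [b' E']].
    exists (fun i => a' i + a i), (fun i => b' i + b i). intros x.
    rewrite trig_poly_plus, E, E'. reflexivity. }
destruct Hl as [a [b E]]. exists a, b. intros x. now rewrite E, H3.
Qed.

(** * Destruction of slow circles *)

Definition well (x : R) : R := 1 - cos (2 * PI * x).

(** The factor [well] makes the bump vanish to second order at the integers, so the fixed point and
    the values of the potential there are unchanged. *)
Definition bump (M : nat) (xi x : R) : R := well x * ((1 + cos (2 * PI * (x - xi))) / 2) ^ M.

Lemma trigonometric_well : trigonometric 1 2 well.
Proof.
apply trigonometric_ext with (fun x => 1 + -1 * cos (2 * PI * IZR 1 * x + 0)).
- intros x. unfold well. rewrite Rmult_1_r, Rplus_0_r. ring.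
- apply trigonometric_weaken with 1%nat (Rabs 1 + Rabs (-1)); [lia | |].
  + rewrite Rabs_R1, Rabs_left by lra. lra.
  + apply trigonometric_plus; [apply trigonometric_const | apply trigonometric_cos; simpl; lia].
Qed.

Lemma trigonometric_kernel (M : nat) xi :
  trigonometric M 1 (fun x => ((1 + cos (2 * PI * (x - xi))) / 2) ^ M).
Proof.
rewrite <- (Nat.mul_1_r M) at 1. apply trigonometric_pow.
apply trigonometric_ext with (fun x => / 2 + / 2 * cos (2 * PI * IZR 1 * x + (- (2 * PI * xi)))).
- intros x. replace (2 * PI * 1 * x + - (2 * PI * xi)) with (2 * PI * (x - xi)) by ring. field.
- apply trigonometric_weaken with 1%nat (Rabs (/ 2) + Rabs (/ 2)); [lia | |].
  + rewrite Rabs_right by lra. lra.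
  + apply trigonometric_plus; [apply trigonometric_const | apply trigonometric_cos; simpl; lia].
Qed.

Lemma trigonometric_bump (M : nat) xi : trigonometric (S M) 2 (bump M xi).
Proof.
apply trigonometric_weaken with (1 + M)%nat (2 * 1); [lia | lra |].
apply trigonometric_mult; [apply trigonometric_well | apply trigonometric_kernel].
Qed.

Lemma sin_ge_quarter (t : R) : 0 <= t <= PI / 2 -> t / 4 <= sin t.
Proof.
intros Ht. pose proof PI_4 as H4. pose proof PI_RGT_0 as H0.
destruct (Rle_dec t (PI / 6)) as [L | L].
- destruct (MVT_gen (fun t => sin t - t / 4) 0 t (fun t => cos t - / 4)) as [c [Hc E]].
  + intros x _. auto_derive; trivial. lra.
  + intros x _. apply continuity_pt_minus; [apply continuity_sin |].
    apply continuity_pt_mult; [apply continuity_pt_id | apply continuity_pt_const; intros u v; reflexivity].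
  + rewrite sin_0 in E. rewrite Rmin_left, Rmax_right in Hc by lra.
    assert (cos (PI / 3) <= cos c) by (apply cos_decr_1; lra). rewrite cos_PI3 in H.
    assert (0 <= (cos c - / 4) * (t - 0)) by (apply Rmult_le_pos; lra). lra.
- assert (sin (PI / 6) <= sin t) by (apply sin_incr_1; lra). rewrite sin_PI6 in H. lra.
Qed.

Lemma cos_double_sin (t : R) : cos (2 * t) = 1 - 2 * (sin t) ^ 2.
Proof. rewrite cos_2a_sin. ring. Qed.

Lemma sin_PI_ge (t : R) : 0 <= t <= 1 / 2 -> 3 / 4 * t <= sin (PI * t).
Proof.
intros Ht. pose proof PI2_3_2. pose proof (sin_ge_quarter (PI * t)). nra.
Qed.

Lemma well_ge (c x : R) : 0 <= c -> c <= x <= 1 - c -> c ^ 2 <= well x.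
Proof.
intros Hc Hx.
assert (E : forall t, well t = 2 * (sin (PI * t)) ^ 2).
{ intros t. unfold well. replace (2 * PI * t) with (2 * (PI * t)) by ring. rewrite cos_double_sin. ring. }
assert (W : forall t, c <= t <= 1 / 2 -> c ^ 2 <= well t).
{ intros t Ht. rewrite E. pose proof (sin_PI_ge t ltac:(lra)) as S. simpl. nra. }
destruct (Rle_dec x (1 / 2)); [apply W; lra |].
replace (well x) with (well (1 - x)); [apply W; lra |].
unfold well. replace (2 * PI * (1 - x)) with (- (2 * PI * x) + 2 * INR 1 * PI) by (simpl; ring).
rewrite cos_period, cos_neg. reflexivity.
Qed.

Lemma well_nonneg x : 0 <= well x.
Proof. unfold well. pose proof (COS_bound (2 * PI * x)). lra. Qed.

Lemma well_middle x : 1 / 4 <= x <= 3 / 4 -> 1 <= well x.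
Proof.
intros Hx. unfold well. pose proof PI_RGT_0.
assert (cos (2 * PI * x) <= 0) by (apply cos_le_0; nra). lra.
Qed.

(** The kernel is (1 - sin^2)^M <= (1 - z)^M with z = A^2/32, and Bernoulli's inequality gives (1 -
    z)^M (1 + M z) <= 1. *)
Lemma kernel_le (M : nat) (A xi y : R) : 0 < A <= 1 / 2 -> A / 4 <= Rabs (y - xi) <= 3 / 4 ->
  ((1 + cos (2 * PI * (y - xi))) / 2) ^ M * (INR M * A ^ 2) <= 32.
Proof.
intros HA Hy.
set (t := Rabs (y - xi)) in *.
assert (E : (1 + cos (2 * PI * (y - xi))) / 2 = 1 - (sin (PI * t)) ^ 2).
{ assert (Ec : cos (2 * PI * (y - xi)) = cos (2 * (PI * t))).
  { unfold t, Rabs. destruct Rcase_abs; [rewrite <- cos_neg |]; f_equal; ring. }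
  rewrite Ec, cos_double_sin. field. }
assert (Hs : A ^ 2 / 32 <= (sin (PI * t)) ^ 2).
{ assert (Hs' : 3 / 4 * (A / 4) <= sin (PI * t)).
  { destruct (Rle_dec t (1 / 2)).
    - pose proof (sin_PI_ge t ltac:(lra)). lra.
    - replace (PI * t) with (PI - PI * (1 - t)) by ring. rewrite sin_PI_x.
      pose proof (sin_PI_ge (1 - t) ltac:(lra)). lra. }
  simpl. nra. }
rewrite E.
assert (Hs1 : (sin (PI * t)) ^ 2 <= 1).
{ pose proof (SIN_bound (PI * t)). simpl. nra. }
set (z := A ^ 2 / 32) in *.
assert (Hz : 0 < z) by (unfold z; simpl; nra).
apply Rle_trans with ((1 - z) ^ M * (INR M * A ^ 2)).
{ apply Rmult_le_compat_r; [pose proof (pos_INR M); simpl; nra |]. apply pow_incr. lra. }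
assert (B1 : 1 + INR M * z <= (1 + z) ^ M) by now apply poly.
assert (B2 : (1 - z) ^ M * (1 + z) ^ M <= 1).
{ rewrite <- Rpow_mult_distr. apply Rle_trans with (1 ^ M); [apply pow_incr | rewrite pow1; lra].
  assert (z <= 1) by (unfold z; simpl; nra).
  replace ((1 - z) * (1 + z)) with (1 - z * z) by ring. split; nra. }
assert (B3 : 0 <= (1 - z) ^ M) by (apply pow_le; lra).
assert (INR M * A ^ 2 = 32 * (INR M * z)) by (unfold z; field). rewrite H.
assert ((1 - z) ^ M * (1 + INR M * z) <= 1).
{ eapply Rle_trans; [| exact B2]. now apply Rmult_le_compat_l. }
nra.
Qed.

Lemma nat_between (a b : R) : 0 <= a -> a + 1 <= b -> exists n : nat, a <= INR n <= b.
Proof.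
intros Ha Hab. destruct (archimed a) as [H1 H2].
assert (0 <= up a)%Z by (apply le_IZR; lra).
exists (Z.to_nat (up a)). rewrite INR_IZR_INZ, Z2Nat.id by trivial. lra.
Qed.

(** The derivative vanishes at 0 because [well] and its derivative do; its Lipschitz constant is (2
    PI (M + 1))^2 times the total amplitude 2. *)
Lemma bump_derivative (M : nat) xi : exists v', (forall x, is_derive (bump M xi) x (v' x)) /\
  forall x, Rabs (v' x) <= 8 * PI ^ 2 * INR (S M) ^ 2 * Rabs x.
Proof.
destruct (trigonometric_derive _ _ _ (trigonometric_bump M xi)) as [v' [D T]].
exists v'. split; trivial.
destruct (trigonometric_derive _ _ _ (trigonometric_kernel M xi)) as [w' [Dw _]].
assert (E0 : v' 0 = 0).
{ rewrite <- (is_derive_unique _ _ _ (D 0)). apply is_derive_unique.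
  evar_last.
  - apply (is_derive_mult well (fun x => ((1 + cos (2 * PI * (x - xi))) / 2) ^ M)); [| apply Dw | intros; apply Rmult_comm].
    instantiate (1 := 0). unfold well. auto_derive; trivial. rewrite Rmult_0_r, sin_0. ring.
  - unfold plus, mult, well; simpl. rewrite Rmult_0_r, cos_0. ring. }
intros x. pose proof (trigonometric_lipschitz _ _ _ T x 0) as L.
rewrite E0, !Rminus_0_r in L. eapply Rle_trans; [exact L |]. right. ring.
Qed.

Lemma slow_circle_destroyed (T : nat) : (8 <= T)%nat -> exists A0, 0 < A0 /\
  forall A, 0 < A <= A0 -> exists (M : nat) (xi : R), INR (S M) <= 130 / A ^ 3 /\
  forall f G B al, (forall x, is_derive (fun x => A * well x + A ^ T * bump M xi x) x (f x)) ->
    circle_map f G B -> rotates G al -> 0 < Rabs al < A -> False.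
Proof.
intros HT.
(* With s^2 = A, the quantity A b^3 to be beaten is s^(2 (3 T + 1)). A growth of (16 t s)^(-t) wins
   by one power of 1/s, and [Q] collects the constants. *)
set (t := (2 * (3 * T + 1) + 1)%nat).
assert (Ht1 : 1 <= INR t) by (apply (le_INR 1); unfold t; lia).
set (Q := (16 * INR t) ^ t).
assert (HQ : 16 * INR t <= Q).
{ unfold Q. rewrite <- (pow_1 (16 * INR t)) at 1. apply Rle_pow; [lra | unfold t; lia]. }
set (s0 := / (20000 * Q)).
assert (Hs0 : 0 < s0) by (apply Rinv_0_lt_compat; lra).
exists (s0 * s0). split; [now apply Rmult_lt_0_compat |].
intros A [HA HA0].
set (s := sqrt A).
assert (Hs : 0 < s) by now apply sqrt_lt_R0.
assert (HsA : s * s = A) by (apply sqrt_sqrt; lra).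
assert (Hss0 : s <= s0) by (apply Rnot_lt_le; intros Hlt; nra).
assert (HsQ : s * (20000 * Q) <= 1).
{ apply Rle_trans with (s0 * (20000 * Q)); [apply Rmult_le_compat_r; lra |].
  unfold s0. rewrite Rinv_l; lra. }
assert (Hs1 : s <= 1 / 20000) by nra.
assert (HA1 : A <= 1 / 400000000) by (rewrite <- HsA; nra).
assert (HA3 : 0 < A ^ 3) by now apply pow_lt.
(* By [kernel_le], this lower bound for [M] makes the kernel at most A/4 at distance A/4 from [xi],
   so there the bump is at most a quarter of [A * well]. *)
destruct (nat_between (128 / A ^ 3) (129 / A ^ 3)) as [M [HM1 HM2]].
{ apply Rlt_le, Rdiv_lt_0_compat; lra. }
{ replace (129 / A ^ 3) with (128 / A ^ 3 + / A ^ 3) by (field; lra).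
  apply Rplus_le_compat_l. rewrite <- Rinv_1. apply Rinv_le_contravar; trivial.
  simpl. nra. }
set (b := A ^ T).
assert (Hb : 0 < b) by now apply pow_lt.
assert (Hbl : b <= A ^ 8).
{ unfold b. replace T with (8 + (T - 8))%nat by lia. rewrite pow_add.
  rewrite <- (Rmult_1_r (A ^ 8)) at 2. apply Rmult_le_compat_l; [now apply Rlt_le, pow_lt |].
  rewrite <- (pow1 (T - 8)). apply pow_incr. lra. }
assert (HSM : INR (S M) <= 130 / A ^ 3).
{ rewrite S_INR. replace (130 / A ^ 3) with (129 / A ^ 3 + / A ^ 3) by (field; lra).
  apply Rplus_le_compat; trivial. rewrite <- Rinv_1. apply Rinv_le_contravar; trivial. simpl. nra. }
assert (Htau : 0 < b / 8) by lra.
(* With sg = b/16 and tau = b/8 the error 2 sg + tau of the barrier is b/4. *)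
destruct (near_minimal_exists (fun x => A * well x) (b / 16) (b / 8)) as [z Hz]; trivial.
{ intros x. pose proof (well_nonneg x). nra. }
assert (Hbl2 : b <= A).
{ eapply Rle_trans; [apply Hbl |]. simpl.
  assert (A ^ 7 <= 1 ^ 7) by (apply pow_incr; lra). simpl in H. nra. }
assert (Hb1 : b <= 1 / 2) by lra.
destruct (near_minimal_gap well A (b / 16) (b / 8) z) as [xi [Hxi Hgap]]; trivial.
{ lra. }
{ lra. }
{ intros x Hx. apply well_middle. lra. }
exists M, xi. split; trivial.
assert (Hpos : forall f G B al, (forall x, is_derive (fun x => A * well x + b * bump M xi x) x (f x)) ->
    circle_map f G B -> rotates G al -> 0 < al < A -> False).
2:{ intros f G B al Hf Hcm Hrot Hal. destruct (Rle_dec 0 al) as [L | L].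
    - rewrite Rabs_right in Hal by lra. now apply (Hpos f G B al).
    - rewrite Rabs_left in Hal by lra. apply (Hpos f B G (- al)); trivial.
      + now apply circle_map_inverse.
      + now apply (rotates_inverse f G B). }
intros f G B al Hf Hcm Hrot Hal.
set (v := bump M xi) in *.
set (P := fun x => A * well x + b * v x) in *.
destruct (bump_derivative M xi) as [v' [Dv Bv]]. fold v in Dv.
set (D := 8 * PI ^ 2 * INR (S M) ^ 2) in *.
assert (Ef : forall x, f x = A * (2 * PI * sin (2 * PI * x)) + b * v' x).
{ intros x. rewrite <- (is_derive_unique _ _ _ (Hf x)). apply is_derive_unique. unfold P.
  apply (is_derive_plus (fun x => A * well x) (fun x => b * v x)).
  - unfold well. auto_derive; trivial. ring.
  - apply (is_derive_scal v x b). apply Dv. }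
assert (Hpi : 3 < PI <= 4) by (pose proof PI2_3_2; pose proof PI_4; lra).
assert (HD : 0 <= D) by (unfold D; pose proof (pow2_ge_0 (INR (S M))); pose proof (pow2_ge_0 PI); nra).
(* Here T >= 8 enters: b <= A^8 against D of order A^(-6). The factor 80 is what nu m <= s/16 needs
   with m <= 5/s. *)
assert (HDb : 80 * (b * D) <= A).
{ assert (D <= 128 * (130 / A ^ 3) ^ 2).
  { unfold D. apply Rmult_le_compat.
    - pose proof (pow2_ge_0 PI). lra.
    - apply pow2_ge_0.
    - simpl. nra.
    - apply pow_incr. split; [apply pos_INR | trivial]. }
  apply Rle_trans with (80 * (A ^ 8 * (128 * (130 / A ^ 3) ^ 2))).
  - apply Rmult_le_compat_l; [lra |]. apply Rmult_le_compat; lra.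
  - replace (80 * (A ^ 8 * (128 * (130 / A ^ 3) ^ 2))) with (173056000 * A * A) by (field; lra). nra. }
assert (Hv0 : forall x, 0 <= v x).
{ intros x. unfold v, bump. apply Rmult_le_pos; [apply well_nonneg |].
  apply pow_le. pose proof (COS_bound (2 * PI * (x - xi))). lra. }
assert (Hw0 : well 0 = 0) by (unfold well; rewrite Rmult_0_r, cos_0; ring).
assert (Hw1 : well 1 = 0) by (unfold well; rewrite Rmult_1_r, cos_2PI; ring).
assert (HbD : 0 <= b * D) by (apply Rmult_le_pos; lra).
assert (Hsin : forall y, 0 <= y <= 1 / 4 -> A * y + b * D * y <= A * (2 * PI * sin (2 * PI * y))).
{ intros y Hy. pose proof (sin_ge_quarter (2 * PI * y) ltac:(split; nra)) as S.
  assert (9 * y <= 2 * PI * sin (2 * PI * y)).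
  { apply Rle_trans with (2 * PI * (2 * PI * y / 4)); [| apply Rmult_le_compat_l; lra].
    replace (2 * PI * (2 * PI * y / 4)) with (PI * PI * y) by field.
    apply Rmult_le_compat_r; [lra | nra]. }
  assert (b * D * y <= A * y) by (apply Rmult_le_compat_r; lra).
  assert (A * (9 * y) <= A * (2 * PI * sin (2 * PI * y))) by (apply Rmult_le_compat_l; lra). nra. }
assert (Hsin2 : forall y, 0 <= y <= 1 / 2 -> 0 <= A * (2 * PI * sin (2 * PI * y))).
{ intros y Hy. assert (0 <= sin (2 * PI * y)) by (apply sin_ge_0; nra).
  apply Rmult_le_pos; [lra | apply Rmult_le_pos; lra]. }
assert (Hv' : forall y, Rabs (b * v' y) <= b * D * Rabs y).
{ intros y. rewrite Rabs_mult, (Rabs_right b) by lra. rewrite Rmult_assoc. apply Rmult_le_compat_l; [lra | apply Bv]. }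
assert (Hv'p : forall y, 0 <= y -> Rabs (b * v' y) <= b * D * y /\ Rabs (b * v' (- y)) <= b * D * y).
{ intros y Hy. pose proof (Hv' y) as V1. pose proof (Hv' (- y)) as V2. rewrite Rabs_Ropp in V2.
  rewrite (Rabs_right y) in V1, V2 by lra. now split. }
assert (Hf0 : f 0 = 0).
{ rewrite Ef, Rmult_0_r, sin_0. destruct (Hv'p 0 (Rle_refl 0)) as [V _]. rewrite Rmult_0_r in V.
  pose proof (Rabs_pos (b * v' 0)). pose proof (Rabs_eq_0 (b * v' 0) ltac:(lra)). lra. }
destruct (nat_between (4 / s) (5 / s)) as [m [Hm1 Hm2]].
{ apply Rlt_le, Rdiv_lt_0_compat; lra. }
{ replace (5 / s) with (4 / s + / s) by (field; lra).
  apply Rplus_le_compat_l. rewrite <- Rinv_1. apply Rinv_le_contravar; lra. }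
assert (HAt : 0 < A * INR t) by (apply Rmult_lt_0_compat; lra).
(* The time n0 = t n2 is at most 1/(8 A), short enough for the rotation number; by Bernoulli each of
   the t blocks of n2 steps multiplies the distance by at least n2 s >= 1/(16 t s). *)
destruct (nat_between (/ (16 * (A * INR t))) (/ (8 * (A * INR t)))) as [n2 [Hn1 Hn2]].
{ apply Rlt_le, Rinv_0_lt_compat; lra. }
{ replace (/ (8 * (A * INR t))) with (/ (16 * (A * INR t)) + / (16 * (A * INR t))) by (field; lra).
  apply Rplus_le_compat_l. rewrite <- Rinv_1. apply Rinv_le_contravar; [lra |].
  assert (s * (16 * INR t) <= 1 / 20000) by nra. rewrite <- HsA. nra. }
set (n0 := (t * n2)%nat).
assert (Hd : G 0 * (1 + s) ^ n0 <= 1 / 4).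
{ apply (slow_circle_near_fixed_point f G B al A (b * D) s n0 m); trivial; try lra.
  - intros y Hy. rewrite Ef. specialize (Hsin y Hy). destruct (Hv'p y ltac:(lra)) as [V _].
    apply Rabs_le_between in V. lra.
  - intros y Hy. rewrite Ef. specialize (Hsin2 y Hy). destruct (Hv'p y ltac:(lra)) as [V _].
    apply Rabs_le_between in V. nra.
  - intros y Hy. rewrite Ef. specialize (Hsin y Hy). destruct (Hv'p y ltac:(lra)) as [_ V].
    replace (2 * PI * - y) with (- (2 * PI * y)) by ring. rewrite sin_neg.
    apply Rabs_le_between in V. lra.
  - intros y Hy. rewrite Ef. specialize (Hsin2 y Hy). destruct (Hv'p y ltac:(lra)) as [_ V].
    replace (2 * PI * - y) with (- (2 * PI * y)) by ring. rewrite sin_neg.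
    apply Rabs_le_between in V. nra.
  - apply Rle_trans with (b * D * (5 / s)); [apply Rmult_le_compat_l; lra |].
    apply Rmult_le_reg_r with s; trivial.
    replace (b * D * (5 / s) * s) with (5 * (b * D)) by (field; lra). lra.
  - apply (Rmult_le_compat_r s) in Hm1; [| lra]. replace (4 / s * s) with 4 in Hm1 by (field; lra). lra.
  - unfold n0. rewrite !plus_INR, mult_INR. simpl (INR 1).
    assert (INR t * INR n2 * A <= 1 / 8).
    { apply (Rmult_le_compat_r (A * INR t)) in Hn2; [| lra].
      replace (/ (8 * (A * INR t)) * (A * INR t)) with (1 / 8) in Hn2 by (field; lra). lra. }
    assert (INR m * A <= 5 * s).
    { rewrite <- HsA. apply (Rmult_le_compat_r (s * s)) in Hm2; [| nra].
      replace (5 / s * (s * s)) with (5 * s) in Hm2 by (field; lra). lra. }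
    assert (Hsum : 0 <= INR t * INR n2 + 1 + INR m).
    { pose proof (pos_INR n2). pose proof (pos_INR m). nra. }
    apply Rle_lt_trans with (2 * (INR t * INR n2 + 1 + INR m) * A); [apply Rmult_le_compat_l; lra |]. lra. }
assert (Hgrow : 260 < A * (b * b * b) * (1 + s) ^ n0).
{ assert (P1 : (/ (16 * INR t * s)) ^ t <= (1 + s) ^ n0).
  { unfold n0. rewrite Nat.mul_comm, pow_mult. apply pow_incr. split.
    - apply Rlt_le, Rinv_0_lt_compat. nra.
    - pose proof (poly n2 s Hs).
      apply (Rmult_le_compat_r s) in Hn1; [| lra].
      replace (/ (16 * (A * INR t)) * s) with (/ (16 * INR t * s)) in Hn1 by (rewrite <- HsA; field; lra). lra. }
  assert (E1 : A * (b * b * b) = s ^ (2 * (3 * T + 1))).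
  { rewrite pow_mult. replace (s ^ 2) with A by (simpl; lra). unfold b.
    rewrite pow_add, pow_mult. simpl.
    replace (A * (A * (A * 1))) with (A ^ 3) by ring.
    rewrite <- pow_mult. replace (3 * T)%nat with (T + T + T)%nat by lia. rewrite !pow_add. ring. }
  rewrite E1.
  assert (E2 : s ^ (2 * (3 * T + 1)) * (/ (16 * INR t * s)) ^ t = / (Q * s)).
  { assert (Et : s ^ t = s ^ (2 * (3 * T + 1)) * s) by (unfold t; rewrite pow_add, pow_1; ring).
    unfold Q. rewrite pow_inv, Rpow_mult_distr, Et. field. repeat split; try lra; apply pow_nonzero; lra. }
  apply Rlt_le_trans with (/ (Q * s)).
  - assert (HQs : 0 < Q * s) by (apply Rmult_lt_0_compat; lra).
    apply Rmult_lt_reg_r with (Q * s); trivial. rewrite Rinv_l; lra.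
  - rewrite <- E2. apply Rmult_le_compat_l; trivial. now apply Rlt_le, pow_lt. }
assert (HG0 : 0 < G 0) by apply (rotates_pos f G B al Hcm Hrot (proj1 Hal)).
set (L := (1 + s) ^ n0) in *.
assert (HL : 0 < L) by (apply pow_lt; lra).
assert (Hbbb : 0 < A * (b * b * b)) by (repeat apply Rmult_lt_0_compat; trivial).
assert (Hdsmall : G 0 * 1040 < A * (b * b * b)).
{ apply Rmult_lt_reg_r with L; trivial. nra. }
assert (Hdsg : G 0 <= b / 16).
{ assert (b * b * b <= b) by nra.
  assert (A * (b * b * b) <= 1 * (b * b * b)) by (apply Rmult_le_compat_r; nra). lra. }
assert (Hbar := slow_circle_barrier P f G B well v al A b (b / 16) (b / 8) xi z Hcm Hrot
  ltac:(lra) Hf).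
assert (HPnn : forall x, 0 <= P x).
{ intros x. unfold P. pose proof (well_nonneg x). pose proof (Hv0 x). nra. }
assert (HP0 : P 0 = 0) by (unfold P, v, bump; rewrite Hw0; ring).
assert (HP1 : P 1 = 0) by (unfold P, v, bump; rewrite Hw1; ring).
specialize (Hbar HPnn HP0 HP1 Hf0 (fun x => eq_refl) Hv0 ltac:(lra) Hz Hdsg ltac:(lra) ltac:(lra)).
destruct Hz as [Hz1 [Hz2 Hz3]].
assert (Hact : action (fun x => A * well x) 0 z <= 1).
{ specialize (Hz3 nil). simpl action in Hz3 at 2. assert (ascending 0 nil) by (simpl; lra).
  specialize (Hz3 H ltac:(intros y [])). lra. }
(* Every point costs at least A (b/16)^2, and the total action is below 1 by comparison with the
   empty chain. *)
assert (Hlen : INR (length z) * (A * (b / 16) ^ 2) <= 1).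
{ eapply Rle_trans; [| exact Hact]. apply away_length with (b / 16); trivial.
  intros y Hy. apply Rmult_le_compat_l; [lra |]. apply well_ge; lra. }
assert (Hsum : sum_over v z <= 1 / 4).
{ assert (HsumA : sum_over v z * 4 <= sum_over (fun x => A * well x) z).
  { clear Hact Hlen Hbar Hz3.
    assert (Hrange : forall y, In y z -> 0 <= y <= 1) by (intros y Hy; specialize (Hz2 y Hy); lra).
    clear Hz1 Hz2.
    induction z as [|y z IH]; simpl; [lra |].
    specialize (IH (fun y Hy => Hgap y (or_intror Hy)) (fun y Hy => Hrange y (or_intror Hy))).
    assert (Hy : v y * 4 <= A * well y).
    { unfold v, bump.
      pose proof (Hgap y (or_introl eq_refl)). pose proof (Hrange y (or_introl eq_refl)).
      assert (Rabs (y - xi) <= 3 / 4) by (apply Rabs_le; lra).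
      pose proof (kernel_le M A xi y ltac:(lra) (conj H H1)) as K.
      set (w := ((1 + cos (2 * PI * (y - xi))) / 2) ^ M) in *.
      assert (Hw : 0 <= w).
      { apply pow_le. pose proof (COS_bound (2 * PI * (y - xi))). lra. }
      assert (HMA : 128 <= INR M * A ^ 3).
      { apply (Rmult_le_compat_r (A ^ 3)) in HM1; [| lra]. unfold Rdiv in HM1. rewrite Rmult_assoc, Rinv_l in HM1; lra. }
      assert (w * 128 <= A * 32).
      { apply Rle_trans with (w * (INR M * A ^ 3)); [now apply Rmult_le_compat_l |].
        replace (w * (INR M * A ^ 3)) with (A * (w * (INR M * A ^ 2))) by ring. apply Rmult_le_compat_l; lra. }
      pose proof (well_nonneg y). nra. }
    lra. }
  pose proof (sum_over_le_action (fun x => A * well x) z 0). lra. }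
assert (Hvxi : 1 <= v xi).
{ unfold v, bump. rewrite Rminus_diag, Rmult_0_r, cos_0.
  replace ((1 + 1) / 2) with 1 by field. rewrite pow1, Rmult_1_r. apply well_middle. lra. }
(* The final count: b on the left, against b/4 from 2 sg + tau, b/4 from the bump on the chain,
   (256/1040) b from the bonds and b/16 from the extra bond. *)
rewrite S_INR in Hbar.
assert (B1 : b <= b * v xi) by nra.
assert (B2 : b * sum_over v z <= b / 4) by nra.
assert (B3 : INR (length z) * G 0 * 1040 <= 256 * b).
{ apply Rle_trans with (INR (length z) * (A * (b * b * b))).
  - rewrite Rmult_assoc. apply Rmult_le_compat_l; [apply pos_INR | lra].
  - simpl in Hlen. nra. }
lra.
Qed.

(** * Reduction of the frequency and choice of the perturbation *)

(** As a real function [c] is continuous, and two distinct integer values would force a half-integer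
    value in between. *)
Lemma locally_constant (c : R -> Z) :
  (forall s, exists d, 0 < d /\ forall t, Rabs (t - s) < d -> c t = c s) -> forall s t, c s = c t.
Proof.
intros Hloc.
assert (Hc : forall x, continuity_pt (fun s => IZR (c s)) x).
{ intros s. destruct (Hloc s) as [d [Hd H]].
  apply continuity_pt_locally_ext with (f := fun _ => IZR (c s)) (a := d); trivial.
  - intros t Ht. now rewrite (H t Ht).
  - apply continuity_pt_const. intros u v; reflexivity. }
assert (W : forall s t, (c s < c t)%Z -> False).
{ intros s t Hlt. apply Zlt_le_succ, IZR_le in Hlt. rewrite succ_IZR in Hlt.
  destruct (IVT_gen _ s t (IZR (c s) + / 2) Hc) as [x [_ Ex]].
  - split; [eapply Rle_trans; [apply Rmin_l | lra] | eapply Rle_trans; [| apply Rmax_r]; lra].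
  - assert (E : (2 * c x)%Z = (2 * c s + 1)%Z).
    { apply eq_IZR. rewrite plus_IZR, !mult_IZR. lra. }
    lia. }
intros s t. destruct (Z.lt_trichotomy (c s) (c t)) as [H | [H | H]]; trivial; destruct (W _ _ H).
Qed.

(* Only finitely many translates of the curve by integers are distinct, and they are disjoint, so by
   connectedness the image of the curve lies on a single one of them. *)
Lemma invariant_curve_icurve k X Y (f : R -> R) : curve k X Y -> continuity f ->
  (forall s t (m : Z), X s = X t + IZR m -> Y s = Y t -> exists n : Z, s = t + IZR n) ->
  (forall s, exists t (m : Z), X s + Y s = X t + IZR m /\ Y s + f (X s + Y s) = Y t) ->
  exists j g, icurve f j g k X Y.
Proof.
intros H Cf Hsep Himg.
pose proof (curve_kge1 _ _ _ H) as Hk.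
assert (Hk0 : (0 < Z.of_nat k)%Z) by (pose proof (curve_pos _ _ _ H); lia).
(* A whole parameter period changes [X] by [k], so the translate can be reduced modulo [k]. *)
assert (Hex : forall s, exists tm : R * Z, X s + Y s = X (fst tm) + IZR (snd tm) /\
  Y s + f (X s + Y s) = Y (fst tm) /\ (0 <= snd tm < Z.of_nat k)%Z).
{ intros s. destruct (Himg s) as [t [m [E1 E2]]].
  exists (t + IZR (m / Z.of_nat k)%Z, (m mod Z.of_nat k)%Z). simpl.
  rewrite (shift_periodic X (INR k)) by apply H.
  rewrite (shift_periodic Y 0) by (intro; rewrite (curve_perY _ _ _ H); ring).
  split; [| split; [rewrite E2; ring | apply Z.mod_pos_bound; lia]].
  rewrite E1. rewrite (Z.div_mod m (Z.of_nat k)) at 1 by lia.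
  rewrite plus_IZR, mult_IZR, <- INR_IZR_INZ. ring. }
pose (c := fun s => proj1_sig (constructive_indefinite_description _ (Hex s))).
assert (Hc : forall s, X s + Y s = X (fst (c s)) + IZR (snd (c s)) /\
  Y s + f (X s + Y s) = Y (fst (c s)) /\ (0 <= snd (c s) < Z.of_nat k)%Z).
{ intros s. exact (proj2_sig (constructive_indefinite_description _ (Hex s))). }
clearbody c.
assert (CA : continuity (fun s => X s + Y s)) by (intros s; apply continuity_pt_plus; apply H).
assert (CB : continuity (fun s => Y s + f (X s + Y s))).
{ intros s. apply continuity_pt_plus; [apply H |].
  apply (continuity_pt_comp (fun s => X s + Y s) f); [apply CA | apply Cf]. }
assert (Hloc : forall s, exists d, 0 < d /\ forall t, Rabs (t - s) < d -> snd (c t) = snd (c s)).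
{ intros s. destruct (Hc s) as [E1 [E2 E3]].
  set (py := Y s + f (X s + Y s)) in *. set (px := X s + Y s) in E1 |- *.
  assert (Hsepn : forall n : nat, exists rho, 0 < rho /\ forall m : Z, (0 <= m < Z.of_nat n)%Z ->
    (m < Z.of_nat k)%Z -> m <> snd (c s) -> forall t, rho <= Rabs (X t - (px - IZR m)) + Rabs (Y t - py)).
  { induction n as [|n [rho [Hrho IH]]].
    - exists 1. split; [lra |]. intros m Hm. lia.
    - destruct (classic (Z.of_nat n < Z.of_nat k /\ Z.of_nat n <> snd (c s))%Z) as [[Hn1 Hn2] | Hno].
      + destruct (curve_dist k X Y (px - IZR (Z.of_nat n)) py H) as [rho' [Hrho' Hd]].
        { intros t Et1 Et2. destruct (Hsep t (fst (c s)) (snd (c s) - Z.of_nat n)%Z) as [i Hi].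
          - rewrite minus_IZR. lra.
          - lra.
          - rewrite Hi in Et1. rewrite (shift_periodic X (INR k)) in Et1 by apply H.
            assert (Ei : (snd (c s) - Z.of_nat n = Z.of_nat k * i)%Z).
            { apply eq_IZR. rewrite minus_IZR, mult_IZR, <- (INR_IZR_INZ k). lra. }
            assert (i = 0)%Z by nia. subst i. lia. }
        exists (Rmin rho rho'). split; [now apply Rmin_pos |].
        intros m Hm1 Hm2 Hm3 t. destruct (Z.eq_dec m (Z.of_nat n)) as [-> | Hne].
        * eapply Rle_trans; [apply Rmin_r | apply Hd].
        * eapply Rle_trans; [apply Rmin_l |]. apply IH; trivial. lia.
      + exists rho. split; trivial. intros m Hm1 Hm2 Hm3. apply IH; trivial.
        destruct (Z.eq_dec m (Z.of_nat n)) as [-> | Hne]; [| lia]. exfalso. now apply Hno. }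
  destruct (Hsepn k) as [rho [Hrho Hd]].
  destruct (CA s (rho / 2) ltac:(lra)) as [d1 [Hd1 HA]].
  destruct (CB s (rho / 2) ltac:(lra)) as [d2 [Hd2 HB]].
  exists (Rmin d1 d2). split; [now apply Rmin_pos |].
  intros t Ht. apply NNPP. intros Hne.
  destruct (Req_dec s t) as [-> | Hst]; [now apply Hne |].
  simpl in HA, HB. unfold Rdist in HA, HB.
  specialize (HA t (conj (conj I Hst) (Rlt_le_trans _ _ _ Ht (Rmin_l _ _)))).
  specialize (HB t (conj (conj I Hst) (Rlt_le_trans _ _ _ Ht (Rmin_r _ _)))).
  destruct (Hc t) as [F1 [F2 F3]].
  specialize (Hd (snd (c t)) F3 (proj2 F3) Hne (fst (c t))).
  replace (X (fst (c t)) - (px - IZR (snd (c t)))) with (X t + Y t - px) in Hd by lra.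
  rewrite <- F2 in Hd. unfold px, py in Hd. lra. }
exists (snd (c 0)), (fun s => fst (c s)).
pose proof (locally_constant (fun s => snd (c s)) Hloc) as Hconst. cbv beta in Hconst.
constructor; trivial.
- apply (param_continuous k X Y (fun s => X s + Y s - IZR (snd (c 0))) (fun s => Y s + f (X s + Y s))); trivial.
  + now apply continuity_minus_cst.
  + intros s. destruct (Hc s) as [E1 _]. rewrite (Hconst 0 s). lra.
  + intros s. apply Hc.
- intros s. rewrite (Hconst 0 s). apply Hc.
- intros s. apply Hc.
Qed.

(** The sign [e] reverses the parameter when the degree is negative, so that the winding number
    becomes positive. *)
Lemma circle_icurve (G : R -> R * R) (F : R * R -> R * R -> Prop) (f : R -> R) :
  noncontractible_simple_closed_curve G -> invariant_curve F G -> continuity f ->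
  (forall p, F p (fst p + snd p, snd p + f (fst p + snd p))) ->
  exists k j g X Y, icurve f j g k X Y /\ forall s, lifted_set G (X s, Y s).
Proof.
intros [Hcont [[k0 [Hk0 Hper]] Hinj]] [Hinv _] Cf HF.
assert (Hor : exists (e : R) (k : nat), (e = 1 \/ e = -1) /\ (0 < k)%nat /\ IZR k0 = e * INR k).
{ destruct (Z_lt_dec 0 k0) as [L | L].
  - exists 1, (Z.to_nat k0). repeat split; [now left | lia |]. rewrite INR_IZR_INZ, Z2Nat.id by lia. ring.
  - exists (-1), (Z.to_nat (- k0)). repeat split; [now right | lia |].
    rewrite INR_IZR_INZ, Z2Nat.id, opp_IZR by lia. ring. }
destruct Hor as [e [k [He [Hk Ek]]]].
assert (Hee : e * e = 1) by (destruct He as [-> | ->]; ring).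
assert (PX : forall s, fst (G (s + 1)) = fst (G s) + IZR k0) by (intros s; now rewrite Hper).
assert (PY : forall s, snd (G (s + 1)) = snd (G s)) by (intros s; now rewrite Hper).
set (X := fun s => fst (G (e * s))). set (Y := fun s => snd (G (e * s))).
assert (Hcomp : forall u : R -> R, (forall t, continuous u t) -> continuity (fun s => u (e * s))).
{ intros u Hu s. apply (continuity_pt_comp (fun s => e * s) u).
  - apply continuity_pt_mult; [apply continuity_pt_const; intros x y; reflexivity | apply continuity_pt_id].
  - apply continuity_pt_filterlim, Hu. }
assert (Hpt : forall s t (m : Z), X s = X t + IZR m -> Y s = Y t -> exists n : Z, s = t + IZR n).
{ intros s t m E1 E2. destruct (Hinj (e * s) (e * t)) as [n Hn].
  - exists m. rewrite (surjective_pairing (G (e * s))). f_equal; assumption.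
  - destruct He as [-> | ->]; [exists n | exists (- n)%Z; rewrite opp_IZR]; lra. }
assert (HXper : forall s, X (s + 1) = X s + INR k).
{ intros s. unfold X. destruct He as [-> | ->].
  - rewrite !Rmult_1_l, PX, Ek. ring.
  - replace (-1 * s) with (-1 * (s + 1) + 1) by ring. rewrite PX, Ek. ring. }
assert (HYper : forall s, Y (s + 1) = Y s).
{ intros s. unfold Y. destruct He as [-> | ->].
  - rewrite !Rmult_1_l. apply PY.
  - replace (-1 * s) with (-1 * (s + 1) + 1) by ring. now rewrite PY. }
assert (Hcurve : curve k X Y).
{ constructor; trivial.
  - apply (Hcomp (fun s => fst (G s))). intros t. apply (Hcont t).
  - apply (Hcomp (fun s => snd (G s))). intros t. apply (Hcont t).
  - intros s t E1 E2. destruct (Hpt s t 0%Z) as [n Hn]; [simpl; lra | trivial |].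
    rewrite Hn, (shift_periodic X (INR k)) in E1 by trivial.
    assert (1 <= INR k) by (apply (le_INR 1); lia).
    assert (IZR n = 0) by nra. lra. }
assert (Hlift : forall s, lifted_set G (X s, Y s)).
{ intros s. exists (e * s), 0%Z. unfold X, Y. f_equal. simpl. ring. }
destruct (invariant_curve_icurve k X Y f Hcurve Cf Hpt) as [j [g Hic]].
{ intros s. destruct (Hinv _ _ (Hlift s) (HF _)) as [t [m E]]. simpl in E. injection E as E1 E2.
  assert (Et : e * (e * t) = t) by (rewrite <- Rmult_assoc, Hee; ring).
  exists (e * t), m. replace (X (e * t)) with (fst (G t)) by (unfold X; now rewrite Et).
  replace (Y (e * t)) with (snd (G t)) by (unfold Y; now rewrite Et). now split. }
now exists k, j, g, X, Y.
Qed.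

(** In the coordinates (q x, q y - p) the curve winds [q * k] times around the new unit circle; the
    subtracted [p] moves into the translate, where the periodic force does not see it. *)
Lemma icurve_rescale (f : R -> R) (q : nat) (p j : Z) g k X Y : (0 < q)%nat -> continuity f ->
  (forall x, f (x + 1) = f x) ->
  icurve (fun x => f (INR q * x) / INR q) j g k X Y ->
  icurve f (Z.of_nat q * j - p) g (q * k) (fun s => INR q * X s) (fun s => INR q * Y s - IZR p).
Proof.
intros Hq Cf Hper [[H1 H2 H3 H4 H5 H6] _ Cg EX EY].
assert (Hq' : 0 < INR q) by now apply lt_0_INR.
assert (Cmul : forall u : R -> R, continuity u -> continuity (fun s => INR q * u s)).
{ intros u Cu s. apply continuity_pt_mult; [apply continuity_pt_const; intros x y; reflexivity | apply Cu]. }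
constructor; trivial.
- constructor.
  + lia.
  + now apply Cmul.
  + apply continuity_minus_cst. now apply Cmul.
  + intros s. rewrite H4, mult_INR. ring.
  + intros s. now rewrite H5.
  + intros s t E1 E2. apply H6.
    * apply Rmult_eq_reg_l with (INR q); lra.
    * apply Rmult_eq_reg_l with (INR q); lra.
- intros s. rewrite minus_IZR, mult_IZR, <- INR_IZR_INZ.
  pose proof (EX s) as E. replace (X s) with (X (g s) + IZR j - Y s) by lra. ring.
- intros s. replace (INR q * X s + (INR q * Y s - IZR p)) with (INR q * (X s + Y s) + IZR (- p)) by (rewrite opp_IZR; ring).
  rewrite (shift_periodic f 0) by (intro; rewrite Hper; ring).
  rewrite <- EY. field. lra.
Qed.

(** An orbit of [G] is carried back to an orbit of [F] on the circle, whose frequency is known. The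
    summand n p in [z] restores the drift that the subtraction of [p] removed from each step. *)
Lemma rescaled_rotation (F : R * R -> R * R -> Prop) (C : R -> R * R) (f G B : R -> R) (w : R)
  (q : nat) (p : Z) (X Y : R -> R) :
  (0 < q)%nat -> circle_map f G B -> (forall x, f (x + 1) = f x) ->
  (forall z, F z (fst z + snd z, snd z + f (INR q * (fst z + snd z)) / INR q)) ->
  (forall s, lifted_set C (X s, Y s)) ->
  (forall x, exists s (m : Z), INR q * X s + IZR m = x /\ INR q * Y s - IZR p = G x - x) ->
  has_frequency F C w -> rotates G (INR q * w - IZR p).
Proof.
intros Hq Hcm Hper HF Hlift Hgraph Hfreq x.
assert (Hq' : 0 < INR q) by now apply lt_0_INR.
destruct (Hgraph x) as [s [m [E1 E2]]].
set (xs := fun n => Nat.iter n G x).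
set (z := fun n : nat => ((xs n - IZR m + INR n * IZR p) / INR q, (G (xs n) - xs n + IZR p) / INR q)).
assert (Hz0 : lifted_set C (z 0%nat)).
{ replace (z 0%nat) with (X s, Y s); [apply Hlift |].
  unfold z, xs. simpl. f_equal; apply Rmult_eq_reg_l with (INR q); try lra; field_simplify; lra. }
assert (Hzs : forall n, F (z n) (z (S n))).
{ intros n. pose proof (HF (z n)) as T.
  assert (Es : fst (z n) + snd (z n) = fst (z (S n))).
  { unfold z. cbn [fst snd]. rewrite S_INR. unfold xs. simpl. field. lra. }
  rewrite Es in T.
  replace (z (S n)) with (fst (z (S n)), snd (z n) + f (INR q * fst (z (S n))) / INR q); trivial.
  rewrite (surjective_pairing (z (S n))) at 3. f_equal.
  replace (f (INR q * fst (z (S n)))) with (f (xs (S n))).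
  - unfold z. cbn [snd]. change (G (xs n)) with (xs (S n)).
    pose proof (cm_eq _ _ _ Hcm (xs (S n))) as E. unfold xs in E at 2. simpl in E. rewrite (cm_BG _ _ _ Hcm) in E.
    fold (xs n) in E. replace (f (xs (S n))) with (G (xs (S n)) + xs n - 2 * xs (S n)) by (unfold xs; simpl; unfold xs in E; lra).
    field. lra.
  - unfold z. cbn [fst].
    replace (INR q * ((xs (S n) - IZR m + INR (S n) * IZR p) / INR q)) with
      (xs (S n) + IZR (Z.of_nat (S n) * p - m)).
    + now rewrite (shift_periodic f 0) by (intro; rewrite Hper; ring); rewrite Rmult_0_l, Rplus_0_r.
    + rewrite minus_IZR, mult_IZR, <- INR_IZR_INZ. field. lra. }
pose proof (Hfreq z Hz0 Hzs) as Hlim.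
apply is_lim_seq_ext_loc with (fun n => INR q * (fst (z n) / INR n) + (IZR m / INR n - IZR p)).
- exists 1%nat. intros n Hn. unfold z, xs. cbn [fst].
  assert (0 < INR n) by (apply lt_0_INR; lia). field. lra.
- replace (Finite (INR q * w - IZR p)) with (Finite (INR q * w + (0 - IZR p))) by (f_equal; ring).
  apply is_lim_seq_plus'.
  + apply (is_lim_seq_scal_l _ (INR q) w), Hlim.
  + apply is_lim_seq_minus'; [apply inv_n_lim | apply is_lim_seq_const].
Qed.

Lemma gen_map_step (V dV : R -> R) : (forall x, is_derive V x (dV x)) ->
  forall z, gen_map (fun x x' => h0 x x' + V x') z (fst z + snd z, snd z + dV (fst z + snd z)).
Proof.
intros HV [x y]. unfold gen_map, h0. cbn [fst snd]. split.
- rewrite (is_derive_unique _ _ (x - (x + y))); [ring |].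
  auto_derive; trivial. lra.
- symmetry. apply is_derive_unique.
  apply (is_derive_ext (fun s => (x - s) ^ 2 / 2 + V s)); [reflexivity |].
  evar_last.
  + apply (is_derive_plus (fun s => (x - s) ^ 2 / 2) V); [| apply HV].
    instantiate (1 := x + y - x). auto_derive; trivial. lra.
  + unfold plus; simpl. ring.
Qed.

Lemma trigonometric_ex_derive_n N W g : trigonometric N W g -> forall j x, ex_derive_n g j x.
Proof.
intros H [|j] x; simpl; trivial.
destruct (trigonometric_derive _ _ _ (trigonometric_Derive_n _ _ _ j H)) as [g' [D _]].
eexists. apply D.
Qed.

Lemma Derive_n_plus_bound N N' W W' g h (j : nat) x :
  trigonometric N W g -> trigonometric N' W' h ->
  Rabs (Derive_n (fun x => g x + h x) j x) <= (2 * PI * INR N) ^ j * W + (2 * PI * INR N') ^ j * W'.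
Proof.
intros Hg Hh. rewrite Derive_n_plus.
- eapply Rle_trans; [apply Rabs_triang |]. apply Rplus_le_compat.
  + apply (trigonometric_bound _ _ _ (trigonometric_Derive_n _ _ _ j Hg)).
  + apply (trigonometric_bound _ _ _ (trigonometric_Derive_n _ _ _ j Hh)).
- apply filter_forall. intros y k _. apply (trigonometric_ex_derive_n _ _ _ Hg).
- apply filter_forall. intros y k _. apply (trigonometric_ex_derive_n _ _ _ Hh).
Qed.

Lemma Rpower_small (d e : R) : 0 < d -> 0 < e -> exists Q : nat, forall q : nat, (Q < q)%nat -> Rpower (INR q) (- d) < e.
Proof.
intros Hd He. destruct (nat_above (exp (- ln e / d))) as [Q [HQ0 HQ]].
exists Q. intros q Hq. apply lt_INR in Hq. unfold Rpower.
apply Rlt_le_trans with (exp (ln e)); [apply exp_increasing | right; now apply exp_ln].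
assert (H : - ln e / d < ln (INR q)).
{ rewrite <- (ln_exp (- ln e / d)). apply ln_increasing; [apply exp_pos | lra]. }
apply Rlt_div_l in H; trivial. lra.
Qed.

(* The degree-one part of the rescaled perturbation, of size [q^(j-3-mu)], is what fixes the exponent [3 + mu]. *)
Lemma perturbation_small (mu r eps A b : R) (q M T J j : nat) :
  (0 < q)%nat -> A = Rpower (INR q) (-1 - mu) -> 0 < A -> A * INR q <= 1 -> A <= 1 ->
  INR (S M) <= 130 / A ^ 3 ->
  INR j <= r -> (j <= J)%nat -> T = (4 * J + 8)%nat -> b = A ^ T ->
  2 * (2 * PI) ^ J * Rpower (INR q) (r - 3 - mu) <= eps / 4 ->
  2 * (260 * PI) ^ J * A <= eps / 4 ->
  (2 * PI * INR (q * 1)) ^ j * (Rabs (A / INR q ^ 2) * 2) +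
  (2 * PI * INR (q * S M)) ^ j * (Rabs (b / INR q ^ 2) * 2) <= eps / 2.
Proof.
intros Hq HA HA0 HAq HA1 HM Hj HjJ HT Hb He1 He2.
assert (Hq1 : 1 <= INR q) by (apply (le_INR 1); lia).
assert (Hpi : 3 < PI) by (pose proof PI2_3_2; lra).
assert (Hq2 : 1 <= INR q ^ 2) by (simpl; nra).
assert (Hb0 : 0 < b) by (rewrite Hb; now apply pow_lt).
assert (Q1 : (2 * PI * INR (q * 1)) ^ j * (Rabs (A / INR q ^ 2) * 2) <= eps / 4).
{ rewrite Nat.mul_1_r, Rabs_right by (apply Rle_ge, Rlt_le, Rdiv_lt_0_compat; lra).
  eapply Rle_trans; [| exact He1].
  rewrite Rpow_mult_distr.
  assert (P1 : (2 * PI) ^ j <= (2 * PI) ^ J) by (apply Rle_pow; [lra | trivial]).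
  assert (P2 : INR q ^ j * (A / INR q ^ 2) <= Rpower (INR q) (r - 3 - mu)).
  { rewrite HA, <- !Rpower_pow by lra. unfold Rdiv. rewrite <- Rpower_Ropp, <- !Rpower_plus.
    apply Rle_Rpower; [trivial |]. simpl (INR 2). lra. }
  assert (0 <= (2 * PI) ^ j) by (apply pow_le; lra).
  assert (0 <= INR q ^ j * (A / INR q ^ 2)).
  { apply Rmult_le_pos; [apply pow_le; lra | apply Rlt_le, Rdiv_lt_0_compat; lra]. }
  replace ((2 * PI) ^ j * INR q ^ j * (A / INR q ^ 2 * 2)) with (2 * ((2 * PI) ^ j * (INR q ^ j * (A / INR q ^ 2)))) by ring.
  rewrite Rmult_assoc. apply Rmult_le_compat_l; [lra |]. apply Rmult_le_compat; trivial. }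
assert (Q2 : (2 * PI * INR (q * S M)) ^ j * (Rabs (b / INR q ^ 2) * 2) <= eps / 4).
{ rewrite Rabs_right by (apply Rle_ge, Rlt_le, Rdiv_lt_0_compat; lra).
  eapply Rle_trans; [| exact He2].
  assert (P0 : b / INR q ^ 2 <= b).
  { apply Rle_div_l; [lra |]. nra. }
  assert (HA4 : 0 < A ^ 4) by now apply pow_lt.
  assert (HA4' : A ^ 4 <= 1) by (rewrite <- (pow1 4); apply pow_incr; lra).
  assert (HA3 : 0 < A ^ 3) by now apply pow_lt.
  (* Since q <= 1/A and M + 1 <= 130/A^3, each derivative costs at most 260 PI/A^4; J of them use up
     4 J of the T powers of A. *)
  assert (P1 : 2 * PI * INR (q * S M) <= 260 * PI / A ^ 4).
  { rewrite mult_INR. apply (proj1 (Rle_div_r _ _ _ HA4)).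
    assert (HM' : INR (S M) * A ^ 3 <= 130) by (apply Rle_div_r in HM; trivial).
    replace (2 * PI * (INR q * INR (S M)) * A ^ 4) with (2 * PI * ((A * INR q) * (INR (S M) * A ^ 3))) by ring.
    replace (260 * PI) with (2 * PI * (1 * 130)) by ring.
    apply Rmult_le_compat_l; [lra |]. apply Rmult_le_compat; trivial.
    - nra.
    - apply Rmult_le_pos; [apply pos_INR | lra]. }
  assert (P2 : (2 * PI * INR (q * S M)) ^ j <= (260 * PI / A ^ 4) ^ J).
  { apply Rle_trans with ((260 * PI / A ^ 4) ^ j).
    - apply pow_incr. split; trivial. apply Rmult_le_pos; [lra | apply pos_INR].
    - apply Rle_pow; trivial. apply Rle_div_r; lra. }
  assert (P3 : (260 * PI / A ^ 4) ^ J * b <= (260 * PI) ^ J * A).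
  { unfold Rdiv. rewrite Rpow_mult_distr, pow_inv, Rmult_assoc.
    apply Rmult_le_compat_l; [apply pow_le; lra |].
    rewrite Hb, HT, pow_add, pow_mult.
    rewrite <- Rmult_assoc, Rinv_l, Rmult_1_l by (apply pow_nonzero; lra).
    replace (A ^ 8) with (A ^ 7 * A) by ring. apply Rle_trans with (1 * A); [| lra].
    apply Rmult_le_compat_r; [lra |]. rewrite <- (pow1 7). apply pow_incr. lra. }
  assert (0 <= (2 * PI * INR (q * S M)) ^ j).
  { apply pow_le. apply Rmult_le_pos; [lra | apply pos_INR]. }
  apply Rle_trans with ((260 * PI / A ^ 4) ^ J * (b * 2)); [| lra].
  apply Rmult_le_compat; trivial; [| lra].
  assert (0 < b / INR q ^ 2) by (apply Rdiv_lt_0_compat; lra). lra. }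
lra.
Qed.

Theorem theorem1p1 :
  forall (mu omega : R), 0 <= mu -> well_approximable mu omega ->
  forall (r eps : R), 0 <= r < 3 + mu -> 0 < eps ->
  exists (N : nat) (a b : nat -> R),
    Rbar_lt (Cr_norm r (trig_poly N a b)) (Finite eps) /\
    ~ invariant_circle_with_frequency
        (gen_map (fun x x' => h0 x x' + trig_poly N a b x')) omega.
Proof.
intros mu omega Hmu [Hirr Happ] r eps Hr Heps.
destruct (nat_above r) as [J [_ HJ]].
set (T := (4 * J + 8)%nat).
destruct (slow_circle_destroyed T ltac:(unfold T; lia)) as [A0 [HA0 Hdestroy]].
pose proof PI_RGT_0 as Hpi.
assert (HC1 : 0 < (2 * PI) ^ J) by (apply pow_lt; lra).
assert (HC2 : 0 < (260 * PI) ^ J) by (apply pow_lt; lra).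
destruct (Rpower_small (3 + mu - r) (eps / (8 * (2 * PI) ^ J))) as [Q1 HQ1]; [lra | apply Rdiv_lt_0_compat; lra |].
(* A large [q] forces A below all three bounds: the threshold for destruction, 1, and the size
   allowed for the second term. *)
set (A1 := Rmin (Rmin A0 1) (eps / (8 * (260 * PI) ^ J))).
assert (HA1 : 0 < A1).
{ repeat apply Rmin_pos; try lra. apply Rdiv_lt_0_compat; lra. }
destruct (nat_above (/ A1)) as [Q2 [_ HQ2]].
destruct (Happ (Q1 + Q2 + 1)%nat) as [q [Hq [p Hpq]]].
assert (Hq0 : (0 < q)%nat) by lia.
assert (Hq1 : 1 <= INR q) by (apply (le_INR 1); lia).
set (A := Rpower (INR q) (-1 - mu)) in *.
assert (HA : 0 < A) by (unfold A, Rpower; apply exp_pos).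
assert (HAq : A * INR q <= 1).
{ unfold A. rewrite <- (Rpower_1 (INR q)) at 2 by lra. rewrite <- Rpower_plus.
  apply Rle_trans with (Rpower (INR q) 0); [apply Rle_Rpower; lra | rewrite Rpower_O; lra]. }
assert (HAA1 : A <= A1).
{ apply Rmult_le_reg_r with (INR q); [lra |]. eapply Rle_trans; [exact HAq |].
  rewrite <- (Rinv_r A1) by lra. apply Rmult_le_compat_l; [lra |].
  assert (INR Q2 <= INR q) by (apply le_INR; lia). lra. }
pose proof (Rmin_l (Rmin A0 1) (eps / (8 * (260 * PI) ^ J))) as M1.
pose proof (Rmin_r (Rmin A0 1) (eps / (8 * (260 * PI) ^ J))) as M2. fold A1 in M1, M2.
pose proof (Rmin_l A0 1) as M3. pose proof (Rmin_r A0 1) as M4.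
destruct (Hdestroy A ltac:(split; lra)) as [M [xi [HM Hno]]].
set (b := A ^ T) in *.
set (P := fun x => A * well x + b * bump M xi x).
(* Division by q^2 makes the kick f (q x)/q, which becomes exactly [f] once momenta are scaled by
   q. *)
set (R1 := fun x => A / INR q ^ 2 * well (INR q * x)).
set (R2 := fun x => b / INR q ^ 2 * bump M xi (INR q * x)).
assert (TR1 : trigonometric (q * 1) (Rabs (A / INR q ^ 2) * 2) R1)
  by apply (trigonometric_rescale _ _ _ _ _ trigonometric_well).
assert (TR2 : trigonometric (q * S M) (Rabs (b / INR q ^ 2) * 2) R2)
  by apply (trigonometric_rescale _ _ _ _ _ (trigonometric_bump M xi)).
assert (TR : trigonometric (q * S M) (Rabs (A / INR q ^ 2) * 2 + Rabs (b / INR q ^ 2) * 2) (fun x => R1 x + R2 x)).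
{ apply trigonometric_plus; trivial. apply (trigonometric_weaken (q * 1)) with (2 := Rle_refl _); [nia | trivial]. }
destruct (trigonometric_trig_poly _ _ _ TR) as [ca [cb Etp]].
exists (q * S M)%nat, ca, cb. split.
(* Half of [eps] leaves the room that a strict bound on the supremum requires. *)
- apply Rbar_le_lt_trans with (Finite (eps / 2)); [| simpl; lra].
  unfold Cr_norm. apply (proj2 (Lub_Rbar_correct _)).
  intros v [j [x [Hj ->]]]. simpl.
  rewrite (Derive_n_ext _ _ j x Etp).
  eapply Rle_trans; [apply (Derive_n_plus_bound _ _ _ _ _ _ _ _ TR1 TR2) |].
  apply (perturbation_small mu r eps A b q M T J j); trivial; try lra.
  + apply INR_le. lra.
  + specialize (HQ1 q ltac:(lia)). apply Rlt_div_r in HQ1; [| lra].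
    replace (r - 3 - mu) with (- (3 + mu - r)) by ring. lra.
  + assert (HAe : A <= eps / (8 * (260 * PI) ^ J)) by lra.
    apply Rle_div_r in HAe; lra.
- intros [C [HC1' [HC2' Hfreq]]].
  assert (TP : trigonometric (S M) (Rabs A * 2 + Rabs b * 2) P).
  { apply trigonometric_plus; apply trigonometric_scal.
    - apply (trigonometric_weaken 1) with (2 := Rle_refl _); [lia | apply trigonometric_well].
    - apply trigonometric_bump. }
  destruct (trigonometric_derive _ _ _ TP) as [f [Df Tf]].
  assert (Pf := trigonometric_periodic _ _ _ Tf).
  assert (Lf := trigonometric_lipschitz _ _ _ Tf).
  set (L := 2 * PI * INR (S M) * (2 * PI * INR (S M) * (Rabs A * 2 + Rabs b * 2))) in *.
  assert (HL : 0 <= L).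
  { specialize (Lf 1 0). rewrite Rminus_0_r, Rabs_R1, Rmult_1_r in Lf.
    pose proof (Rabs_pos (f 1 - f 0)). lra. }
  assert (Cf : continuity f).
  { intros x. destruct (trigonometric_derive _ _ _ Tf) as [f' [Df' _]].
    apply continuity_pt_filterlim. apply (ex_derive_continuous f). eexists. apply Df'. }
  assert (Hq' : 0 < INR q) by lra.
  assert (DV : forall x, is_derive (trig_poly (q * S M) ca cb) x (f (INR q * x) / INR q)).
  { assert (EV : forall t, / INR q ^ 2 * P (INR q * t) = trig_poly (q * S M) ca cb t).
    { intros t. rewrite Etp. unfold R1, R2, P. field. lra. }
    intros x. apply is_derive_ext with (fun x => / INR q ^ 2 * P (INR q * x)).
    - exact EV.
    - assert (Dq : is_derive (fun x => INR q * x) x (INR q)) by (auto_derive; trivial; ring).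
      pose proof (is_derive_scal _ x (/ INR q ^ 2) _ (is_derive_comp P (fun x => INR q * x) x _ _ (Df (INR q * x)) Dq)) as D.
      replace (f (INR q * x) / INR q) with (/ INR q ^ 2 * (INR q * f (INR q * x))) by (field; lra). exact D. }
  assert (Hstep := gen_map_step _ _ DV).
  set (F := gen_map (fun x x' => h0 x x' + trig_poly (q * S M) ca cb x')) in *.
  assert (Cf' : continuity (fun x => f (INR q * x) / INR q)).
  { intros x. apply continuity_pt_mult; [| apply continuity_pt_const; intros u v; reflexivity].
    apply (continuity_pt_comp (fun x => INR q * x) f); [| apply Cf].
    apply continuity_pt_mult; [apply continuity_pt_const; intros u v; reflexivity | apply continuity_pt_id]. }
  destruct (circle_icurve C F _ HC1' HC2' Cf' Hstep) as [k [j [g [X [Y [Hic Hlift]]]]]].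
  apply (icurve_rescale f q p) in Hic; trivial.
  destruct (graph_theorem _ _ _ _ _ _ L Hic HL Lf Pf)
    as [G [B [G1 [G2 [G3 [G4 [G5 [G6 [G7 [G8 [G9 G10]]]]]]]]]]].
  assert (Hcm : circle_map f G B) by (constructor; trivial).
  apply (Hno f G B (INR q * omega - IZR p)); trivial.
  + apply (rescaled_rotation F C f G B omega q p X Y); trivial.
  + split; [| exact Hpq]. apply Rabs_pos_lt. intros E.
    apply (Hirr p q Hq0). apply Rmult_eq_reg_l with (INR q); [| lra].
    replace (INR q * (IZR p / INR q)) with (IZR p) by (field; lra). lra.
Qed.
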